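(* Let $l:[0,+\infty)\to[1,+\infty)$ be a non-decreasing function such that $$\ln t=O(l(t))\quad (t\to\infty),\qquad \limsup_{t\to+\infty}\frac{\ln l(t)}{\ln t}<\frac12,\qquad \limsup_{t\to+\infty}\frac{l(Kt)}{l(t)}<+\infty\ \text{ for some } K>1 .$$ Let $\psi\in\mathcal P$ be invertible in the sense of Ehrenpreis, with zero set $\mathcal M=\{\mu_k\}$. Fix $M_0>0$ and let $\mathcal M'\subset\mathcal M$ be defined by $$\mu_k\in\mathcal M'\iff |\mathrm{Im}\,\mu_k|\le M_0\, l\left(|\mathrm{Re}\,\mu_k|\right).$$ For $x\in\mathbb R$ let $m_{\mathrm{Re}}(x,1)$ denote the number of points of the sequence $\mathrm{Re}\,\mathcal M'=\{\mathrm{Re}\,\mu_k:\ \mu_k\in\mathcal M'\}$ contained in the segment $[x-1,x+1]$. Then $$\limsup_{|x|\to\infty}\frac{m_{\mathrm{Re}}(x,1)}{l(|x|)}<\infty .$$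
   Context: $\mathcal P$ (the Schwartz algebra) is the set of Fourier-Laplace transforms $z\mapsto S(e^{-\mathrm{i}tz})$ of compactly supported distributions $S$ on $\mathbb R$ (i.e. $S\in\mathcal E'$, the dual of $\mathcal E=C^\infty(\mathbb R)$). Equivalently (Paley-Wiener-Schwartz), $\mathcal P$ consists of all entire functions of exponential type having at most polynomial growth along the real axis. A function $\varphi\in\mathcal P$, $\varphi\not\equiv 0$, is called invertible in the sense of Ehrenpreis if the division theorem is valid for it: whenever $\Phi\in\mathcal P$ and $\Phi/\varphi$ is entire, one has $\Phi/\varphi\in\mathcal P$. By a known criterion of Ehrenpreis, $\varphi\in\mathcal P$ is invertible in this sense if and only if it is slowly decreasing, i.e. there exists $a>0$ such that for every $x\in\mathbb R$ there is $x'\in\mathbb R$ with $|x-x'|\le a\ln(2+|x|)$ and $|\varphi(x')|\ge(a+|x'|)^{-a}$. The zero set $\mathcal M=\{\mu_k\}$ is the sequence of zeros of $\psi$ in $\mathbb C$ listed with multiplicities, and $m_{\mathrm{Re}}(x,1)$ counts the terms of the sequence of real parts with repetitions (i.e. the number of indices $k$ with $\mu_k\in\mathcal M'$ and $\mathrm{Re}\,\mu_k\in[x-1,x+1]$). *)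

(* Defs.v *)
From Stdlib Require Export Reals List.
From Coquelicot Require Export Coquelicot.
Open Scope R_scope.

(* The space E = C^oo(R) of complex-valued functions, with derivatives taken
   on real and imaginary parts. *)

Definition smooth (f : R -> C) : Prop :=
  forall n t, ex_derive_n (fun s => Re (f s)) n t /\
              ex_derive_n (fun s => Im (f s)) n t.

Definition CDerive_n (f : R -> C) (n : nat) (t : R) : C :=
  (Derive_n (fun s => Re (f s)) n t, Derive_n (fun s => Im (f s)) n t).

(* A linear functional on the Frechet space E is continuous iff it is dominated
   by one of the seminorms p_{N,A}(f) = max_{j<=N} sup_{|t|<=A} |f^(j)(t)|.  In
   the last clause B ranges over the upper bounds of p_{N,A}(f), so the clause
   says |S f| <= c * p_{N,A}(f).  Only the values of S on smooth functions
   matter. *)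
Definition compactly_supported_distribution (S : (R -> C) -> C) : Prop :=
  (forall f g, smooth f -> smooth g ->
     S (fun t => (f t + g t)%C) = (S f + S g)%C) /\
  (forall (a : C) f, smooth f -> S (fun t => (a * f t)%C) = (a * S f)%C) /\
  (exists (N : nat) (A c : R), 0 <= A /\ 0 <= c /\
     forall f, smooth f ->
     forall B : R,
       (forall j t, (j <= N)%nat -> Rabs t <= A -> Cmod (CDerive_n f j t) <= B) ->
       Cmod (S f) <= c * B).

Definition Cexp (z : C) : C :=
  (exp (Re z) * cos (Im z), exp (Re z) * sin (Im z)).

Definition Fourier_Laplace (S : (R -> C) -> C) (z : C) : C :=
  S (fun t : R => Cexp (- (Ci * (RtoC t * z)))%C).

Definition Schwartz_algebra (phi : C -> C) : Prop :=
  exists S, compactly_supported_distribution S /\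
            forall z, phi z = Fourier_Laplace S z.

Definition entire (f : C -> C) : Prop :=
  forall z : C, @ex_derive C_AbsRing C_NormedModule f z.

(* "Phi / phi is entire" means that the quotient extends to an entire function
   q across the zeros of phi. *)
Definition Ehrenpreis_invertible (phi : C -> C) : Prop :=
  Schwartz_algebra phi /\
  (exists z, phi z <> RtoC 0) /\
  (forall Phi q : C -> C,
     Schwartz_algebra Phi -> entire q ->
     (forall z, phi z <> RtoC 0 -> q z = (Phi z / phi z)%C) ->
     Schwartz_algebra q).

Definition zero_order (f : C -> C) (z : C) (m : nat) : Prop :=
  exists g : C -> C, entire g /\ g z <> RtoC 0 /\
    forall w, f w = (Cpow (w - z) m * g w)%C.

(* Number of elements of a set of indices: the supremum of the sizes of its
   finite subsets, hence p_infty when the set is infinite. *)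
Definition card {I : Type} (J : I -> Prop) : Rbar :=
  Lub_Rbar (fun r => exists s : list I,
    NoDup s /\ (forall k, In k s -> J k) /\ r = INR (length s)).

(* mu lists the zeros of f with multiplicities: every complex number is listed
   as many times as its order as a zero of f (0 times when it is not a zero). *)
Definition zero_sequence (f : C -> C) {I : Type} (mu : I -> C) : Prop :=
  forall z : C, exists m : nat,
    zero_order f z m /\ card (fun k => mu k = z) = Finite (INR m).

Definition low_zero (l : R -> R) (M0 : R) (mu : C) : Prop :=
  Rabs (Im mu) <= M0 * l (Rabs (Re mu)).

Definition m_Re (l : R -> R) (M0 : R) {I : Type} (mu : I -> C) (x : R) : Rbar :=
  card (fun k => low_zero l M0 (mu k) /\ x - 1 <= Re (mu k) <= x + 1).

(* Upper limit of f along F: the infimum of the eventual upper bounds of f. *)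
Definition limsup (F : (R -> Prop) -> Prop) (f : R -> Rbar) : Rbar :=
  Rbar_glb (fun M : Rbar => F (fun x => Rbar_le (f x) M)).

(* The filter of the limits |x| -> +oo. *)
Definition abs_infty (P : R -> Prop) : Prop :=
  exists M : R, forall x, M < Rabs x -> P x.

(* Main.v *)
Require Import Defs.
From Stdlib Require Import Lra Lia Psatz FunctionalExtensionality Classical ClassicalEpsilon.
From Stdlib Require FinFun.

(** Let x be real with |x| large and L = ln(2 + |x|), a quantity that is O(l(|x|)).

    Slow decrease. There is a point z at distance O(L) from x where
    |psi z| >= e^(- a L) ([slowly_decreasing]). The zeros counted by m_Re(x, 1) and
    the point z all lie in one disc of radius R = O(l(|x|)), by the doubling
    property of l. It remains to see that n zeros in such a disc force
    |psi z| <= C e^(- n) e^(O(l(|x|))): comparing the two bounds gives n = O(l(|x|)).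

    Many zeros make psi small ([many_zeros_small], in the role of Jensen's
    inequality). If psi is the transform of S and psi mu = 0, then psi / (z - mu)
    is the transform of f |-> S (- i g), where g is the solution of
    g' = - i mu g + f with g 0 = 0 ([FL_resolvent]). On functions that grow like
    e^((c + r) |t|), with c >= |Im mu|, the operator f |-> g has norm at most 2 / r.
    Dividing by n zeros at distance at most R from z and multiplying back by the
    n factors z - mu therefore changes the size of psi z by (2 R / r)^n, which is
    e^(- n) for r = 2 e R. The same estimate shows that a transform that vanishes
    on a real segment is zero ([FL_eq_0_of_segment]).

    Slow decrease follows from the division property. If it fails, there are
    points x_j and numbers a_j -> oo such that psi is smaller than
    e^(- a_j L_j) on the real interval of radius a_j L_j around x_j. Consider the
    peaks p_j(z) = (2 sinc ((z - x_j) / k_j))^(k_j), with k_j even and comparable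
    to a_j L_j. At x_j the peak is 2^(k_j), more than any fixed power of |x_j|;
    but p_j psi is at most e^(- j) / (2 + |y|)^2 on the whole real line, near x_j
    because psi is small there and away from x_j because p_j is
    ([peak_product_bound]). The x_j can be taken so sparse that q = sum_j p_j is
    entire; q is not polynomially bounded on the real line, hence is not a
    transform. But q psi is one, which contradicts the division property.

    Why q psi is a transform. Multiplication by sinc ((z - x) / k) averages the
    distribution and lowers its order ([distribution_avg]), so p_j psi is the
    transform of a distribution of order 0. Such a transform of exponential type
    less than b is determined by its samples at the nodes +-(n + 1/2) pi / b, and
    the functional that pairs a test function with the Fourier series of these
    samples has the same transform ([distribution_from_samples]). Its norm is at
    most a constant times the sum of the moduli of the samples, that is O(e^(- j)),
    so that the functionals can be added up. The sampling theorem itself rests on the expansion of the wave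
    e^(- i t x) in the waves of the nodes, uniformly on |t| <= a < b
    ([sampling_sum_cvg]). *)

(** * Waves and calculus for complex-valued functions *)

Definition wave (z : C) (t : R) : C := Cexp (- (Ci * (RtoC t * z)))%C.

Lemma wave_val z t :
  wave z t = (exp (t * Im z) * cos (t * Re z), - (exp (t * Im z) * sin (t * Re z))).
Proof.
  unfold wave, Cexp; destruct z as [x y]; simpl.
  replace (- (0 * (t * x - 0 * y) - 1 * (t * y + 0 * x))) with (t * y) by ring.
  replace (- (0 * (t * y + 0 * x) + 1 * (t * x - 0 * y))) with (- (t * x)) by ring.
  rewrite cos_neg, sin_neg; f_equal; ring.
Qed.

Lemma Cmod_wave z t : Cmod (wave z t) = exp (t * Im z).
Proof.
  rewrite wave_val; unfold Cmod; simpl.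
  generalize (sin2_cos2 (t * Re z)) (exp_pos (t * Im z)).
  set (e := exp _) in *; set (a := sin _) in *; set (b := cos _) in *.
  unfold Rsqr; intros H He.
  transitivity (sqrt (Rsqr e)); [|apply sqrt_Rsqr; lra].
  f_equal; unfold Rsqr.
  transitivity (e * e * (a * a + b * b)); [|rewrite H]; ring.
Qed.

Lemma wave_mult_opp z t : (wave z t * wave (- z) t = 1)%C.
Proof.
  rewrite !wave_val; destruct z as [x y]; unfold Cmult; simpl.
  replace (t * - y) with (- (t * y)) by ring.
  replace (t * - x) with (- (t * x)) by ring.
  rewrite exp_Ropp, cos_neg, sin_neg.
  generalize (sin2_cos2 (t * x)); unfold Rsqr; intros H.
  generalize (exp_pos (t * y)); intros He.
  set (e := exp _) in *; set (a := sin _) in *; set (b := cos _) in *.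
  apply injective_projections; simpl.
  - transitivity (a * a + b * b); [field; lra | exact H].
  - field; lra.
Qed.

Lemma wave_plus z w t : (wave (z + w) t = wave z t * wave w t)%C.
Proof.
  rewrite !wave_val; destruct z as [x y], w as [u v]; unfold Cmult; simpl.
  rewrite !Rmult_plus_distr_l, exp_plus, cos_plus, sin_plus.
  apply injective_projections; simpl; ring.
Qed.

Lemma wave_shift z s t : (wave z (s + t) = wave z s * wave z t)%C.
Proof.
  rewrite !wave_val; destruct z as [x y]; unfold Cmult; simpl.
  rewrite !Rmult_plus_distr_r, exp_plus, cos_plus, sin_plus.
  apply injective_projections; simpl; ring.
Qed.

Lemma wave_0_l t : (wave 0 t = 1)%C.
Proof. rewrite wave_val; simpl; rewrite !Rmult_0_r, exp_0, cos_0, sin_0.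
  apply injective_projections; simpl; ring. Qed.

Lemma wave_0_r z : (wave z 0 = 1)%C.
Proof. rewrite wave_val; rewrite !Rmult_0_l, exp_0, cos_0, sin_0.
  apply injective_projections; simpl; ring. Qed.

Definition is_Cderive (f : R -> C) (t : R) (d : C) : Prop :=
  is_derive (fun s => Re (f s)) t (Re d) /\ is_derive (fun s => Im (f s)) t (Im d).

Lemma is_Cderive_ext_d f t d d' : is_Cderive f t d -> d = d' -> is_Cderive f t d'.
Proof. intros H <-; exact H. Qed.

Lemma is_Cderive_const c t : is_Cderive (fun _ => c) t 0.
Proof. split; simpl; apply @is_derive_const. Qed.

Lemma is_Cderive_plus f g t a b :
  is_Cderive f t a -> is_Cderive g t b -> is_Cderive (fun s => f s + g s)%C t (a + b)%C.
Proof.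
  intros [H1 H2] [H3 H4]; split; simpl;
  [ exact (is_derive_plus (fun s => Re (f s)) (fun s => Re (g s)) _ _ _ H1 H3)
  | exact (is_derive_plus (fun s => Im (f s)) (fun s => Im (g s)) _ _ _ H2 H4)].
Qed.

Lemma is_Cderive_mult f g t a b : is_Cderive f t a -> is_Cderive g t b ->
  is_Cderive (fun s => f s * g s)%C t (a * g t + f t * b)%C.
Proof.
  intros [H1 H2] [H3 H4]; split; simpl.
  - evar_last.
    + apply @is_derive_minus;
      [ exact (is_derive_mult (fun s => Re (f s)) (fun s => Re (g s)) _ _ _ H1 H3 Rmult_comm)
      | exact (is_derive_mult (fun s => Im (f s)) (fun s => Im (g s)) _ _ _ H2 H4 Rmult_comm)].
    + unfold minus, plus, opp, mult; simpl; unfold Re, Im; ring.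
  - evar_last.
    + apply @is_derive_plus;
      [ exact (is_derive_mult (fun s => Re (f s)) (fun s => Im (g s)) _ _ _ H1 H4 Rmult_comm)
      | exact (is_derive_mult (fun s => Im (f s)) (fun s => Re (g s)) _ _ _ H2 H3 Rmult_comm)].
    + unfold minus, plus, opp, mult; simpl; unfold Re, Im; ring.
Qed.

Lemma is_Cderive_scal c f t a : is_Cderive f t a -> is_Cderive (fun s => c * f s)%C t (c * a)%C.
Proof.
  intros H; eapply is_Cderive_ext_d; [apply is_Cderive_mult; [apply is_Cderive_const | exact H] |
    cbv beta; ring].
Qed.

Lemma is_Cderive_shift f e t a : is_Cderive f (t + e) a -> is_Cderive (fun s => f (s + e)) t a.
Proof.
  intros [H1 H2]; split.
  - evar_last.
    + apply (is_derive_comp (fun s => Re (f s)) (fun s => s + e)); [exact H1|].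
      apply @is_derive_plus; [apply @is_derive_id | apply @is_derive_const].
    + unfold scal, plus, zero, one; simpl; unfold mult; simpl; ring.
  - evar_last.
    + apply (is_derive_comp (fun s => Im (f s)) (fun s => s + e)); [exact H2|].
      apply @is_derive_plus; [apply @is_derive_id | apply @is_derive_const].
    + unfold scal, plus, zero, one; simpl; unfold mult; simpl; ring.
Qed.

Lemma is_Cderive_wave z t : is_Cderive (wave z) t (- Ci * z * wave z t)%C.
Proof.
  split.
  - apply (is_derive_ext (fun s => exp (s * Im z) * cos (s * Re z))).
    { intros s; rewrite wave_val; reflexivity. }
    auto_derive; [easy|]. rewrite wave_val; destruct z; simpl; ring.
  - apply (is_derive_ext (fun s => - (exp (s * Im z) * sin (s * Re z)))).
    { intros s; rewrite wave_val; reflexivity. }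
    auto_derive; [easy|]. rewrite wave_val; destruct z; simpl; ring.
Qed.

Lemma is_Cderive_RtoC_id t : is_Cderive (fun s => RtoC s) t 1.
Proof. split; simpl; [apply @is_derive_id | apply @is_derive_const]. Qed.

(** * Smooth functions and distributions with explicit constants *)

(** A function presented with all its derivatives. Everything below is built from
    waves by operations whose effect on derivatives is explicit, so estimates are
    proved on jets and transferred to [CDerive_n] once and for all. *)
Definition jet (d : nat -> R -> C) : Prop := forall j t, is_Cderive (d j) t (d (S j) t).

Lemma jet_Derive_n d j t : jet d -> CDerive_n (d O) j t = d j t /\
   ex_derive_n (fun s => Re (d O s)) j t /\ ex_derive_n (fun s => Im (d O s)) j t.
Proof.
  intros Hd.
  assert (HR : forall j t, Derive_n (fun s => Re (d O s)) j t = Re (d j t)).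
  { clear j t; induction j as [|j IH]; intros t; [reflexivity|].
    simpl. rewrite (Derive_ext _ (fun s => Re (d j s)) _ IH).
    apply is_derive_unique; apply Hd. }
  assert (HI : forall j t, Derive_n (fun s => Im (d O s)) j t = Im (d j t)).
  { clear j t HR; induction j as [|j IH]; intros t; [reflexivity|].
    simpl. rewrite (Derive_ext _ (fun s => Im (d j s)) _ IH).
    apply is_derive_unique; apply Hd. }
  split.
  - unfold CDerive_n; rewrite HR, HI; destruct (d j t); reflexivity.
  - destruct j as [|j]; [split; exact Logic.I|]; simpl; split.
    + apply (ex_derive_ext (fun s => Re (d j s))); [intros s; symmetry; apply HR|].
      exists (Re (d (S j) t)); apply (proj1 (Hd j t)).
    + apply (ex_derive_ext (fun s => Im (d j s))); [intros s; symmetry; apply HI|].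
      exists (Im (d (S j) t)); apply (proj2 (Hd j t)).
Qed.

Lemma jet_smooth d : jet d -> smooth (d O).
Proof. intros Hd n t; apply (jet_Derive_n d n t Hd). Qed.

Lemma smooth_jet f : smooth f -> jet (CDerive_n f).
Proof.
  intros Hf j t; destruct (Hf (S j) t) as [H1 H2].
  split; [exact (Derive_correct _ _ H1) | exact (Derive_correct _ _ H2)].
Qed.

Lemma CDerive_0 f : CDerive_n f 0 = f.
Proof. apply functional_extensionality; intros t; unfold CDerive_n; simpl;
  destruct (f t); reflexivity. Qed.

Lemma smooth_iff_jet f : smooth f <-> exists d, jet d /\ d O = f.
Proof.
  split.
  - intros H; exists (CDerive_n f); split; [now apply smooth_jet | apply CDerive_0].
  - intros (d & Hd & <-); now apply jet_smooth.
Qed.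

Lemma jet_plus d e : jet d -> jet e -> jet (fun j t => d j t + e j t)%C.
Proof. intros Hd He j t; apply is_Cderive_plus; [apply Hd | apply He]. Qed.

Lemma jet_scal c d : jet d -> jet (fun j t => c * d j t)%C.
Proof. intros Hd j t; apply is_Cderive_scal; apply Hd. Qed.

Lemma jet_shift a d : jet d -> jet (fun j t => d j (t + a)).
Proof. intros Hd j t; apply (is_Cderive_shift (d j)); apply Hd. Qed.

Lemma jet_wave z : jet (fun j t => Cpow (- Ci * z) j * wave z t)%C.
Proof.
  intros j t; eapply is_Cderive_ext_d; [apply is_Cderive_scal, is_Cderive_wave |].
  simpl; ring.
Qed.

(** The order, the radius of the support and the constant are explicit because
    the proof tracks how each operation changes them. *)
Definition distribution (N : nat) (A c : R) (S : (R -> C) -> C) : Prop :=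
  (forall d e, jet d -> jet e -> S (fun t => d O t + e O t)%C = (S (d O) + S (e O))%C) /\
  (forall (a : C) d, jet d -> S (fun t => a * d O t)%C = (a * S (d O))%C) /\
  0 <= A /\ 0 <= c /\
  (forall d B, jet d ->
     (forall j t, (j <= N)%nat -> Rabs t <= A -> Cmod (d j t) <= B) ->
     Cmod (S (d O)) <= c * B).

Definition FL := Fourier_Laplace.

Lemma compactly_supported_distribution_iff S :
  compactly_supported_distribution S <-> exists N A c, distribution N A c S.
Proof.
  split.
  - intros (H1 & H2 & N & A & c & HA & Hc & H3).
    exists N, A, c; repeat split; auto.
    + intros d e Hd He; apply H1; now apply jet_smooth.
    + intros a d Hd; apply H2; now apply jet_smooth.
    + intros d B Hd HB; apply H3; [now apply jet_smooth|].
      intros j t Hj Ht. rewrite (proj1 (jet_Derive_n d j t Hd)); auto.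
  - intros (N & A & c & H1 & H2 & HA & Hc & H3); split; [|split].
    + intros f g Hf Hg. apply smooth_iff_jet in Hf; apply smooth_iff_jet in Hg.
      destruct Hf as (d & Hd & <-), Hg as (e & He & <-); auto.
    + intros a f Hf; apply smooth_iff_jet in Hf; destruct Hf as (d & Hd & <-); auto.
    + exists N, A, c; repeat split; auto.
      intros f Hf B HB; apply smooth_iff_jet in Hf; destruct Hf as (d & Hd & <-).
      apply H3; auto. intros j t Hj Ht. rewrite <- (proj1 (jet_Derive_n d j t Hd)); auto.
Qed.

Lemma smooth_wave z : smooth (wave z).
Proof.
  apply smooth_iff_jet; eexists; split; [apply (jet_wave z)|].
  apply functional_extensionality; intros t; simpl; ring.
Qed.

Lemma smooth_plus f g : smooth f -> smooth g -> smooth (fun t => f t + g t)%C.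
Proof.
  rewrite !smooth_iff_jet; intros (d & Hd & <-) (e & He & <-).
  eexists; split; [exact (jet_plus d e Hd He) | reflexivity].
Qed.

Lemma smooth_scal a f : smooth f -> smooth (fun t => a * f t)%C.
Proof.
  rewrite !smooth_iff_jet; intros (d & Hd & <-).
  eexists; split; [exact (jet_scal a d Hd) | reflexivity].
Qed.

Lemma smooth_is_Cderive f : smooth f -> exists f', forall t, is_Cderive f t (f' t).
Proof.
  rewrite smooth_iff_jet; intros (d & Hd & <-); exists (d 1%nat); apply Hd.
Qed.

Section Dist_linear.
Context {N A c S} (HS : distribution N A c S).
Lemma distribution_plus f g : smooth f -> smooth g -> S (fun t => f t + g t)%C = (S f + S g)%C.
Proof.
  rewrite !smooth_iff_jet; intros (d & Hd & <-) (e & He & <-); now apply HS.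
Qed.
Lemma distribution_scal a f : smooth f -> S (fun t => a * f t)%C = (a * S f)%C.
Proof.
  rewrite !smooth_iff_jet; intros (d & Hd & <-); now apply HS.
Qed.
End Dist_linear.

Definition Ccontinuous (f : R -> C) : Prop :=
  forall t, continuous (fun s => Re (f s)) t /\ continuous (fun s => Im (f s)) t.

Lemma is_Cderive_Ccontinuous f f' : (forall t, is_Cderive f t (f' t)) -> Ccontinuous f.
Proof.
  intros H t; destruct (H t) as [H1 H2]; split; apply @ex_derive_continuous;
  eexists; eassumption.
Qed.

Lemma smooth_Ccontinuous f : smooth f -> Ccontinuous f.
Proof. intros H; destruct (smooth_is_Cderive f H) as (f' & Hf);
  exact (is_Cderive_Ccontinuous f f' Hf). Qed.

Lemma Ccontinuous_mult f g :
  Ccontinuous f -> Ccontinuous g -> Ccontinuous (fun t => f t * g t)%C.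
Proof.
  intros Hf Hg t; destruct (Hf t) as [H1 H2], (Hg t) as [H3 H4]; split; simpl.
  - apply @continuous_minus; apply @continuous_mult; assumption.
  - apply @continuous_plus; apply @continuous_mult; assumption.
Qed.

Definition CInt (g : R -> C) (a b : R) : C :=
  (RInt (fun s => Re (g s)) a b, RInt (fun s => Im (g s)) a b).

Lemma is_Cderive_CInt g a t : Ccontinuous g -> is_Cderive (CInt g a) t (g t).
Proof.
  intros Hg.
  assert (Hr : forall h : R -> R, (forall s, continuous h s) ->
     is_derive (fun s => RInt h a s) t (h t)).
  { intros h Hh; apply (is_derive_RInt h (RInt h a) a); [|apply Hh].
    exists (mkposreal 1 Rlt_0_1); intros x _; apply @RInt_correct.
    apply @ex_RInt_continuous; intros z _; apply Hh. }
  split.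
  - exact (Hr (fun s => Re (g s)) (fun s => proj1 (Hg s))).
  - exact (Hr (fun s => Im (g s)) (fun s => proj2 (Hg s))).
Qed.

Lemma CInt_point g a : CInt g a a = 0%C.
Proof. unfold CInt; rewrite !RInt_point; reflexivity. Qed.

Lemma is_Cderive_zero_const (f : R -> C) : (forall t, is_Cderive f t 0) -> forall t, f t = f 0.
Proof.
  intros H t.
  assert (Hr : forall h : R -> R, (forall s, is_derive h s 0) -> h t = h 0).
  { intros h Hh; generalize (bounded_variation h (fun _ => 0) 0 0 t); intros Hb.
    assert (Hb' : Rabs (h t - h 0) <= 0 * Rabs (t - 0)).
    { apply Hb; intros s _; split; [apply Hh | rewrite Rabs_R0; lra]. }
    rewrite Rmult_0_l in Hb'; generalize (Rabs_pos (h t - h 0)); intros Hp.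
    destruct (Req_dec (h t - h 0) 0) as [|Hn]; [lra|].
    apply Rabs_pos_lt in Hn; lra. }
  apply injective_projections.
  - apply (Hr (fun s => Re (f s))); intros s; apply H.
  - apply (Hr (fun s => Im (f s))); intros s; apply H.
Qed.

Lemma CInt_0 f F a b :
  Ccontinuous f -> (forall t, is_Cderive F t (f t)) -> CInt f a b = (F b - F a)%C.
Proof.
  intros Hf HF.
  assert (H : forall t, (CInt f a t + (-1) * F t)%C = (CInt f a 0 + (-1) * F 0)%C).
  { apply (is_Cderive_zero_const (fun t => CInt f a t + (-1) * F t)%C); intros t.
    eapply is_Cderive_ext_d; [apply is_Cderive_plus; [now apply is_Cderive_CInt |
      apply is_Cderive_scal, HF] | ].
    apply injective_projections; simpl; ring. }
  generalize (H b) (H a); rewrite CInt_point; intros Hb Ha.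
  rewrite <- Ha in Hb.
  transitivity ((CInt f a b + (-1) * F b) + F b)%C; [ring|]. rewrite Hb; ring.
Qed.

(** * Dividing a transform by z - mu *)

(** The solution of g' = - i mu g + f with g 0 = 0, by variation of constants. *)
Definition resolvent (mu : C) (f : R -> C) (t : R) : C :=
  (wave mu t * CInt (fun s => wave (- mu) s * f s) 0 t)%C.

Lemma is_Cderive_resolvent mu f t :
  Ccontinuous f -> is_Cderive (resolvent mu f) t (- Ci * mu * resolvent mu f t + f t)%C.
Proof.
  intros Hf; unfold resolvent; eapply is_Cderive_ext_d.
  - apply is_Cderive_mult; [apply is_Cderive_wave | apply is_Cderive_CInt].
    apply Ccontinuous_mult; [apply smooth_Ccontinuous, smooth_wave | exact Hf].
  - cbv beta. transitivity (- Ci * mu * (wave mu t * CInt (fun s : R => wave (- mu) s * f s) 0 t)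
       + (wave mu t * wave (- mu) t) * f t)%C; [ring|].
    rewrite wave_mult_opp; ring.
Qed.

Lemma resolvent_0 mu f : resolvent mu f 0 = 0%C.
Proof. unfold resolvent; rewrite CInt_point; ring. Qed.

(** Linearity of the operator and its action on waves come from uniqueness, which
    holds because a solution of the homogeneous equation times the opposite wave
    is constant. *)
Lemma resolvent_unique mu f (u : R -> C) : Ccontinuous f -> u 0 = 0%C ->
  (forall t, is_Cderive u t (- Ci * mu * u t + f t)%C) -> resolvent mu f = u.
Proof.
  intros Hf H0 Hu; apply functional_extensionality; intros t.
  assert (H : forall t, (wave (- mu) t * (resolvent mu f t + (-1) * u t))%C
                      = (wave (- mu) 0 * (resolvent mu f 0 + (-1) * u 0))%C).
  { apply (is_Cderive_zero_const (fun t => wave (- mu) t * (resolvent mu f t + (-1) * u t))%C);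
    intros s.
    eapply is_Cderive_ext_d.
    - apply is_Cderive_mult; [apply is_Cderive_wave | apply is_Cderive_plus;
      [now apply is_Cderive_resolvent | apply is_Cderive_scal, Hu]].
    - cbv beta; ring. }
  specialize (H t); rewrite resolvent_0, H0 in H.
  replace (wave (- mu) 0 * (0 + (-1) * 0))%C with (RtoC 0) in H by ring.
  assert (H' : (resolvent mu f t + -1 * u t = 0)%C).
  { transitivity ((wave mu t * wave (- mu) t) * (resolvent mu f t + -1 * u t))%C.
    - rewrite wave_mult_opp; ring.
    - rewrite <- Cmult_assoc, H; ring. }
  transitivity ((resolvent mu f t + -1 * u t) + u t)%C; [ring | rewrite H'; ring].
Qed.

Fixpoint resolvent_jet (mu : C) (d : nat -> R -> C) (j : nat) (t : R) : C :=
  match j with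
  | O => resolvent mu (d O) t
  | S i => (- Ci * mu * resolvent_jet mu d i t + d i t)%C
  end.

Lemma jet_Ccontinuous d j : jet d -> Ccontinuous (d j).
Proof. intros Hd; exact (is_Cderive_Ccontinuous _ _ (Hd j)). Qed.

Lemma jet_resolvent mu d : jet d -> jet (resolvent_jet mu d).
Proof.
  intros Hd j; induction j as [|j IH]; intros t.
  - apply is_Cderive_resolvent; now apply jet_Ccontinuous.
  - simpl. apply (is_Cderive_plus (fun t => - Ci * mu * resolvent_jet mu d j t)%C (d j)).
    + eapply is_Cderive_ext_d; [apply is_Cderive_scal, IH | reflexivity].
    + apply Hd.
Qed.

Lemma smooth_resolvent mu f : smooth f -> smooth (resolvent mu f).
Proof.
  rewrite !smooth_iff_jet; intros (d & Hd & <-).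
  exists (resolvent_jet mu d); split; [now apply jet_resolvent | reflexivity].
Qed.

Lemma resolvent_plus mu f g : Ccontinuous f -> Ccontinuous g ->
  resolvent mu (fun t => f t + g t)%C = (fun t => resolvent mu f t + resolvent mu g t)%C.
Proof.
  intros Hf Hg; refine (resolvent_unique _ _ _ _ _ _).
  - intros t; destruct (Hf t), (Hg t); split; simpl; apply @continuous_plus; assumption.
  - rewrite !resolvent_0; ring.
  - intros t; eapply is_Cderive_ext_d; [apply is_Cderive_plus; now apply is_Cderive_resolvent | ring].
Qed.

Lemma resolvent_scal mu a f :
  Ccontinuous f -> resolvent mu (fun t => a * f t)%C = (fun t => a * resolvent mu f t)%C.
Proof.
  intros Hf; refine (resolvent_unique _ _ _ _ _ _).
  - apply Ccontinuous_mult; [|exact Hf].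
    apply (is_Cderive_Ccontinuous _ (fun _ => 0%C)); intros t; apply is_Cderive_const.
  - rewrite resolvent_0; ring.
  - intros t; eapply is_Cderive_ext_d; [apply is_Cderive_scal; now apply is_Cderive_resolvent | ring].
Qed.

(** On waves the operator is a divided difference in the frequency: this is why it
    divides transforms. *)
Lemma resolvent_wave mu z t :
  (- Ci * (z - mu) * resolvent mu (wave z) t = wave z t - wave mu t)%C.
Proof.
  assert (HE : Ccontinuous (wave z)) by apply smooth_Ccontinuous, smooth_wave.
  change ((fun t => - Ci * (z - mu) * resolvent mu (wave z) t) t = wave z t - wave mu t)%C.
  rewrite <- (resolvent_scal mu _ _ HE).
  rewrite (resolvent_unique mu _ (fun t => wave z t + (-1) * wave mu t)%C); [ring| | |].
  - apply Ccontinuous_mult; [|exact HE].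
    apply (is_Cderive_Ccontinuous _ (fun _ => 0%C)); intros s; apply is_Cderive_const.
  - rewrite !wave_0_r; apply injective_projections; simpl; ring.
  - intros s; eapply is_Cderive_ext_d; [apply is_Cderive_plus; [apply is_Cderive_wave |
    apply is_Cderive_scal, is_Cderive_wave] | ring].
Qed.

(** * Norm estimates for the division operators *)

Lemma exp_le_mono x y : x <= y -> exp x <= exp y.
Proof. intros [H| ->]; [left; now apply exp_increasing | right; reflexivity]. Qed.

Lemma deriv_nonneg_le (k k' : R -> R) (t : R) : 0 <= t ->
  (forall s, 0 <= s <= t -> is_derive k s (k' s) /\ 0 <= k' s) -> k 0 <= k t.
Proof.
  intros Ht H.
  destruct (MVT_gen k 0 t k') as (x & Hx & He).
  - rewrite Rmin_left, Rmax_right by lra; intros x Hx; apply H; lra.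
  - rewrite Rmin_left, Rmax_right by lra; intros x Hx.
    apply continuity_pt_filterlim. apply @ex_derive_continuous.
    exists (k' x); apply H; lra.
  - rewrite Rmin_left, Rmax_right in Hx by lra.
    generalize (proj2 (H x Hx)); intros Hk; nra.
Qed.

Lemma exp_growth_pos (h h' : R -> R) D r t : 0 < r -> 0 <= t -> 0 <= D -> h 0 = 0 ->
  (forall s, 0 <= s <= t -> is_derive h s (h' s) /\ h' s <= D * exp (r * s)) ->
  h t <= D / r * exp (r * t).
Proof.
  intros Hr Ht HD H0 H.
  assert (Hm := deriv_nonneg_le (fun s => D / r * exp (r * s) - h s)
     (fun s => D * exp (r * s) - h' s) t Ht).
  cbv beta in Hm; rewrite Rmult_0_r, exp_0, H0 in Hm.
  assert (HDr : 0 <= D / r) by (apply Rdiv_le_0_compat; lra).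
  cut (D / r * 1 - 0 <= D / r * exp (r * t) - h t); [lra|].
  apply Hm; intros s Hs; destruct (H s Hs) as [H1 H2]; split; [|lra].
  apply (is_derive_minus (fun s => D / r * exp (r * s)) h); [|exact H1].
  auto_derive; [easy|]. field; lra.
Qed.

(** Comparison with the primitive of the majorant, on both sides of 0. *)
Lemma exp_growth (h h' : R -> R) D r t : 0 < r -> 0 <= D -> h 0 = 0 ->
  (forall s, Rmin 0 t <= s <= Rmax 0 t ->
     is_derive h s (h' s) /\ Rabs (h' s) <= D * exp (r * Rabs s)) ->
  Rabs (h t) <= D / r * exp (r * Rabs t).
Proof.
  intros Hr HD H0 H.
  assert (Hpos : forall (g g' : R -> R) u, 0 <= u -> g 0 = 0 ->
     (forall s, 0 <= s <= u -> is_derive g s (g' s) /\ Rabs (g' s) <= D * exp (r * s)) ->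
     Rabs (g u) <= D / r * exp (r * u)).
  { intros g g' u Hu Hg0 Hg; apply Rabs_le; split.
    - cut (- g u <= D / r * exp (r * u)); [lra|].
      apply (exp_growth_pos (fun s => - g s) (fun s => - g' s)); try lra.
      intros s Hs; destruct (Hg s Hs) as [H1 H2]; split.
      + exact (is_derive_opp g s _ H1).
      + apply Rabs_le_between in H2; lra.
    - apply (exp_growth_pos g g'); try lra.
      intros s Hs; destruct (Hg s Hs) as [H1 H2]; split; [exact H1|].
      apply Rabs_le_between in H2; lra. }
  destruct (Rle_dec 0 t) as [Ht|Ht].
  - rewrite Rmin_left, Rmax_right in H by lra.
    rewrite (Rabs_pos_eq t Ht) in *; apply (Hpos h h'); auto.
    intros s Hs; specialize (H s); rewrite (Rabs_pos_eq s) in H by lra; apply H; lra.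
  - rewrite Rmin_right, Rmax_left in H by lra.
    rewrite (Rabs_left t) in * by lra.
    replace (h t) with (h (- - t)) by (f_equal; ring).
    apply (Hpos (fun s => h (- s)) (fun s => - h' (- s))); [lra | rewrite Ropp_0; auto |].
    intros s Hs; specialize (H (- s)); rewrite Rabs_Ropp, (Rabs_pos_eq s) in H by lra.
    destruct H as [H1 H2]; [lra|]; split; [|rewrite Rabs_Ropp; exact H2].
    evar_last; [apply (is_derive_comp h (fun s => - s)); [exact H1|]|].
    + apply @is_derive_opp, @is_derive_id.
    + unfold scal, opp, one; simpl; unfold mult; simpl; ring.
Qed.

Lemma Cmod_le_ReIm z B : Rabs (Re z) <= B -> Rabs (Im z) <= B -> Cmod z <= 2 * B.
Proof.
  intros H1 H2; destruct z as [x y]; simpl in *.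
  replace (x, y) with (RtoC x + Ci * RtoC y)%C.
  - eapply Rle_trans; [apply Cmod_triangle|].
    rewrite Cmod_mult, Cmod_Ci, !Cmod_R; lra.
  - apply injective_projections; simpl; ring.
Qed.

Lemma Rabs_Re_le_Cmod z : Rabs (Re z) <= Cmod z.
Proof. eapply Rle_trans; [apply Rmax_l | apply Rmax_Cmod]. Qed.
Lemma Rabs_Im_le_Cmod z : Rabs (Im z) <= Cmod z.
Proof. eapply Rle_trans; [apply Rmax_r | apply Rmax_Cmod]. Qed.

(** For s between 0 and t the kernel e^(- i mu (t - s)) is at most
    e^(c (|t| - |s|)); against the growth e^((c + r) |s|) of f there remains the
    integral of e^(r |s|), which produces the factor 1 / r. The 2 comes from
    treating real and imaginary parts separately. *)
Lemma resolvent_bound mu f c r D t : Ccontinuous f -> Rabs (Im mu) <= c -> 0 < r -> 0 <= D ->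
  (forall s, Rabs s <= Rabs t -> Cmod (f s) <= D * exp ((c + r) * Rabs s)) ->
  Cmod (resolvent mu f t) <= 2 * D / r * exp ((c + r) * Rabs t).
Proof.
  intros Hf Hc Hr HD H.
  set (g := fun s => (wave mu t * (wave (- mu) s * f s))%C).
  set (G := fun s => (wave mu t * CInt (fun s => wave (- mu) s * f s) 0 s)%C).
  assert (HG : forall s, is_Cderive G s (g s)).
  { intros s; apply is_Cderive_scal, is_Cderive_CInt, Ccontinuous_mult;
    [apply smooth_Ccontinuous, smooth_wave | exact Hf]. }
  assert (HG0 : G 0 = 0%C) by (unfold G; rewrite CInt_point; ring).
  assert (Hg : forall s, Rmin 0 t <= s <= Rmax 0 t ->
             Cmod (g s) <= D * exp (c * Rabs t) * exp (r * Rabs s)).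
  { intros s Hs.
    assert (Hst : Rabs s <= Rabs t /\ Rabs (t - s) = Rabs t - Rabs s).
    { destruct (Rle_dec 0 t) as [Ht|Ht].
      - rewrite Rmin_left, Rmax_right in Hs by lra.
        rewrite !Rabs_pos_eq by lra; lra.
      - rewrite Rmin_right, Rmax_left in Hs by lra.
        rewrite !(Rabs_left1) by lra; lra. }
    destruct Hst as [Hst1 Hst2]; specialize (H s Hst1).
    unfold g; rewrite !Cmod_mult, !Cmod_wave, <- Rmult_assoc, <- exp_plus.
    replace (t * Im mu + s * Im (- mu)%C) with ((t - s) * Im mu)
      by (destruct mu; simpl; ring).
    assert (Hm : (t - s) * Im mu <= c * (Rabs t - Rabs s)).
    { rewrite <- Hst2, (Rmult_comm c). eapply Rle_trans; [apply Rle_abs|].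
      rewrite Rabs_mult; apply Rmult_le_compat_l; [apply Rabs_pos | exact Hc]. }
    apply exp_le_mono in Hm.
    eapply Rle_trans.
    { apply Rmult_le_compat; [left; apply exp_pos | apply Cmod_ge_0 | exact Hm | exact H]. }
    right. rewrite !(Rmult_comm D), !Rmult_assoc, !(Rmult_comm D), <- !Rmult_assoc.
    rewrite <- !exp_plus; do 2 f_equal; ring. }
  assert (HJ : Cmod (G t) <= 2 * (D * exp (c * Rabs t) / r * exp (r * Rabs t))).
  { assert (HD' : 0 <= D * exp (c * Rabs t)) by (generalize (exp_pos (c * Rabs t)); nra).
    apply Cmod_le_ReIm.
    - apply (exp_growth (fun s => Re (G s)) (fun s => Re (g s))); auto.
      + rewrite HG0; reflexivity.
      + intros s Hs; split; [apply HG|].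
        eapply Rle_trans; [apply Rabs_Re_le_Cmod | apply Hg, Hs].
    - apply (exp_growth (fun s => Im (G s)) (fun s => Im (g s))); auto.
      + rewrite HG0; reflexivity.
      + intros s Hs; split; [apply HG|].
        eapply Rle_trans; [apply Rabs_Im_le_Cmod | apply Hg, Hs]. }
  eapply Rle_trans; [exact HJ|].
  rewrite Rmult_plus_distr_r, exp_plus; right; field; lra.
Qed.

(** A weight, with K and kappa to be matched to r, in which division by z - mu has
    norm 2 / r uniformly in the number of derivatives. *)
Definition weighted_bound (N : nat) (A B K kappa : R) (d : nat -> R -> C) : Prop :=
  forall j t, (j <= N)%nat -> Rabs t <= A -> Cmod (d j t) <= B * K ^ j * exp (kappa * Rabs t).

(** Derivatives are read off g' = - i mu g + f. The bound of f is r / 2 times that of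
    g, so one more derivative costs at most |mu| + r, which K = 1 + M + r absorbs. *)
Lemma weighted_bound_resolvent N A B M c r d mu : jet d -> 0 < r -> 0 <= B -> Cmod mu <= M ->
  Rabs (Im mu) <= c ->
  weighted_bound N A B (1 + M + r) (c + r) d ->
  weighted_bound N A (2 * B / r) (1 + M + r) (c + r) (resolvent_jet mu d).
Proof.
  intros Hd Hr HB HM Hc Hw j; induction j as [|j IH]; intros t Hj Ht.
  - simpl; rewrite Rmult_1_r; apply resolvent_bound; auto.
    + now apply jet_Ccontinuous.
    + intros s Hs; generalize (Hw O s (Nat.le_0_l _) (Rle_trans _ _ _ Hs Ht)); simpl.
      now rewrite Rmult_1_r.
  - simpl resolvent_jet; eapply Rle_trans; [apply Cmod_triangle|].
    specialize (IH t (Nat.le_trans _ _ _ (Nat.le_succ_diag_r _) Hj) Ht).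
    generalize (Hw j t (Nat.le_trans _ _ _ (Nat.le_succ_diag_r _) Hj) Ht); intros H2.
    rewrite !Cmod_mult, Cmod_opp, Cmod_Ci, Rmult_1_l.
    assert (HM0 := Cmod_ge_0 mu).
    set (X := (1 + M + r) ^ j * exp ((c + r) * Rabs t)).
    assert (HX : 0 <= X).
    { apply Rmult_le_pos; [apply pow_le; lra | left; apply exp_pos]. }
    replace (B * (1 + M + r) ^ j * exp ((c + r) * Rabs t)) with (B * X) in H2
      by (unfold X; ring).
    replace (2 * B / r * (1 + M + r) ^ j * exp ((c + r) * Rabs t)) with (2 * B / r * X) in IH
      by (unfold X; ring).
    apply Rle_trans with (M * (2 * B / r * X) + B * X).
    { apply Rplus_le_compat; [|exact H2].
      apply Rmult_le_compat; auto; apply Cmod_ge_0. }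
    replace (2 * B / r * (1 + M + r) ^ S j * exp ((c + r) * Rabs t))
      with ((1 + M + r) * (2 * B / r * X)) by (unfold X; simpl; ring).
    assert (HBX : 0 <= B * X) by nra.
    replace (2 * B / r * X) with (2 * / r * (B * X)) by (field; lra).
    assert (Hir : 0 < / r) by (now apply Rinv_0_lt_compat).
    assert (r * (2 * / r * (B * X)) = 2 * (B * X)) by (field; lra).
    assert (0 <= 2 * / r * (B * X)) by nra.
    nra.
Qed.

(** A derivative of g = [resolvent mu f] costs no more than a derivative of f one
    order lower, hence the order drops by one. Iterated averaging uses the first
    form, division by zeros the second. *)
Lemma distribution_resolvent N A c S mu : distribution N A c S ->
  exists c', distribution (pred N) A c' (fun f => S (fun t => - Ci * resolvent mu f t)%C) /\
             distribution N A c' (fun f => S (fun t => - Ci * resolvent mu f t)%C).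
Proof.
  intros HS; destruct HS as (H1 & H2 & HA & Hc & H3).
  set (C0 := 2 * exp ((Rabs (Im mu) + 1) * A)).
  assert (HC0 : 1 <= C0).
  { unfold C0; assert (1 <= exp ((Rabs (Im mu) + 1) * A)); [|lra].
    rewrite <- exp_0 at 1; apply exp_le_mono.
    generalize (Rabs_pos (Im mu)); nra. }
  set (c' := c * (C0 * (1 + Cmod mu) ^ N)).
  assert (HM0 := Cmod_ge_0 mu).
  assert (Hpow : 1 <= (1 + Cmod mu) ^ N) by (apply pow_R1_Rle; lra).
  exists c'.
  assert (Hgen : distribution (pred N) A c' (fun f => S (fun t => - Ci * resolvent mu f t)%C)).
  2:{ split; [exact Hgen|].
      destruct Hgen as (G1 & G2 & GA & Gc & G3); repeat split; auto.
      intros d B Hd HB; apply G3; auto; intros j t Hj Ht; apply HB; auto; lia. }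
  repeat split; auto.
  - intros d e Hd He.
    rewrite (resolvent_plus mu (d O) (e O)) by (now apply jet_Ccontinuous).
    etransitivity;
      [|apply (H1 (fun j t => - Ci * resolvent_jet mu d j t)%C (fun j t => - Ci * resolvent_jet mu
        e j t)%C)].
    + f_equal; apply functional_extensionality; intros t; simpl; ring.
    + apply jet_scal, jet_resolvent, Hd.
    + apply jet_scal, jet_resolvent, He.
  - intros a d Hd.
    rewrite (resolvent_scal mu a (d O)) by (now apply jet_Ccontinuous).
    etransitivity; [|apply (H2 a (fun j t => - Ci * resolvent_jet mu d j t)%C)].
    + f_equal; apply functional_extensionality; intros t; simpl; ring.
    + apply jet_scal, jet_resolvent, Hd.
  - unfold c'; apply Rmult_le_pos; [exact Hc|]; nra.
  - intros d B Hd HB; unfold c'; rewrite Rmult_assoc.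
    apply (H3 (fun j t => - Ci * resolvent_jet mu d j t)%C); [apply jet_scal, jet_resolvent, Hd|].
    assert (HB0 : 0 <= B).
    { eapply Rle_trans; [apply Cmod_ge_0 | apply (HB O 0); [lia | rewrite Rabs_R0; lra]]. }
    assert (Hj : forall j t, (j <= N)%nat -> Rabs t <= A ->
      Cmod (resolvent_jet mu d j t) <= C0 * B * (1 + Cmod mu) ^ j).
    { induction j as [|j IH]; intros t Hj Ht.
      - simpl; rewrite Rmult_1_r.
        eapply Rle_trans.
        + apply (resolvent_bound mu (d O) (Rabs (Im mu)) 1 B); auto; try lra.
          * now apply jet_Ccontinuous.
          * intros s Hs; eapply Rle_trans; [apply (HB O s); [lia | lra]|].
            assert (1 <= exp ((Rabs (Im mu) + 1) * Rabs s)); [|nra].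
            rewrite <- exp_0 at 1; apply exp_le_mono.
            generalize (Rabs_pos (Im mu)) (Rabs_pos s); nra.
        + unfold C0. replace (2 * B / 1) with (2 * B) by field.
          assert (exp ((Rabs (Im mu) + 1) * Rabs t) <= exp ((Rabs (Im mu) + 1) * A)).
          { apply exp_le_mono; generalize (Rabs_pos (Im mu)); nra. }
          nra.
      - simpl resolvent_jet; eapply Rle_trans; [apply Cmod_triangle|].
        rewrite !Cmod_mult, Cmod_opp, Cmod_Ci, Rmult_1_l.
        assert (Hd' : Cmod (d j t) <= B) by (apply HB; [lia | exact Ht]).
        specialize (IH t ltac:(lia) Ht).
        assert (1 <= (1 + Cmod mu) ^ j) by (apply pow_R1_Rle; lra).
        simpl pow.
        assert (B * 1 <= C0 * B * (1 + Cmod mu) ^ j).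
        { rewrite (Rmult_comm C0), Rmult_assoc; apply Rmult_le_compat_l; [lra|nra]. }
        nra. }
    intros j t Hj' Ht; rewrite Cmod_mult, Cmod_opp, Cmod_Ci, Rmult_1_l.
    eapply Rle_trans; [apply Hj; auto|].
    assert ((1 + Cmod mu) ^ j <= (1 + Cmod mu) ^ N) by (apply Rle_pow; [lra | lia]).
    replace (C0 * (1 + Cmod mu) ^ N * B) with (C0 * B * (1 + Cmod mu) ^ N) by ring.
    apply Rmult_le_compat_l; [nra | assumption].
Qed.

Lemma FL_eq S z : FL S z = S (wave z).
Proof. reflexivity. Qed.

(** The product form also covers z = mu. *)
Lemma FL_resolvent N A c S mu z : distribution N A c S ->
  ((z - mu) * FL (fun f => S (fun t => - Ci * resolvent mu f t)%C) z = FL S z - FL S mu)%C.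
Proof.
  intros HS.
  assert (H1 := distribution_scal HS (z - mu)%C (fun t => - Ci * resolvent mu (wave z) t)%C
     (smooth_scal _ _ (smooth_resolvent _ _ (smooth_wave z)))).
  assert (H2 := distribution_plus HS (wave z) (fun t => (-1) * wave mu t)%C (smooth_wave z)
     (smooth_scal _ _ (smooth_wave mu))).
  assert (H3 := distribution_scal HS (-1)%C (wave mu) (smooth_wave mu)).
  cbv beta in H1, H2.
  assert (H4 : (fun t => (z - mu) * (- Ci * resolvent mu (wave z) t))%C
             = (fun t => wave z t + (-1) * wave mu t)%C).
  { apply functional_extensionality; intros t.
    transitivity (wave z t - wave mu t)%C; [|ring]. rewrite <- resolvent_wave; ring. }
  rewrite H4, H2, H3 in H1.
  change (((z - mu) * S (fun t => - Ci * resolvent mu (wave z) t))%C = (S (wave z) - S (wave mu))%C).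
  rewrite <- H1; ring.
Qed.

(** * Transforms with many zeros *)

Lemma exp_Im_le z t : exp (t * Im z) <= exp (Rabs (Im z) * Rabs t).
Proof.
  apply exp_le_mono; rewrite <- Rabs_mult, Rmult_comm; apply Rle_abs.
Qed.

(** The easy half of the Paley-Wiener-Schwartz theorem. *)
Lemma FL_growth N A c S z : distribution N A c S ->
  Cmod (FL S z) <= c * ((1 + Cmod z) ^ N * exp (Rabs (Im z) * A)).
Proof.
  intros HS; destruct HS as (H1 & H2 & HA & Hc & H3).
  rewrite FL_eq.
  replace (wave z) with ((fun j t => Cpow (- Ci * z) j * wave z t)%C O)
    by (apply functional_extensionality; intros t; simpl; ring).
  apply (H3 (fun j t => Cpow (- Ci * z) j * wave z t)%C); [apply jet_wave|].
  intros j t Hj Ht; rewrite Cmod_mult, Cmod_pow, Cmod_mult, Cmod_opp, Cmod_Ci, Rmult_1_l, Cmod_wave.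
  assert (Hz := Cmod_ge_0 z).
  apply Rmult_le_compat; [now apply pow_le | left; apply exp_pos | |].
  - apply Rle_trans with ((1 + Cmod z) ^ j).
    + apply pow_incr; lra.
    + apply Rle_pow; [lra | exact Hj].
  - eapply Rle_trans; [apply exp_Im_le|]; apply exp_le_mono.
    apply Rmult_le_compat_l; [apply Rabs_pos | exact Ht].
Qed.

Definition locally_bounded (h : C -> C) (z : C) : Prop :=
  exists d B, 0 < d /\ forall w, Cmod (w - z) < d -> Cmod (h w) <= B.

Lemma FL_locally_bounded N A c S z : distribution N A c S -> locally_bounded (FL S) z.
Proof.
  intros HS; exists 1; eexists; split; [lra|]; intros w Hw.
  eapply Rle_trans; [apply (FL_growth _ _ _ _ w HS)|].
  destruct HS as (_ & _ & HA & Hc & _).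
  assert (Hwz : Cmod w <= 1 + Cmod z).
  { replace w with ((w - z) + z)%C by ring.
    eapply Rle_trans; [apply Cmod_triangle|]; lra. }
  apply Rmult_le_compat_l; [exact Hc|].
  apply Rmult_le_compat; [apply pow_le; generalize (Cmod_ge_0 w); lra | left; apply exp_pos | |].
  - apply pow_incr; split; [generalize (Cmod_ge_0 w); lra|].
    apply Rplus_le_compat_l; exact Hwz.
  - apply exp_le_mono, Rmult_le_compat_r; [exact HA|].
    eapply Rle_trans; [apply Rabs_Im_le_Cmod | exact Hwz].
Qed.

Lemma C_eq_dec (x y : C) : {x = y} + {x <> y}.
Proof.
  destruct x as [a b], y as [c d].
  destruct (Req_dec_T a c) as [->|H]; [|right; congruence].
  destruct (Req_dec_T b d) as [->|H]; [now left | right; congruence].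
Qed.

Lemma Cminus_neq_0 w z : w <> z -> (w - z)%C <> 0%C.
Proof.
  intros H H0; apply H; transitivity ((w - z) + z)%C; [ring | rewrite H0; ring].
Qed.

(** The difference quotient of a transform at z is a transform, hence bounded near
    z; so a transform is continuous, and O(|w - z|) off z forces the value 0. *)
Lemma FL_vanish N A c S z h : distribution N A c S -> locally_bounded h z ->
  (forall w, w <> z -> FL S w = ((w - z) * h w)%C) -> FL S z = 0%C.
Proof.
  intros HS (d & B & Hd & HB) Hw.
  destruct (distribution_resolvent N A c S z HS) as (c' & _ & HS').
  destruct (FL_locally_bounded _ _ _ _ z HS') as (d' & B' & Hd' & HB').
  destruct (Req_dec (Cmod (FL S z)) 0) as [H0|H0]; [now apply Cmod_eq_0|exfalso].
  assert (Hp : 0 < Cmod (FL S z)) by (generalize (Cmod_ge_0 (FL S z)); lra).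
  set (C1 := Rabs B + Rabs B' + 1).
  assert (HC1 : 0 < C1) by (unfold C1; generalize (Rabs_pos B) (Rabs_pos B'); lra).
  set (e := Rmin (Rmin d d') (Cmod (FL S z) / C1) / 2).
  assert (He : 0 < e).
  { unfold e; apply Rdiv_lt_0_compat; [|lra].
    apply Rmin_pos; [now apply Rmin_pos | now apply Rdiv_lt_0_compat]. }
  assert (He1 : e < d /\ e < d' /\ e < Cmod (FL S z) / C1).
  { unfold e in *; generalize (Rmin_l (Rmin d d') (Cmod (FL S z) / C1))
     (Rmin_r (Rmin d d') (Cmod (FL S z) / C1)) (Rmin_l d d') (Rmin_r d d'); lra. }
  destruct He1 as (He1 & He2 & He3).
  set (w := (z + RtoC e)%C).
  assert (Hwz : (w - z = RtoC e)%C) by (unfold w; ring).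
  assert (Hm : Cmod (w - z) = e) by (rewrite Hwz, Cmod_R, Rabs_pos_eq; lra).
  assert (Hne : w <> z).
  { intros Heq; rewrite Heq in Hm; replace (z - z)%C with (RtoC 0) in Hm by ring.
    rewrite Cmod_0 in Hm; lra. }
  specialize (HB w ltac:(lra)); specialize (HB' w ltac:(lra)).
  assert (Hfl := FL_resolvent N A c S z w HS).
  rewrite (Hw w Hne) in Hfl.
  assert (Hz : FL S z = ((w - z) * (h w + (-1) * FL (fun f => S (fun t => - Ci * resolvent z f
    t)%C) w))%C).
  { rewrite Cmult_plus_distr_l.
    replace ((w - z) * (-1 * FL (fun f : R -> C => S (fun t : R => - Ci * resolvent z f t)) w))%C
      with ((-1) * ((w - z) * FL (fun f : R ->
        C => S (fun t : R => - Ci * resolvent z f t)) w))%C by ring.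
    rewrite Hfl; ring. }
  assert (Hle : Cmod (FL S z) <= e * C1).
  { rewrite Hz, Cmod_mult, Hm; apply Rmult_le_compat_l; [lra|].
    eapply Rle_trans; [apply Cmod_triangle|].
    rewrite Cmod_mult. replace (Cmod (-1)) with 1 by (rewrite Cmod_R, Rabs_left; lra).
    unfold C1; generalize (Rle_abs B) (Rle_abs B'); lra. }
  apply (Rmult_lt_compat_r C1) in He3; [|exact HC1].
  replace (Cmod (FL S z) / C1 * C1) with (Cmod (FL S z)) in He3 by (field; lra); lra.
Qed.

(** Quotient by the list of roots, the head being divided out first. *)
Fixpoint divided (l : list C) (S : (R -> C) -> C) : (R -> C) -> C :=
  match l with
  | nil => S
  | mu :: l' => divided l' (fun f => S (fun t => - Ci * resolvent mu f t)%C)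
  end.

Fixpoint rootprod (l : list C) (z : C) : C :=
  match l with nil => 1%C | mu :: l' => ((z - mu) * rootprod l' z)%C end.

(** By induction on the list. After dividing by z - mu the hypothesis for mu :: l
    becomes the one for l: at points u other than mu the cofactor h is divided by
    w - mu, which is bounded away from 0 near u; at mu the exponent drops by one,
    and if zeros remain the value at mu itself is recovered from [FL_vanish]. *)
Lemma FL_divided l : forall N A c S, distribution N A c S ->
  (forall z, exists h, locally_bounded h z /\
     forall w, FL S w = (Cpow (w - z) (count_occ C_eq_dec l z) * h w)%C) ->
  forall z, FL S z = (rootprod l z * FL (divided l S) z)%C.
Proof.
  induction l as [|mu l IH]; intros N A c S HS Hz z; [simpl; ring|].
  simpl rootprod; simpl divided.
  destruct (distribution_resolvent N A c S mu HS) as (c' & _ & HS').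
  set (S' := fun f => S (fun t => - Ci * resolvent mu f t)%C) in *.
  assert (H0 : FL S mu = 0%C).
  { destruct (Hz mu) as (h & _ & Hh); rewrite Hh, count_occ_cons_eq by reflexivity.
    simpl; ring. }
  assert (Hdiv : forall w, FL S w = ((w - mu) * FL S' w)%C).
  { intros w; unfold S'; rewrite (FL_resolvent N A c S mu w HS), H0; ring. }
  rewrite Hdiv, (IH N A c' S' HS'); [ring|].
  intros u; destruct (Hz u) as (h & (d & B & Hd & HB) & Hh).
  destruct (C_eq_dec mu u) as [<-|Hu].
  - rewrite count_occ_cons_eq in Hh by reflexivity.
    assert (Hw : forall w, w <> mu -> FL S' w = (Cpow (w - mu) (count_occ C_eq_dec l mu) * h w)%C).
    { intros w Hw; apply Cminus_neq_0 in Hw.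
      transitivity ((w - mu) * FL S' w / (w - mu))%C; [field; exact Hw|].
      rewrite <- Hdiv, Hh; simpl; field; exact Hw. }
    destruct (count_occ C_eq_dec l mu) as [|m] eqn:Hm.
    + exists (FL S'); split; [exact (FL_locally_bounded _ _ _ _ _ HS') | intros w; simpl; ring].
    + exists h; split; [exists d, B; auto|].
      intros w; destruct (C_eq_dec w mu) as [->|Hne]; [|now apply Hw].
      replace (Cpow (mu - mu) (Datatypes.S m) * h mu)%C with (RtoC 0) by (simpl; ring).
      apply (FL_vanish _ _ _ _ mu (fun w => Cpow (w - mu) m * h w)%C HS').
      * exists (Rmin d 1), B; split; [apply Rmin_pos; lra|]; intros v Hv.
        rewrite Cmod_mult, Cmod_pow.
        assert (Cmod (h v) <= B) by (apply HB; eapply Rlt_le_trans; [exact Hv | apply Rmin_l]).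
        assert (Cmod (v - mu) ^ m <= 1).
        { rewrite <- (pow1 m); apply pow_incr; split; [apply Cmod_ge_0|].
          left; eapply Rlt_le_trans; [exact Hv | apply Rmin_r]. }
        assert (0 <= Cmod (v - mu) ^ m) by (apply pow_le, Cmod_ge_0).
        generalize (Cmod_ge_0 (h v)); nra.
      * intros v Hv; rewrite (Hw v Hv); simpl; ring.
  - rewrite count_occ_cons_neq in Hh by exact Hu.
    set (m := count_occ C_eq_dec l u) in *.
    assert (Hmu := Cminus_neq_0 _ _ Hu).
    exists (fun w => if C_eq_dec w mu then (FL S' mu / Cpow (mu - u) m)%C else (h w / (w - mu))%C).
    split.
    + set (r := Cmod (mu - u)).
      assert (Hr : 0 < r) by (apply Cmod_gt_0; exact Hmu).
      exists (Rmin d (r / 2)), (B * (2 / r)); split; [apply Rmin_pos; lra|].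
      intros w Hw.
      assert (Hwr : r / 2 <= Cmod (w - mu)).
      { assert (r <= Cmod (w - mu) + Cmod (w - u)).
        { unfold r; replace (mu - u)%C with (- (w - mu) + (w - u))%C by ring.
          eapply Rle_trans; [apply Cmod_triangle|]; rewrite Cmod_opp; lra. }
        generalize (Rmin_r d (r / 2)); lra. }
      destruct (C_eq_dec w mu) as [->|Hne].
      * exfalso; replace (mu - mu)%C with (RtoC 0) in Hwr by ring.
        rewrite Cmod_0 in Hwr; lra.
      * unfold Cdiv; rewrite Cmod_mult.
        rewrite Cmod_inv by (now apply Cminus_neq_0).
        apply Rmult_le_compat; [apply Cmod_ge_0 | left; apply Rinv_0_lt_compat; lra | |].
        { apply HB; eapply Rlt_le_trans; [exact Hw | apply Rmin_l]. }
        replace (2 / r) with (/ (r / 2)) by (field; lra).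
        apply Rinv_le_contravar; lra.
    + intros w; destruct (C_eq_dec w mu) as [->|Hne].
      * field. now apply Cpow_nz.
      * apply Cminus_neq_0 in Hne.
        transitivity ((w - mu) * FL S' w / (w - mu))%C; [field; exact Hne|].
        rewrite <- Hdiv, Hh; field; exact Hne.
Qed.

(** Stated for all S because dividing replaces S, while the test function d' stays
    the same. *)
Lemma divided_jet l : forall N A B M h r d, jet d -> 0 < r -> 0 <= B ->
  (forall mu, In mu l -> Cmod mu <= M /\ Rabs (Im mu) <= h) ->
  weighted_bound N A B (1 + M + r) (h + r) d ->
  exists d', jet d' /\ weighted_bound N A (B * (2 / r) ^ length l) (1 + M + r) (h + r) d' /\
    forall S, divided l S (d O) = S (d' O).
Proof.
  induction l as [|mu l IH]; intros N A B M h r d Hd Hr HB Hl Hw.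
  - exists d; split; [exact Hd|]; split; [|reflexivity].
    simpl; rewrite Rmult_1_r; exact Hw.
  - destruct (IH N A B M h r d Hd Hr HB) as (d' & Hd' & Hw' & HO); auto.
    { intros nu Hnu; apply Hl; now right. }
    destruct (Hl mu (or_introl eq_refl)) as [H1 H2].
    exists (fun j t => - Ci * resolvent_jet mu d' j t)%C; split; [|split].
    + now apply jet_scal, jet_resolvent.
    + intros j t Hj Ht; rewrite Cmod_mult, Cmod_opp, Cmod_Ci, Rmult_1_l.
      replace (B * (2 / r) ^ length (mu :: l)) with (2 * (B * (2 / r) ^ length l) / r)
        by (simpl; field; lra).
      apply (weighted_bound_resolvent N A (B * (2 / r) ^ length l) M h r d' mu); auto.
      apply Rmult_le_pos; [exact HB | apply pow_le].
      apply Rdiv_le_0_compat; lra.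
    + intros S; simpl divided; rewrite HO; reflexivity.
Qed.

Lemma rootprod_bound l z Rd : (forall mu, In mu l -> Cmod (z - mu) <= Rd) -> 0 <= Rd ->
  Cmod (rootprod l z) <= Rd ^ length l.
Proof.
  intros H HR; induction l as [|mu l IH].
  - simpl; rewrite Cmod_1; lra.
  - simpl; rewrite Cmod_mult; apply Rmult_le_compat; try apply Cmod_ge_0.
    + apply H; now left.
    + apply IH; intros nu Hnu; apply H; now right.
Qed.

Lemma exp_INR_mult n x : exp (INR n * x) = exp x ^ n.
Proof.
  induction n as [|n IH]; [simpl; rewrite Rmult_0_l; apply exp_0|].
  rewrite S_INR; replace ((INR n + 1) * x) with (x + INR n * x) by ring.
  now rewrite exp_plus, IH.
Qed.

(** With r = 2 e Rd each zero contributes Rd from its factor z - mu and 2 / r from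
    the division, that is e^(- 1) in total. *)
Lemma many_zeros_small N A c S l z M h Rd : distribution N A c S -> 0 < Rd ->
  FL S z = (rootprod l z * FL (divided l S) z)%C ->
  (forall mu, In mu l -> Cmod mu <= M /\ Rabs (Im mu) <= h /\ Cmod (z - mu) <= Rd) ->
  Cmod z <= M -> Rabs (Im z) <= h ->
  Cmod (FL S z) <= c * (exp (- INR (length l)) * (1 + M + 2 * exp 1 * Rd) ^ N
                         * exp ((h + 2 * exp 1 * Rd) * A)).
Proof.
  intros HS HRd Hfac Hl Hz1 Hz2.
  set (r := 2 * exp 1 * Rd) in *.
  assert (He := exp_pos 1).
  assert (Hr : 0 < r) by (unfold r; nra).
  assert (HM : 0 <= M) by (generalize (Cmod_ge_0 z); lra).
  destruct (divided_jet l N A 1 M h r (fun j t => Cpow (- Ci * z) j * wave z t)%C) as (d' & Hd' &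
    Hw & HO);
    auto; try lra.
  - apply jet_wave.
  - intros mu Hmu; split; apply Hl; auto.
  - intros j t Hj Ht; rewrite Cmod_mult, Cmod_pow, Cmod_mult, Cmod_opp, Cmod_Ci, !Rmult_1_l, Cmod_wave.
    apply Rmult_le_compat; [apply pow_le, Cmod_ge_0 | left; apply exp_pos | |].
    + apply pow_incr; split; [apply Cmod_ge_0 | lra].
    + eapply Rle_trans; [apply exp_Im_le|]; apply exp_le_mono.
      apply Rmult_le_compat_r; [apply Rabs_pos | lra].
  - assert (HE : (fun t => Cpow (- Ci * z) 0 * wave z t)%C = wave z).
    { apply functional_extensionality; intros t; simpl; ring. }
    cbv beta in HO; rewrite HE in HO.
    set (n := length l) in *.
    assert (HG : Cmod (FL (divided l S) z) <=
       c * ((2 / r) ^ n * (1 + M + r) ^ N * exp ((h + r) * A))).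
    { rewrite FL_eq, HO; destruct HS as (_ & _ & HA & Hc & H3); apply H3; [exact Hd'|].
      intros j t Hj Ht; eapply Rle_trans; [apply Hw; auto|]; rewrite Rmult_1_l.
      assert (Hh0 : 0 <= h) by (generalize (Rabs_pos (Im z)); lra).
      apply Rmult_le_compat.
      - apply Rmult_le_pos; [apply pow_le, Rdiv_le_0_compat; lra | apply pow_le; lra].
      - left; apply exp_pos.
      - apply Rmult_le_compat_l; [apply pow_le, Rdiv_le_0_compat; lra|].
        apply Rle_pow; [lra | exact Hj].
      - apply exp_le_mono, Rmult_le_compat_l; [lra | exact Ht]. }
    assert (HP : Cmod (rootprod l z) <= Rd ^ n).
    { apply rootprod_bound; [|lra]; intros mu Hmu; apply Hl; exact Hmu. }
    rewrite Hfac, Cmod_mult.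
    eapply Rle_trans; [apply Rmult_le_compat; [apply Cmod_ge_0 | apply Cmod_ge_0 | exact HP |
      exact HG]|].
    assert (Hn : Rd ^ n * (2 / r) ^ n = exp (- INR n)).
    { rewrite <- Rpow_mult_distr. replace (Rd * (2 / r)) with (exp (- (1))).
      - rewrite <- exp_INR_mult; f_equal; ring.
      - unfold r; rewrite exp_Ropp; field; lra. }
    right. rewrite <- Hn; ring.
Qed.

(** The segment contains arbitrarily many zeros in a fixed disc, so the bound of
    [many_zeros_small] tends to 0 at every z. *)
Lemma FL_eq_0_of_segment N A c S r : distribution N A c S -> 0 < r ->
  (forall x : R, Rabs x < r -> FL S (RtoC x) = 0%C) ->
  forall z, FL S z = 0%C.
Proof.
  intros HS Hr H0 z.
  (* The zeros r' / (i + 1) lie in the segment and in the unit disc. *)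
  set (r' := Rmin r 1 / 2).
  assert (Hr' : 0 < r' < r /\ r' <= 1).
  { unfold r'; generalize (Rmin_l r 1) (Rmin_r r 1) (Rmin_pos r 1 Hr Rlt_0_1); lra. }
  set (rl := fun n => map (fun i => RtoC (r' / INR (Datatypes.S i))) (List.seq 0 n)).
  assert (Hin : forall n mu, In mu (rl n) -> exists x, mu = RtoC x /\ Rabs x <= r').
  { intros n mu Hmu; apply in_map_iff in Hmu; destruct Hmu as (i & <- & _).
    exists (r' / INR (Datatypes.S i)); split; [reflexivity|].
    assert (1 <= INR (Datatypes.S i)) by (rewrite S_INR; generalize (pos_INR i); lra).
    rewrite Rabs_pos_eq; [|apply Rdiv_le_0_compat; lra].
    rewrite <- (Rmult_1_r r') at 2; apply Rmult_le_compat_l; [lra|].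
    rewrite <- Rinv_1; apply Rinv_le_contravar; lra. }
  assert (HND : forall n, NoDup (rl n)).
  { intros n; apply FinFun.Injective_map_NoDup; [|apply seq_NoDup].
    intros i j Hij; apply RtoC_inj in Hij; apply Rmult_eq_reg_l in Hij; [|lra].
    apply Rinv_eq_reg in Hij; apply INR_eq in Hij; lia. }
  assert (Hfac : forall n, FL S z = (rootprod (rl n) z * FL (divided (rl n) S) z)%C).
  { intros n; apply (FL_divided (rl n) N A c S HS); intros u.
    destruct (in_dec C_eq_dec u (rl n)) as [Hu|Hu].
    - destruct (distribution_resolvent N A c S u HS) as (c' & _ & HS').
      exists (FL (fun f => S (fun t => - Ci * resolvent u f t)%C)); split;
        [exact (FL_locally_bounded _ _ _ _ _ HS')|].
      intros w; replace (count_occ C_eq_dec (rl n) u) with 1%nat.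
      + simpl Cpow; rewrite Cmult_1_r, (FL_resolvent N A c S u w HS).
        destruct (Hin n u Hu) as (x & -> & Hx); rewrite H0; [ring | lra].
      + symmetry; apply (proj1 (NoDup_count_occ' C_eq_dec (rl n)) (HND n)), Hu.
    - exists (FL S); split; [exact (FL_locally_bounded _ _ _ _ _ HS)|].
      intros w; rewrite (proj1 (count_occ_not_In C_eq_dec (rl n) u) Hu); simpl; ring. }
  set (Q := (1 + (1 + Cmod z) + 2 * exp 1 * (1 + Cmod z)) ^ N
            * exp ((Rabs (Im z) + 2 * exp 1 * (1 + Cmod z)) * A)).
  assert (Hb : forall n, Cmod (FL S z) <= c * Q * exp (- INR n)).
  { intros n.
    assert (Hz := Cmod_ge_0 z).
    eapply Rle_trans.
    - apply (many_zeros_small N A c S (rl n) z (1 + Cmod z) (Rabs (Im z)) (1 + Cmod z)); auto; try lra.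
      intros mu Hmu; destruct (Hin n mu Hmu) as (x & -> & Hx).
      repeat split.
      + rewrite Cmod_R; lra.
      + simpl; rewrite Rabs_R0; apply Rabs_pos.
      + unfold Cminus; eapply Rle_trans; [apply Cmod_triangle|].
        rewrite Cmod_opp, Cmod_R; lra.
    - unfold rl; rewrite length_map, length_seq; unfold Q; right; ring. }
  destruct (Req_dec (Cmod (FL S z)) 0) as [Hz0|Hz0]; [now apply Cmod_eq_0|exfalso].
  assert (Hp : 0 < Cmod (FL S z)) by (generalize (Cmod_ge_0 (FL S z)); lra).
  assert (HQ : 0 < c * Q).
  { specialize (Hb O); simpl in Hb; rewrite Ropp_0, exp_0 in Hb; lra. }
  destruct (INR_unbounded (c * Q / Cmod (FL S z))) as (n & Hn).
  specialize (Hb n). rewrite exp_Ropp in Hb.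
  assert (He : INR n < exp (INR n)).
  { generalize (exp_ineq1_le (INR n)); lra. }
  assert (Hen := exp_pos (INR n)).
  apply (Rmult_le_compat_r (exp (INR n))) in Hb; [|lra].
  replace (c * Q * / exp (INR n) * exp (INR n)) with (c * Q) in Hb by (field; lra).
  apply (Rmult_lt_compat_r (Cmod (FL S z))) in Hn; [|exact Hp].
  replace (c * Q / Cmod (FL S z) * Cmod (FL S z)) with (c * Q) in Hn by (field; lra).
  nra.
Qed.

(** * Expansion of a wave in the waves of the nodes *)

Fixpoint Csum (f : nat -> C) (X : nat) : C :=
  match X with O => 0%C | S n => (Csum f n + f n)%C end.

Fixpoint Rsum (f : nat -> R) (X : nat) : R :=
  match X with O => 0 | S n => Rsum f n + f n end.

Lemma RtoC_Rsum f X : Csum (fun n => RtoC (f n)) X = RtoC (Rsum f X).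
Proof. induction X as [|X IH]; simpl; [reflexivity|]. now rewrite IH, RtoC_plus. Qed.

Lemma Csum_ext f g X : (forall n, (n < X)%nat -> f n = g n) -> Csum f X = Csum g X.
Proof.
  induction X as [|X IH]; intros H; simpl; [reflexivity|].
  rewrite IH, H; [reflexivity | lia | intros n Hn; apply H; lia].
Qed.

Lemma Csum_scal c f X : (c * Csum f X = Csum (fun n => c * f n) X)%C.
Proof. induction X as [|X IH]; simpl; [ring|]. rewrite <- IH; ring. Qed.

Lemma is_Cderive_Csum (f g : nat -> R -> C) X t : (forall n, is_Cderive (f n) t (g n t)) ->
  is_Cderive (fun s => Csum (fun n => f n s) X) t (Csum (fun n => g n t) X).
Proof.
  intros H; induction X as [|X IH]; simpl; [apply is_Cderive_const|].
  now apply is_Cderive_plus.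
Qed.

Lemma Ccontinuous_scal c f : Ccontinuous f -> Ccontinuous (fun t => c * f t)%C.
Proof.
  intros Hf; apply Ccontinuous_mult; [|exact Hf].
  apply (is_Cderive_Ccontinuous _ (fun _ => 0%C)); intros s; apply is_Cderive_const.
Qed.

Lemma Ccontinuous_plus f g :
  Ccontinuous f -> Ccontinuous g -> Ccontinuous (fun t => f t + g t)%C.
Proof.
  intros Hf Hg t; destruct (Hf t), (Hg t); split; simpl; apply @continuous_plus; assumption.
Qed.

Lemma CInt_scal c f a b : Ccontinuous f -> (CInt (fun s => c * f s) a b = c * CInt f a b)%C.
Proof.
  intros Hf.
  rewrite (CInt_0 _ (fun t => c * CInt f a t)%C a b); [|now apply Ccontinuous_scal|].
  - cbv beta; rewrite CInt_point; ring.
  - intros t; apply is_Cderive_scal, is_Cderive_CInt, Hf.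
Qed.

Lemma CInt_plus f g a b : Ccontinuous f -> Ccontinuous g ->
  (CInt (fun s => f s + g s) a b = CInt f a b + CInt g a b)%C.
Proof.
  intros Hf Hg.
  rewrite (CInt_0 _ (fun t => CInt f a t + CInt g a t)%C a b); [|now apply Ccontinuous_plus|].
  - cbv beta; rewrite !CInt_point; ring.
  - intros t; apply is_Cderive_plus; now apply is_Cderive_CInt.
Qed.

Lemma CInt_ext f g a b : (forall t, f t = g t) -> CInt f a b = CInt g a b.
Proof. intros H; f_equal; now apply functional_extensionality. Qed.

Lemma CInt_bound f a b B : Ccontinuous f -> a <= b ->
  (forall t, a <= t <= b -> Cmod (f t) <= B) -> Cmod (CInt f a b) <= 2 * (B * (b - a)).
Proof.
  intros Hf Hab HB.
  assert (Hr : forall h : R -> R, (forall t, continuous h t) ->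
     (forall t, a <= t <= b -> Rabs (h t) <= B) -> Rabs (RInt h a b) <= B * (b - a)).
  { intros h Hc Hh. rewrite Rmult_comm; apply abs_RInt_le_const; auto.
    apply @ex_RInt_continuous; auto. }
  apply Cmod_le_ReIm; simpl.
  - apply Hr; [apply Hf|]; intros t Ht; eapply Rle_trans; [apply Rabs_Re_le_Cmod | auto].
  - apply Hr; [apply Hf|]; intros t Ht; eapply Rle_trans; [apply Rabs_Im_le_Cmod | auto].
Qed.

(** Equal to sin (b w) / (b w) off 0. The integral shows that it is entire and that
    it is the transform of the mean over [- b, b]. *)
Definition sinc (b : R) (w : C) : C := (CInt (wave w) (- b) b / (2 * b))%C.

Lemma RtoC_neq x : x <> 0 -> RtoC x <> 0%C.
Proof. intros H H0; apply H, RtoC_inj, H0. Qed.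

Lemma Ccontinuous_wave w : Ccontinuous (wave w).
Proof. apply smooth_Ccontinuous, smooth_wave. Qed.

Lemma sinc_mult b w : 0 < b ->
  (w * sinc b w = Ci * (wave w b - wave w (- b)) / (2 * b))%C.
Proof.
  intros Hb; unfold sinc.
  assert (H := CInt_scal (- Ci * w)%C (wave w) (- b) b (Ccontinuous_wave w)).
  rewrite (CInt_0 _ (wave w)) in H.
  - rewrite H. transitivity (- (Ci * Ci) * (w * CInt (wave w) (- b) b) / (2 * b))%C; [|field].
    + replace (- (Ci * Ci))%C with (RtoC 1)
        by (apply injective_projections; simpl; ring). field. apply RtoC_neq; lra.
    + apply RtoC_neq; lra.
  - apply Ccontinuous_scal, Ccontinuous_wave.
  - intros t; apply is_Cderive_wave.
Qed.

Lemma sinc_0 b : 0 < b -> (sinc b 0 = 1)%C.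
Proof.
  intros Hb; unfold sinc.
  rewrite (CInt_ext (wave 0) (fun _ => RtoC 1)) by (intros t; apply wave_0_l).
  rewrite (CInt_0 _ (fun s => RtoC s) (- b) b).
  - rewrite RtoC_opp; field; apply RtoC_neq; lra.
  - apply (is_Cderive_Ccontinuous _ (fun _ => 0%C)); intros s; apply is_Cderive_const.
  - intros t; apply is_Cderive_RtoC_id.
Qed.

Lemma wave_real v t : wave (RtoC v) t = (cos (v * t), - sin (v * t)).
Proof.
  rewrite wave_val; simpl; rewrite Rmult_0_r, exp_0, !(Rmult_comm t).
  apply injective_projections; simpl; ring.
Qed.

Lemma Cmod_wave_real v t : Cmod (wave (RtoC v) t) = 1.
Proof. rewrite Cmod_wave; simpl; now rewrite Rmult_0_r, exp_0. Qed.

(** The real number x is restricted to a segment around 0, on which cos (b x) does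
    not vanish; by the identity theorem this is enough for the sampling theorem. *)
Section Sampling.
Variable b : R.
Hypothesis Hb : 0 < b.
Variable x : R.
Let theta := PI / b.
Hypothesis Hx : Rabs x < theta / 2.

(** Half-integers, so that the nodes come in pairs and none of them is 0. *)
Definition node (b : R) (n : nat) : R := (INR n + / 2) * (PI / b).
Let nu := node b.

Lemma theta_pos : 0 < theta.
Proof. unfold theta; apply Rdiv_lt_0_compat; [apply PI_RGT_0 | exact Hb]. Qed.

Lemma cos_sin_node n : cos (nu n * b) = 0 /\ sin (nu n * b) = (-1) ^ n.
Proof.
  unfold nu, node; replace ((INR n + / 2) * (PI / b) * b) with (INR n * PI + PI / 2)
    by (field; lra).
  induction n as [|n [IH1 IH2]].
  - simpl; rewrite Rmult_0_l, Rplus_0_l, cos_PI2, sin_PI2; lra.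
  - rewrite S_INR; replace ((INR n + 1) * PI + PI / 2) with (INR n * PI + PI / 2 + PI) by ring.
    rewrite neg_cos, neg_sin, IH1, IH2; simpl; lra.
Qed.

Let kappa : R := cos (b * x) / b.

Lemma sinc_node_minus n :
  ((x - nu n) * sinc b (x - nu n) = - ((-1) ^ n * kappa)%R)%C.
Proof.
  rewrite sinc_mult by exact Hb.
  destruct (cos_sin_node n) as [Hc Hs].
  unfold Cminus; rewrite !wave_plus, <- !RtoC_opp, !wave_real.
  replace (- nu n * b) with (- (nu n * b)) by ring.
  replace (- nu n * - b) with (nu n * b) by ring.
  replace (x * - b) with (- (b * x)) by ring. replace (x * b) with (b * x) by ring.
  rewrite !cos_neg, !sin_neg, Hc, Hs.
  unfold kappa; apply injective_projections; simpl; field; lra.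
Qed.

Lemma sinc_node_plus n :
  ((x + nu n) * sinc b (x + nu n) = ((-1) ^ n * kappa)%R)%C.
Proof.
  rewrite sinc_mult by exact Hb.
  destruct (cos_sin_node n) as [Hc Hs].
  rewrite !wave_plus, !wave_real.
  replace (nu n * - b) with (- (nu n * b)) by ring.
  replace (x * - b) with (- (b * x)) by ring. replace (x * b) with (b * x) by ring.
  rewrite !cos_neg, !sin_neg, Hc, Hs.
  unfold kappa; apply injective_projections; simpl; field; lra.
Qed.

(** Orthogonality of the waves of the nodes on [- b, b]. *)
Lemma sinc_integer m : m <> 0%Z -> sinc b (RtoC (IZR m * theta)) = 0%C.
Proof.
  intros Hm.
  assert (H0 : IZR m * theta <> 0).
  { apply Rmult_integral_contrapositive; split; [now apply not_0_IZR | generalize theta_pos; lra]. }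
  assert (H := sinc_mult b (RtoC (IZR m * theta)) Hb).
  assert (Hper : wave (RtoC (IZR m * theta)) b = wave (RtoC (IZR m * theta)) (- b)).
  { rewrite !wave_real. unfold theta.
    replace (IZR m * (PI / b) * b) with (IZR m * PI) by (field; lra).
    replace (IZR m * (PI / b) * - b) with (- (IZR m * PI)) by (field; lra).
    rewrite cos_neg, sin_neg.
    assert (Hs : sin (IZR m * PI) = 0) by (apply sin_eq_0_1; now exists m).
    rewrite Hs; f_equal; ring. }
  rewrite Hper in H.
  transitivity (RtoC (IZR m * theta) * sinc b (RtoC (IZR m * theta)) / RtoC (IZR m * theta))%C.
  - field; now apply RtoC_neq.
  - rewrite H; field; split; apply RtoC_neq; lra.
Qed.

Definition sampling_sum (b x : R) (X : nat) (t : R) : C :=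
  Csum (fun n => sinc b (x - node b n) * wave (node b n) t
                 + sinc b (x + node b n) * wave (- node b n) t)%C X.

(** The sampling sum times the opposite wave: it has to converge to 1. *)
Let unwound X t := (wave (- x) t * sampling_sum b x X t)%C.

(** The alternating Dirichlet kernel, by telescoping. *)
Lemma dirichlet_alt X t :
  cos (theta * t / 2) * (2 * Rsum (fun n => (-1) ^ n * sin (nu n * t)) X)
   = - ((-1) ^ X * sin (INR X * theta * t)).
Proof.
  induction X as [|X IH].
  - simpl; rewrite !Rmult_0_l, sin_0; ring.
  - simpl Rsum.
    rewrite !Rmult_plus_distr_l, IH, S_INR.
    replace (nu X * t) with (INR X * theta * t + theta * t / 2)
      by (unfold nu, node, theta; field; lra).
    replace ((INR X + 1) * theta * t) with (INR X * theta * t + 2 * (theta * t / 2)) by field.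
    generalize (INR X * theta * t) (theta * t / 2); intros u v.
    rewrite !sin_plus, sin_2a, cos_2a; simpl.
    generalize (sin2_cos2 v); unfold Rsqr; intros Hv.
    replace (cos v * cos v - sin v * sin v) with (2 * (cos v * cos v) - 1) by lra.
    ring.
Qed.

(** After multiplication by e^(i t x) every term of the sum has a derivative in which
    the frequency cancels the denominator of sinc: an alternating Dirichlet kernel
    is left, singular only at t = +-b. *)
Lemma is_Cderive_unwound X t : cos (theta * t / 2) <> 0 ->
  is_Cderive (unwound X) t (RtoC (kappa * (-1) ^ X * sin (INR X * theta * t) / cos (theta * t / 2))
    * wave (- x) t)%C.
Proof.
  intros Hc; unfold unwound.
  eapply is_Cderive_ext_d.
  - apply is_Cderive_mult; [apply is_Cderive_wave|]. unfold sampling_sum.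
    apply (is_Cderive_Csum (fun n t => sinc b (x - node b n) * wave (node b n) t
                 + sinc b (x + node b n) * wave (- node b n) t)%C
         (fun n t => sinc b (x - node b n) * (- Ci * node b n * wave (node b n) t)
                 + sinc b (x + node b n) * (- Ci * (- node b n) * wave (- node b n) t))%C).
    intros n; apply is_Cderive_plus; apply is_Cderive_scal, is_Cderive_wave.
  - unfold sampling_sum.
    rewrite <- Cmult_assoc, (Cmult_comm (wave (- x) t)).
    transitivity ((Csum (fun n => - (2 * kappa) * RtoC ((-1) ^ n * sin (nu n * t))) X) * wave (- x)
      t)%C.
    + set (F := fun n => (sinc b (x - node b n) * wave (node b n) t
            + sinc b (x + node b n) * wave (- node b n) t)%C).
      set (G := fun n => (sinc b (x - node b n) * (- Ci * node b n * wave (node b n) t)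
            + sinc b (x + node b n) * (- Ci * (- node b n) * wave (- node b n) t))%C).
      transitivity ((Csum (fun n => Ci * x * F n + G n) X) * wave (- x) t)%C.
      * assert (Hadd : Csum (fun n => Ci * x * F n + G n)%C X = (Ci * x * Csum F X + Csum G X)%C).
        { clear; induction X as [|X IH]; simpl; [ring | rewrite IH; ring]. }
        rewrite Hadd; ring.
      * f_equal; apply Csum_ext; intros n _.
        transitivity (Ci * (((x - nu n) * sinc b (x - nu n)) * wave (node b n) t
           + ((x + nu n) * sinc b (x + nu n)) * wave (- node b n) t))%C; [unfold F, G, nu; ring|].
        rewrite sinc_node_minus, sinc_node_plus, <- (RtoC_opp (node b n)), !wave_real.
        fold nu. replace (- nu n * t) with (- (nu n * t)) by ring.
        rewrite cos_neg, sin_neg.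
        apply injective_projections; simpl; ring.
    + f_equal. rewrite <- (Csum_scal (- (2 * kappa)) (fun n => RtoC ((-1) ^ n * sin (nu n * t)))).
      rewrite RtoC_Rsum.
      generalize (dirichlet_alt X t); intros HD.
      set (Z := Rsum _ X) in *.
      replace (kappa * (-1) ^ X * sin (INR X * theta * t) / cos (theta * t / 2))
        with (- (2 * kappa) * Z).
      * rewrite RtoC_mult, RtoC_opp, RtoC_mult; reflexivity.
      * replace (kappa * (-1) ^ X * sin (INR X * theta * t))
          with (kappa * ((-1) ^ X * sin (INR X * theta * t))) by ring.
        replace ((-1) ^ X * sin (INR X * theta * t)) with (- (cos (theta * t / 2) * (2 * Z))) by lra.
        field; exact Hc.
Qed.

Lemma is_Cderive_RtoC f t d : is_derive f t d -> is_Cderive (fun s => RtoC (f s)) t (RtoC d).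
Proof. intros H; split; simpl; [exact H | apply @is_derive_const]. Qed.

Lemma is_Cderive_bounded (h h' : R -> C) D t :
  (forall s, Rabs s <= Rabs t -> is_Cderive h s (h' s) /\ Cmod (h' s) <= D) ->
  Cmod (h t - h 0) <= 2 * (D * Rabs t).
Proof.
  intros H; apply Cmod_le_ReIm.
  - replace (Re (h t - h 0)) with (Re (h t) - Re (h 0)) by reflexivity.
    replace (Rabs t) with (Rabs (t - 0)) by (f_equal; ring).
    apply (bounded_variation (fun s => Re (h s)) (fun s => Re (h' s))).
    intros s; rewrite !Rminus_0_r; intros Hs; split; [apply H, Hs|].
    eapply Rle_trans; [apply Rabs_Re_le_Cmod | apply H, Hs].
  - replace (Im (h t - h 0)) with (Im (h t) - Im (h 0)) by reflexivity.
    replace (Rabs t) with (Rabs (t - 0)) by (f_equal; ring).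
    apply (bounded_variation (fun s => Im (h s)) (fun s => Im (h' s))).
    intros s; rewrite !Rminus_0_r; intros Hs; split; [apply H, Hs|].
    eapply Rle_trans; [apply Rabs_Im_le_Cmod | apply H, Hs].
Qed.

(** The denominator of the kernel decreases with |t| on (- b, b). *)
Lemma cos_lower s t : Rabs s <= Rabs t -> Rabs t < b ->
  0 < cos (theta * t / 2) <= cos (theta * s / 2).
Proof.
  intros Hs Ht.
  assert (Habs : forall u, cos (theta * u / 2) = cos (theta * Rabs u / 2)).
  { intros u; unfold Rabs; destruct (Rcase_abs u); [|reflexivity].
    rewrite <- cos_neg; f_equal; field. }
  rewrite (Habs s), (Habs t).
  assert (Hth := theta_pos).
  assert (Hu : theta * Rabs t / 2 < PI / 2).
  { replace (PI / 2) with (theta * b / 2) by (unfold theta; field; lra).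
    nra. }
  assert (0 <= theta * Rabs s / 2) by (generalize (Rabs_pos s); nra).
  assert (theta * Rabs s / 2 <= theta * Rabs t / 2) by nra.
  split.
  - apply cos_gt_0; generalize PI_RGT_0; lra.
  - apply cos_decr_1; generalize PI_RGT_0; lra.
Qed.

Definition osc_const : R := Rabs kappa * (2 * b * (theta / 2 + Rabs x) + 2) / theta.

Lemma Cmod_scal_wave r v t : Cmod (RtoC r * wave (RtoC v) t) = Rabs r.
Proof. now rewrite Cmod_mult, Cmod_R, Cmod_wave_real, Rmult_1_r. Qed.

Lemma Rabs_sgn X : Rabs ((-1) ^ X) = 1.
Proof. apply pow_1_abs. Qed.

(** Integration by parts of the fast factor sin (X theta t): V is the boundary term,
    and the derivative of unwound - V is again O(1 / X). Hence the unwound sum is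
    nearly constant in t; the constant is found below. *)
Lemma osc_bound X t : (0 < X)%nat -> Rabs t < b ->
  Cmod (unwound X t - unwound X 0) <= osc_const / (INR X * cos (theta * t / 2) ^ 2).
Proof.
  intros HX Ht.
  assert (Hth := theta_pos).
  assert (HXp : 0 < INR X) by (apply lt_0_INR; exact HX).
  set (a := INR X * theta); assert (Ha : 0 < a) by (unfold a; nra).
  set (m := kappa * (-1) ^ X).
  assert (Hm : Rabs m = Rabs kappa) by (unfold m; now rewrite Rabs_mult, Rabs_sgn, Rmult_1_r).
  set (c := cos (theta * t / 2)).
  assert (Hc : 0 < c) by (apply (cos_lower t t); lra).
  assert (Hc1 : c <= 1) by apply COS_bound.
  assert (Hc2 : c ^ 2 <= c) by (simpl; nra).
  set (r := fun s => - (m * cos (a * s) / (a * cos (theta * s / 2)))).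
  set (V := fun s => (RtoC (r s) * wave (- x) s)%C).
  assert (Hr : forall s, Rabs s <= Rabs t -> Rabs (r s) <= Rabs kappa / (a * c)).
  { intros s Hs; destruct (cos_lower s t Hs Ht) as [_ Hcs]; fold c in Hcs.
    unfold r; rewrite Rabs_Ropp; unfold Rdiv; rewrite !Rabs_mult, Hm, Rabs_inv.
    rewrite Rmult_assoc; apply Rmult_le_compat_l; [apply Rabs_pos|].
    rewrite (Rabs_pos_eq (a * _)) by nra.
    apply Rle_trans with (1 * / (a * cos (theta * s / 2))).
    - apply Rmult_le_compat_r; [left; apply Rinv_0_lt_compat; nra|].
      apply Rabs_le, COS_bound.
    - rewrite Rmult_1_l; apply Rinv_le_contravar; nra. }
  set (D := Rabs kappa * (theta / 2 + Rabs x) / (a * c ^ 2)).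
  assert (HYV : Cmod ((unwound X t + (-1) * V t) - (unwound X 0 + (-1) * V 0)) <= 2 * (D * Rabs t)).
  { apply (is_Cderive_bounded (fun s => unwound X s + (-1) * V s)%C
      (fun s => RtoC (m * cos (a * s) * (theta / 2) * sin (theta * s / 2) / (a * cos (theta * s /
        2) ^ 2))
                * wave (- x) s + (-1) * (Ci * x * (RtoC (r s) * wave (- x) s)))%C).
    intros s Hs; destruct (cos_lower s t Hs Ht) as [_ Hcs]; fold c in Hcs.
    assert (Hc0 : cos (theta * s / 2) <> 0) by lra.
    split.
    - eapply is_Cderive_ext_d.
      + apply is_Cderive_plus; [now apply is_Cderive_unwound|].
        apply is_Cderive_scal; unfold V; apply is_Cderive_mult; [|apply is_Cderive_wave].
        apply (is_Cderive_RtoC r s (m * sin (a * s) / cos (theta * s / 2)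
           - m * cos (a * s) * (theta / 2) * sin (theta * s / 2) / (a * cos (theta * s / 2) ^ 2))).
        unfold r. auto_derive; [apply Rmult_integral_contrapositive; split; [lra | exact Hc0]|].
        unfold Rdiv in *; field; split; [exact Hc0 | lra].
      + cbv beta. fold a; fold m.
        rewrite RtoC_minus; ring.
    - eapply Rle_trans; [apply Cmod_triangle|].
      rewrite !Cmod_mult, Cmod_Ci, <- !RtoC_opp, Cmod_wave_real, !Cmod_R.
      replace (Rabs (-1)) with 1 by (rewrite Rabs_left; lra).
      rewrite !Rmult_1_r, !Rmult_1_l.
      replace D with (Rabs kappa * (theta / 2) / (a * c ^ 2) + Rabs x * (Rabs kappa / (a * c ^ 2)))
        by (unfold D; field; lra).
      apply Rplus_le_compat.
      + unfold Rdiv; rewrite !Rabs_mult, Hm, (Rabs_inv (a * _)).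
        rewrite (Rabs_pos_eq (a * _ ^ 2)) by (apply Rmult_le_pos; [lra | apply pow2_ge_0]).
        rewrite (Rabs_pos_eq (theta)), (Rabs_pos_eq (/ 2)) by lra.
        assert (H1 : Rabs (cos (a * s)) <= 1) by (apply Rabs_le, COS_bound).
        assert (H2 : Rabs (sin (theta * s * / 2)) <= 1) by (apply Rabs_le, SIN_bound).
        assert (H3 : / (a * cos (theta * s * / 2) ^ 2) <= / (a * c ^ 2)).
        { unfold Rdiv in Hcs; apply Rinv_le_contravar; [apply Rmult_lt_0_compat; [lra |
          now apply pow_lt]|].
          apply Rmult_le_compat_l; [lra|]; apply pow_incr; lra. }
        apply Rmult_le_compat; auto.
        * apply Rmult_le_pos; [|apply Rabs_pos]; apply Rmult_le_pos; [|lra].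
          apply Rmult_le_pos; apply Rabs_pos.
        * left; apply Rinv_0_lt_compat, Rmult_lt_0_compat; [lra|].
          unfold Rdiv in Hcs; apply pow_lt; lra.
        * rewrite <- (Rmult_1_r (Rabs kappa * (theta * / 2))).
          apply Rmult_le_compat; try apply Rabs_pos; auto.
          -- apply Rmult_le_pos; [|lra]; apply Rmult_le_pos; apply Rabs_pos.
          -- apply Rmult_le_compat_r; [lra|].
             rewrite <- (Rmult_1_r (Rabs kappa)) at 2; apply Rmult_le_compat_l; [apply Rabs_pos |
               exact H1].
      + apply Rmult_le_compat_l; [apply Rabs_pos|].
        eapply Rle_trans; [apply Hr, Hs|].
        apply Rmult_le_compat_l; [apply Rabs_pos|].
        apply Rinv_le_contravar; [apply Rmult_lt_0_compat; [lra | now apply pow_lt]|].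
    apply Rmult_le_compat_l; [lra | exact Hc2]. }
  assert (HV : forall s, Rabs s <= Rabs t -> Cmod (V s) <= Rabs kappa / (a * c ^ 2)).
  { intros s Hs; unfold V; rewrite <- RtoC_opp, Cmod_scal_wave.
    eapply Rle_trans; [apply Hr, Hs|].
    apply Rmult_le_compat_l; [apply Rabs_pos|].
    apply Rinv_le_contravar; [apply Rmult_lt_0_compat; [lra | now apply pow_lt]|].
    apply Rmult_le_compat_l; [lra | exact Hc2]. }
  replace (unwound X t - unwound X 0)%C
    with (((unwound X t + (-1) * V t) - (unwound X 0 + (-1) * V 0)) + (V t + (-1) * V 0))%C by ring.
  eapply Rle_trans; [apply Cmod_triangle|].
  assert (HV2 : Cmod (V t + (-1) * V 0) <= 2 * (Rabs kappa / (a * c ^ 2))).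
  { eapply Rle_trans; [apply Cmod_triangle|]. rewrite Cmod_mult, Cmod_R.
    replace (Rabs (-1)) with 1 by (rewrite Rabs_left; lra).
    generalize (HV t (Rle_refl _)) (HV 0); rewrite Rabs_R0; intros A1 A2.
    specialize (A2 (Rabs_pos t)); lra. }
  assert (HD : 0 <= D).
  { unfold D; apply Rdiv_le_0_compat.
    - apply Rmult_le_pos; [apply Rabs_pos | generalize (Rabs_pos x); lra].
    - apply Rmult_lt_0_compat; [lra | now apply pow_lt]. }
  replace (osc_const / (INR X * c ^ 2)) with (2 * (D * b) + 2 * (Rabs kappa / (a * c ^ 2))).
  - apply Rplus_le_compat; [|exact HV2]. eapply Rle_trans; [exact HYV|]; nra.
  - unfold osc_const, D, a; field; lra.
Qed.

(** The integral of the wave of frequency v against [weight], divided by b. *)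
Let weight_tr (v : C) : C :=
  ((sinc b (v + RtoC (IZR 3 * (theta / 2))) + 3 * sinc b (v + RtoC (IZR 1 * (theta / 2)))
  + 3 * sinc b (v + RtoC (IZR (-1) * (theta / 2))) + sinc b (v + RtoC (IZR (-3) * (theta / 2)))) / 4)%C.

(** The power 3 exceeds the order 2 of the singularity in [osc_bound], and a power of
    cos (theta t / 2) involves only finitely many frequencies of the nodes. *)
Let weight (t : R) : C := RtoC (cos (theta * t / 2) ^ 3).

Lemma weight_as_waves t :
  (weight t = (wave (RtoC (IZR 3 * (theta / 2))) t + 3 * wave (RtoC (IZR 1 * (theta / 2))) t
  + 3 * wave (RtoC (IZR (-1) * (theta / 2))) t + wave (RtoC (IZR (-3) * (theta / 2))) t) / 8)%C.
Proof.
  unfold weight; rewrite !wave_real.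
  replace (IZR 3 * (theta / 2) * t) with (2 * (theta * t / 2) + theta * t / 2) by (simpl; field).
  replace (IZR (-3) * (theta / 2) * t) with (- (2 * (theta * t / 2) + theta * t / 2)) by (simpl; field).
  replace (IZR 1 * (theta / 2) * t) with (theta * t / 2) by (simpl; field).
  replace (IZR (-1) * (theta / 2) * t) with (- (theta * t / 2)) by (simpl; field).
  generalize (theta * t / 2); intros u.
  rewrite !cos_neg, !sin_neg, !cos_plus, !sin_plus, cos_2a_cos, sin_2a.
  assert (Hs : sin u * sin u = 1 - cos u * cos u).
  { generalize (sin2_cos2 u); unfold Rsqr; lra. }
  apply injective_projections; simpl.
  - field_simplify. replace (sin u ^ 2) with (1 - cos u * cos u) by (rewrite <- Hs; ring).
    field.
  - field.
Qed.

(** The weight is a combination of four waves, so its products with waves integrate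
    to values of sinc. *)
Lemma CInt_weight v : (CInt (fun t => wave v t * weight t) (- b) b = b * weight_tr v)%C.
Proof.
  set (e := fun k => wave (v + RtoC (IZR k * (theta / 2)))%C).
  rewrite (CInt_ext _ (fun t => / 8 * (e 3%Z t + 3 * e 1%Z t + 3 * e (-1)%Z t + e (-3)%Z t))%C).
  - assert (Hk : forall k, Ccontinuous (e k)) by (intros k; apply Ccontinuous_wave).
    assert (H1 := fun k => Ccontinuous_scal 3 (e k) (Hk k)).
    assert (H2 := Ccontinuous_plus _ _ (Hk 3%Z) (H1 1%Z)).
    assert (H3 := Ccontinuous_plus _ _ H2 (H1 (-1)%Z)).
    rewrite (CInt_scal _ _ _ _ (Ccontinuous_plus _ _ H3 (Hk (-3)%Z))).
    rewrite (CInt_plus _ _ _ _ H3 (Hk (-3)%Z)), (CInt_plus _ _ _ _ H2 (H1 (-1)%Z)),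
      (CInt_plus _ _ _ _ (Hk 3%Z) (H1 1%Z)), (CInt_scal _ _ _ _ (Hk 1%Z)),
      (CInt_scal _ _ _ _ (Hk (-1)%Z)).
    unfold weight_tr, sinc, e. field. repeat split; apply RtoC_neq; lra.
  - intros t; rewrite weight_as_waves; unfold e; rewrite !wave_plus; field.
Qed.

Lemma node_half n : nu n = (2 * INR n + 1) * (theta / 2).
Proof. unfold nu, node, theta; field; lra. Qed.

Lemma sinc_half k m : (k + m <> 0)%Z -> Z.even (k + m) = true ->
  sinc b (RtoC (IZR k * (theta / 2)) + RtoC (IZR m * (theta / 2)))%C = 0%C.
Proof.
  intros H0 He; apply Z.even_spec in He; destruct He as (j & Hj).
  rewrite <- RtoC_plus.
  replace (IZR k * (theta / 2) + IZR m * (theta / 2)) with (IZR (k + m) * (theta / 2))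
    by (rewrite plus_IZR; ring).
  rewrite Hj, mult_IZR; replace (IZR 2 * IZR j * (theta / 2)) with (IZR j * theta)
    by (simpl; field).
  apply sinc_integer; lia.
Qed.

Lemma sinc_half0 k m : (k + m = 0)%Z ->
  sinc b (RtoC (IZR k * (theta / 2)) + RtoC (IZR m * (theta / 2)))%C = 1%C.
Proof.
  intros H0; rewrite <- RtoC_plus.
  replace (IZR k * (theta / 2) + IZR m * (theta / 2)) with (IZR (k + m) * (theta / 2))
    by (rewrite plus_IZR; ring).
  rewrite H0, Rmult_0_l; now apply sinc_0.
Qed.

Lemma weight_tr_far n : weight_tr (nu (S (S n))) = 0%C /\ weight_tr (- nu (S (S n))) = 0%C.
Proof.
  rewrite <- RtoC_opp, node_half.
  replace ((2 * INR (S (S n)) + 1) * (theta / 2)) with (IZR (2 * Z.of_nat n + 5) * (theta / 2)).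
  2:{ rewrite plus_IZR, mult_IZR, <- INR_IZR_INZ, !S_INR; simpl; ring. }
  replace (- (IZR (2 * Z.of_nat n + 5) * (theta / 2))) with (IZR (- (2 * Z.of_nat n + 5)) * (theta / 2))
    by (rewrite opp_IZR; ring).
  assert (Hev : forall m, Z.even (m * 2) = true).
  { intros m; apply Z.even_spec; exists m; ring. }
  split; unfold weight_tr; rewrite !sinc_half; try lia;
    try (apply injective_projections; simpl; field).
  - replace (2 * Z.of_nat n + 5 + -3)%Z with ((Z.of_nat n + 1) * 2)%Z by ring; apply Hev.
  - replace (2 * Z.of_nat n + 5 + -1)%Z with ((Z.of_nat n + 2) * 2)%Z by ring; apply Hev.
  - replace (2 * Z.of_nat n + 5 + 1)%Z with ((Z.of_nat n + 3) * 2)%Z by ring; apply Hev.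
  - replace (2 * Z.of_nat n + 5 + 3)%Z with ((Z.of_nat n + 4) * 2)%Z by ring; apply Hev.
  - replace (- (2 * Z.of_nat n + 5) + -3)%Z with ((- Z.of_nat n - 4) * 2)%Z by ring; apply Hev.
  - replace (- (2 * Z.of_nat n + 5) + -1)%Z with ((- Z.of_nat n - 3) * 2)%Z by ring; apply Hev.
  - replace (- (2 * Z.of_nat n + 5) + 1)%Z with ((- Z.of_nat n - 2) * 2)%Z by ring; apply Hev.
  - replace (- (2 * Z.of_nat n + 5) + 3)%Z with ((- Z.of_nat n - 1) * 2)%Z by ring; apply Hev.
Qed.

Lemma nu_0 : nu 0 = IZR 1 * (theta / 2).
Proof. rewrite node_half; simpl; ring. Qed.
Lemma nu_1 : nu 1 = IZR 3 * (theta / 2).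
Proof. rewrite node_half; simpl; ring. Qed.
Lemma nu_0' : - nu 0 = IZR (-1) * (theta / 2).
Proof. rewrite node_half; simpl; ring. Qed.
Lemma nu_1' : - nu 1 = IZR (-3) * (theta / 2).
Proof. rewrite node_half; simpl; ring. Qed.

Lemma weight_tr_0 : weight_tr (nu 0) = (3 / 4)%C /\ weight_tr (- nu 0) = (3 / 4)%C.
Proof.
  rewrite <- RtoC_opp, nu_0', nu_0; unfold weight_tr; split.
  - rewrite (sinc_half0 1 (-1)), (sinc_half 1 3), (sinc_half 1 1), (sinc_half 1 (-3));
      try reflexivity; try lia; apply injective_projections; simpl; field.
  - rewrite (sinc_half0 (-1) 1), (sinc_half (-1) 3), (sinc_half (-1) (-1)), (sinc_half (-1) (-3));
      try reflexivity; try lia; apply injective_projections; simpl; field.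
Qed.

Lemma weight_tr_1 : weight_tr (nu 1) = (1 / 4)%C /\ weight_tr (- nu 1) = (1 / 4)%C.
Proof.
  rewrite <- RtoC_opp, nu_1', nu_1; unfold weight_tr; split.
  - rewrite (sinc_half0 3 (-3)), (sinc_half 3 3), (sinc_half 3 1), (sinc_half 3 (-1));
      try reflexivity; try lia; apply injective_projections; simpl; field.
  - rewrite (sinc_half0 (-3) 3), (sinc_half (-3) (-3)), (sinc_half (-3) 1), (sinc_half (-3) (-1));
      try reflexivity; try lia; apply injective_projections; simpl; field.
Qed.

Lemma Ccontinuous_weight : Ccontinuous weight.
Proof.
  apply (is_Cderive_Ccontinuous _ (fun t => RtoC (- (3 * cos (theta * t / 2) ^ 2 * (theta / 2) *
    sin (theta * t / 2))))).
  intros t; apply is_Cderive_RtoC; auto_derive; [easy|]; unfold Rdiv; ring.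
Qed.

Lemma Ccontinuous_sampling_sum X : Ccontinuous (sampling_sum b x X).
Proof.
  unfold sampling_sum; induction X as [|X IH]; simpl.
  - apply (is_Cderive_Ccontinuous _ (fun _ => 0%C)); intros t; apply is_Cderive_const.
  - apply Ccontinuous_plus; [exact IH|]; apply Ccontinuous_plus;
    apply Ccontinuous_scal, Ccontinuous_wave.
Qed.

(** Beyond the first two pairs of nodes all terms are orthogonal to the weight, and
    these two pairs reproduce the integral of the wave e^(- i t x) itself. *)
Lemma CInt_sampling_sum X : (2 <= X)%nat ->
  (CInt (fun t => sampling_sum b x X t * weight t) (- b) b = b * weight_tr x)%C.
Proof.
  assert (Hstep : forall n, (CInt (fun t => sampling_sum b x (S n) t * weight t) (- b) b
    = CInt (fun t => sampling_sum b x n t * weight t) (- b) b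
      + b * (sinc b (x - nu n) * weight_tr (nu n) + sinc b (x + nu n) * weight_tr (- nu n)))%C).
  { intros n.
    rewrite (CInt_ext _ (fun t => sampling_sum b x n t * weight t
       + (sinc b (x - nu n) * (wave (nu n) t * weight t) + sinc b (x + nu n) * (wave (- nu n) t *
         weight t)))%C).
    2:{ intros t; unfold sampling_sum; simpl; unfold nu; ring. }
    assert (HC : forall v, Ccontinuous (fun t => wave v t * weight t)%C).
    { intros v; apply Ccontinuous_mult; [apply Ccontinuous_wave | apply Ccontinuous_weight]. }
    assert (H1 := Ccontinuous_scal (sinc b (x - nu n)) _ (HC (nu n))).
    assert (H2 := Ccontinuous_scal (sinc b (x + nu n)) _ (HC (- nu n)%C)).
    assert (H3 := Ccontinuous_mult _ _ (Ccontinuous_sampling_sum n) Ccontinuous_weight).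
    rewrite (CInt_plus _ _ _ _ H3 (Ccontinuous_plus _ _ H1 H2)), (CInt_plus _ _ _ _ H1 H2),
      (CInt_scal _ _ _ _ (HC (nu n))), (CInt_scal _ _ _ _ (HC (- nu n)%C)), !CInt_weight.
    ring. }
  intros HX; induction HX as [|X HX IH].
  - rewrite !Hstep, (proj1 weight_tr_0), (proj2 weight_tr_0), (proj1 weight_tr_1), (proj2 weight_tr_1).
    rewrite (CInt_ext _ (fun _ => RtoC 0)) by (intros t; unfold sampling_sum; simpl; ring).
    rewrite (CInt_0 _ (fun _ => RtoC 0)); [| |intros t; apply is_Cderive_const].
    2:{ apply (is_Cderive_Ccontinuous _ (fun _ => 0%C)); intros t; apply is_Cderive_const. }
    unfold weight_tr; rewrite <- nu_0, <- nu_1, <- nu_0', <- nu_1', !RtoC_opp.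
    unfold Cminus; field.
  - rewrite Hstep, IH. destruct X as [|[|X]]; [lia|lia|].
    rewrite (proj1 (weight_tr_far X)), (proj2 (weight_tr_far X)); ring.
Qed.

Lemma kappa_pos : 0 < kappa.
Proof.
  unfold kappa; apply Rdiv_lt_0_compat; [|exact Hb].
  assert (Hbx : Rabs (b * x) < PI / 2).
  { rewrite Rabs_mult, (Rabs_pos_eq b) by lra.
    replace (PI / 2) with (b * (theta / 2)) by (unfold theta; field; lra).
    now apply Rmult_lt_compat_l. }
  apply Rabs_lt_between in Hbx; apply cos_gt_0; lra.
Qed.

(** Over a common denominator the four terms add up to a nonzero multiple of
    cos (b x), which is positive for |x| < pi / (2 b). *)
Lemma weight_tr_neq_0 : weight_tr x <> 0%C.
Proof.
  intros H0.
  assert (H1 := sinc_node_minus 0); assert (H2 := sinc_node_plus 0).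
  assert (H3 := sinc_node_minus 1); assert (H4 := sinc_node_plus 1).
  assert (HW : (4 * weight_tr x * ((x - nu 0) * (x + nu 0) * (x - nu 1) * (x + nu 1))
    = ((x + nu 1) * sinc b (x + nu 1)) * ((x - nu 1) * ((x - nu 0) * (x + nu 0)))
    + 3 * ((x + nu 0) * sinc b (x + nu 0)) * ((x - nu 0) * ((x - nu 1) * (x + nu 1)))
    + 3 * ((x - nu 0) * sinc b (x - nu 0)) * ((x + nu 0) * ((x - nu 1) * (x + nu 1)))
    + ((x - nu 1) * sinc b (x - nu 1)) * ((x + nu 1) * ((x - nu 0) * (x + nu 0))))%C).
  { unfold weight_tr; rewrite <- nu_0, <- nu_1, <- nu_0', <- nu_1', !RtoC_opp.
    unfold Cminus; field. }
  rewrite H0, H1, H2, H3, H4 in HW.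
  assert (Hfin : (RtoC (48 * (theta / 2) ^ 3 * kappa) = 0)%C).
  { transitivity (4 * 0 * ((x - nu 0) * (x + nu 0) * (x - nu 1) * (x + nu 1)))%C; [|ring].
    rewrite HW, nu_0, nu_1; apply injective_projections; simpl; field. }
  apply RtoC_inj in Hfin.
  assert (Hk := kappa_pos); assert (Hth := theta_pos).
  assert (0 < (theta / 2) ^ 3) by (apply pow_lt; lra).
  assert (0 < (theta / 2) ^ 3 * kappa) by nra. lra.
Qed.

(** The unwound sum differs from its value at 0 by O(1 / (X cos^2)), and integration
    against the weight, which vanishes to order 3 at +-b, shows that this value
    tends to 1. *)
Lemma sampling_sum_cvg a : a < b -> exists K, forall X t, (2 <= X)%nat -> Rabs t <= a ->
  Cmod (sampling_sum b x X t - wave x t) <= K / INR X.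
Proof.
  intros Hab.
  assert (HW := proj1 (Cmod_gt_0 _) weight_tr_neq_0); set (w := Cmod (weight_tr x)) in *.
  assert (HY : forall X t, (sampling_sum b x X t - unwound X 0 * wave x t = wave x t * (unwound X t
    - unwound X 0))%C).
  { intros X t; unfold unwound.
    transitivity (sampling_sum b x X t * (wave x t * wave (- x) t) - wave (- x) 0 * sampling_sum b
      x X 0 * wave x t)%C.
    - rewrite wave_mult_opp; ring.
    - ring. }
  assert (Hth := theta_pos).
  assert (HCo : 0 <= osc_const).
  { unfold osc_const; apply Rdiv_le_0_compat; [|exact Hth].
    apply Rmult_le_pos; [apply Rabs_pos|].
    assert (0 <= 2 * b * (theta / 2 + Rabs x)); [|lra].
    apply Rmult_le_pos; generalize (Rabs_pos x); lra. }
  assert (H0 : forall X, (2 <= X)%nat -> Cmod (1 - unwound X 0) <= 4 * osc_const / w / INR X).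
  { intros X HX.
    assert (HXp : 0 < INR X) by (apply lt_0_INR; lia).
    assert (HI : CInt (fun t => (sampling_sum b x X t + - unwound X 0 * wave x t) * weight t)%C (- b) b
                 = (b * weight_tr x * (1 - unwound X 0))%C).
    { rewrite (CInt_ext _ (fun t => sampling_sum b x X t * weight t + - unwound X 0 * (wave x t *
      weight t))%C)
        by (intros t; ring).
      assert (H1 := Ccontinuous_mult _ _ (Ccontinuous_wave x) Ccontinuous_weight).
      assert (H2 := Ccontinuous_mult _ _ (Ccontinuous_sampling_sum X) Ccontinuous_weight).
      rewrite (CInt_plus _ _ _ _ H2 (Ccontinuous_scal (- unwound X 0) _ H1)), (CInt_scal _ _ _ _ H1),
        CInt_weight, CInt_sampling_sum by exact HX.
      ring. }
    assert (HB : Cmod (CInt (fun t => (sampling_sum b x X t + - unwound X 0 * wave x t) * weight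
      t)%C (- b) b)
       <= 2 * (osc_const / INR X * (b - - b))).
    { apply CInt_bound; [|lra|].
      - apply Ccontinuous_mult; [|apply Ccontinuous_weight].
        apply Ccontinuous_plus; [apply Ccontinuous_sampling_sum |
          apply Ccontinuous_scal, Ccontinuous_wave].
      - intros t Ht.
        replace (sampling_sum b x X t + - unwound X 0 * wave x t)%C
          with (sampling_sum b x X t - unwound X 0 * wave x t)%C by ring.
        rewrite HY, !Cmod_mult, Cmod_wave_real, Rmult_1_l.
        unfold weight; rewrite Cmod_R.
        assert (HQ : 0 <= osc_const / INR X) by (apply Rdiv_le_0_compat; lra).
        destruct (Req_dec (Rabs t) b) as [Hte|Hte].
        + replace (cos (theta * t / 2)) with 0.
          * rewrite pow_i by lia; rewrite Rabs_R0, Rmult_0_r; exact HQ.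
          * symmetry; destruct (Rle_dec 0 t) as [Hs|Hs].
            -- rewrite Rabs_pos_eq in Hte by lra; subst t.
               replace (theta * b / 2) with (PI / 2) by (unfold theta; field; lra); apply cos_PI2.
            -- rewrite Rabs_left in Hte by lra; replace t with (- b) by lra.
               replace (theta * - b / 2) with (- (PI / 2)) by (unfold theta; field; lra).
               rewrite cos_neg; apply cos_PI2.
        + assert (Htb : Rabs t < b).
          { assert (Rabs t <= b) by (apply Rabs_le; lra); lra. }
          assert (Hc := cos_lower t t (Rle_refl _) Htb).
          assert (Hosc := osc_bound X t ltac:(lia) Htb).
          set (c := cos (theta * t / 2)) in *.
          assert (Hc1 : c <= 1) by apply COS_bound.
          rewrite Rabs_pos_eq by (apply pow_le; lra).
          apply Rle_trans with (osc_const / (INR X * c ^ 2) * c ^ 3).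
          * apply Rmult_le_compat_r; [apply pow_le; lra | exact Hosc].
          * replace (osc_const / (INR X * c ^ 2) * c ^ 3) with (osc_const / INR X * c) by (field; lra).
            nra. }
    rewrite HI, !Cmod_mult, Cmod_R, (Rabs_pos_eq b) in HB by lra; fold w in HB.
    apply (Rmult_le_reg_l (b * w)); [nra|].
    eapply Rle_trans; [exact HB|]; right; field; lra. }
  assert (Hca : forall t, Rabs t <= a -> 0 < cos (theta * a / 2) <= cos (theta * t / 2)).
  { intros t Ht; apply cos_lower; rewrite ?(Rabs_pos_eq a);
      generalize (Rabs_pos t); lra. }
  exists (osc_const / cos (theta * a / 2) ^ 2 + 4 * osc_const / w); intros X t HX Ht.
  assert (HXp : 0 < INR X) by (apply lt_0_INR; lia).
  replace (sampling_sum b x X t - wave x t)%C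
    with ((sampling_sum b x X t - unwound X 0 * wave x t) + - (1 - unwound X 0) * wave x t)%C by ring.
  eapply Rle_trans; [apply Cmod_triangle|].
  rewrite HY, !Cmod_mult, Cmod_opp, Cmod_wave_real, Rmult_1_l, Rmult_1_r.
  specialize (H0 X HX); specialize (Hca t Ht).
  assert (Hosc := osc_bound X t ltac:(lia) (Rle_lt_trans _ _ _ Ht Hab)).
  set (ca := cos (theta * a / 2)) in *; set (ct := cos (theta * t / 2)) in *.
  assert (Hle : osc_const / (INR X * ct ^ 2) <= osc_const / ca ^ 2 / INR X).
  { replace (osc_const / ca ^ 2 / INR X) with (osc_const * / (INR X * ca ^ 2)) by (field; lra).
    apply Rmult_le_compat_l; [exact HCo|].
    apply Rinv_le_contravar; [apply Rmult_lt_0_compat; [lra | apply pow_lt; lra]|].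
    apply Rmult_le_compat_l; [lra|]; apply pow_incr; lra. }
  replace ((osc_const / ca ^ 2 + 4 * osc_const / w) / INR X)
    with (osc_const / ca ^ 2 / INR X + 4 * osc_const / w / INR X) by (field; repeat split; lra).
  lra.
Qed.

End Sampling.

(** * Distributions with prescribed samples *)

Definition CSeries (a : nat -> C) : C :=
  (Series (fun n => Re (a n)), Series (fun n => Im (a n))).

Lemma Cex_series (a : nat -> C) g : (forall n, Cmod (a n) <= g n) -> ex_series g ->
  ex_series (fun n => Re (a n)) /\ ex_series (fun n => Im (a n)).
Proof.
  intros Ha Hg; split; apply @ex_series_le with (b := g); auto; intros n.
  - eapply Rle_trans; [apply Rabs_Re_le_Cmod | apply Ha].
  - eapply Rle_trans; [apply Rabs_Im_le_Cmod | apply Ha].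
Qed.

Lemma Rseries_bound (a : nat -> R) g : (forall n, Rabs (a n) <= g n) -> ex_series g ->
  Rabs (Series a) <= Series g.
Proof.
  intros Ha Hg; eapply Rle_trans; [apply Series_Rabs|].
  - apply @ex_series_le with (b := g); auto; intros n.
    unfold norm; simpl; unfold abs; simpl; now rewrite Rabs_Rabsolu.
  - apply Series_le; [|exact Hg]; intros n; split; [apply Rabs_pos | apply Ha].
Qed.

Lemma CSeries_bound a g : (forall n, Cmod (a n) <= g n) -> ex_series g ->
  Cmod (CSeries a) <= 2 * Series g.
Proof.
  intros Ha Hg; apply Cmod_le_ReIm; simpl; apply Rseries_bound; auto; intros n.
  - eapply Rle_trans; [apply Rabs_Re_le_Cmod | apply Ha].
  - eapply Rle_trans; [apply Rabs_Im_le_Cmod | apply Ha].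
Qed.

Definition Csummable (a : nat -> C) :
  Prop := exists g, (forall n, Cmod (a n) <= g n) /\ ex_series g.

Lemma CSeries_plus a e : Csummable a -> Csummable e ->
  (CSeries (fun n => a n + e n) = CSeries a + CSeries e)%C.
Proof.
  intros (g & Ha & Hg) (h & He & Hh).
  destruct (Cex_series a g Ha Hg), (Cex_series e h He Hh).
  unfold CSeries; apply injective_projections; simpl.
  - apply (Series_plus (fun n => Re (a n)) (fun n => Re (e n))); auto.
  - apply (Series_plus (fun n => Im (a n)) (fun n => Im (e n))); auto.
Qed.

Lemma ex_series_Rscal (k : R) (u : nat -> R) : ex_series u -> ex_series (fun n => k * u n).
Proof. intros H; exact (ex_series_scal_l (K := R_AbsRing) (V := R_NormedModule) k u H). Qed.

Lemma CSeries_scal c a : Csummable a -> (CSeries (fun n => c * a n) = c * CSeries a)%C.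
Proof.
  intros (g & Ha & Hg); destruct (Cex_series a g Ha Hg) as [H1 H2].
  unfold CSeries; apply injective_projections; simpl.
  - change (Series (fun n => Re c * Re (a n) - Im c * Im (a n))
      = Re c * Series (fun n => Re (a n)) - Im c * Series (fun n => Im (a n))).
    rewrite (Series_minus (fun n => Re c * Re (a n)) (fun n => Im c * Im (a n))).
    + rewrite (Series_scal_l (Re c)), (Series_scal_l (Im c)); reflexivity.
    + now apply (ex_series_Rscal (Re c)).
    + now apply (ex_series_Rscal (Im c)).
  - change (Series (fun n => Re c * Im (a n) + Im c * Re (a n))
      = Re c * Series (fun n => Im (a n)) + Im c * Series (fun n => Re (a n))).
    rewrite (Series_plus (fun n => Re c * Im (a n)) (fun n => Im c * Re (a n))).
    + rewrite (Series_scal_l (Re c)), (Series_scal_l (Im c)); reflexivity.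
    + now apply (ex_series_Rscal (Re c)).
    + now apply (ex_series_Rscal (Im c)).
Qed.

Lemma Csum_parts a X : Csum a X = (Rsum (fun n => Re (a n)) X, Rsum (fun n => Im (a n)) X).
Proof.
  induction X as [|X IH]; simpl; [reflexivity|]. rewrite IH; reflexivity.
Qed.

Lemma Rsum_sum_n (a : nat -> R) X : sum_n a X = Rsum a (S X).
Proof.
  induction X as [|X IH]; [rewrite sum_O; simpl; ring|].
  rewrite sum_Sn, IH; reflexivity.
Qed.

Lemma Series_limit (a : nat -> R) l K :
  (forall X, (2 <= X)%nat -> Rabs (Rsum a X - l) <= K / INR X) ->
  Series a = l.
Proof.
  intros H; apply is_series_unique; change (is_lim_seq (sum_n a) l).
  apply is_lim_seq_spec; intros e.
  assert (HK : 0 <= K).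
  { specialize (H 2%nat ltac:(lia)); simpl in H.
    generalize (Rabs_pos (0 + a 0%nat + a 1%nat - l)); lra. }
  destruct (INR_unbounded (K / e)) as (n & Hn).
  exists (n + 1)%nat; intros m Hm; rewrite Rsum_sum_n.
  eapply Rle_lt_trans; [apply H; lia|].
  assert (He := cond_pos e).
  assert (HS : 0 < INR (S m)) by (apply lt_0_INR; lia).
  assert (Hlt : K / e < INR (S m)) by (eapply Rlt_trans; [exact Hn | apply lt_INR; lia]).
  apply (Rmult_lt_reg_r (INR (S m))); [exact HS|].
  replace (K / INR (S m) * INR (S m)) with K by (field; lra).
  apply (Rmult_lt_compat_r e) in Hlt; [|exact He].
  replace (K / e * e) with K in Hlt by (field; lra). lra.
Qed.

Lemma CSeries_limit a l K :
  (forall X, (2 <= X)%nat -> Cmod (Csum a X - l) <= K / INR X) -> CSeries a = l.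
Proof.
  intros H; unfold CSeries; apply injective_projections; simpl;
    apply (Series_limit _ _ K); intros X HX; specialize (H X HX); rewrite Csum_parts in H;
    set (p := (Rsum _ X, Rsum _ X)) in H.
  - eapply Rle_trans; [|exact H]; exact (Rabs_Re_le_Cmod (p - l)%C).
  - eapply Rle_trans; [|exact H]; exact (Rabs_Im_le_Cmod (p - l)%C).
Qed.

Lemma distribution0_bound A c S f B : distribution 0 A c S -> smooth f ->
  (forall t, Rabs t <= A -> Cmod (f t) <= B) -> Cmod (S f) <= c * B.
Proof.
  intros (_ & _ & _ & _ & H) Hf HB; apply smooth_iff_jet in Hf; destruct Hf as (d & Hd & <-).
  apply H; [exact Hd|]; intros j t Hj Ht; replace j with O by lia; now apply HB.
Qed.

Lemma distribution_comb N A c S a e f g : distribution N A c S -> smooth f -> smooth g ->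
  S (fun t => a * f t + e * g t)%C = (a * S f + e * S g)%C.
Proof.
  intros HS Hf Hg.
  transitivity (S (fun t => a * f t)%C + S (fun t => e * g t)%C)%C.
  - exact (distribution_plus HS _ _ (smooth_scal a f Hf) (smooth_scal e g Hg)).
  - f_equal; [exact (distribution_scal HS a f Hf) | exact (distribution_scal HS e g Hg)].
Qed.

Lemma distribution_minus N A c S f g : distribution N A c S -> smooth f -> smooth g ->
  S (fun t => f t - g t)%C = (S f - S g)%C.
Proof.
  intros HS Hf Hg; transitivity (1 * S f + (-1) * S g)%C; [|ring].
  rewrite <- (distribution_comb N A c S 1 (-1) f g HS Hf Hg); f_equal.
  apply functional_extensionality; intros t; ring.
Qed.

Lemma smooth_minus f g : smooth f -> smooth g -> smooth (fun t => f t - g t)%C.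
Proof.
  intros Hf Hg; replace (fun t => f t - g t)%C with (fun t => f t + (-1) * g t)%C.
  - apply smooth_plus; [exact Hf | now apply smooth_scal].
  - apply functional_extensionality; intros t; ring.
Qed.

Lemma smooth_0 : smooth (fun _ => 0%C).
Proof.
  apply smooth_iff_jet; exists (fun _ _ => 0%C); split; [|reflexivity].
  intros j t; apply is_Cderive_const.
Qed.

Lemma distribution_Csum N A c S (f : nat -> R -> C) X :
  distribution N A c S -> (forall n, smooth (f n)) ->
  S (fun t => Csum (fun n => f n t) X) = Csum (fun n => S (f n)) X /\
  smooth (fun t => Csum (fun n => f n t) X).
Proof.
  intros HS Hf; induction X as [|X [IH1 IH2]]; simpl.
  - split; [|apply smooth_0].
    assert (H := distribution_scal HS 0%C _ smooth_0). cbv beta in H.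
    replace (fun _ : R => (0 * 0)%C) with (fun _ : R => RtoC 0) in H
      by (apply functional_extensionality; intros; ring).
    rewrite H; ring.
  - split; [|now apply smooth_plus].
    rewrite (distribution_plus HS (fun t => Csum (fun n => f n t) X) (f X)), IH1; auto.
Qed.

Definition window_coef (b v : R) (f : R -> C) : C :=
  (CInt (fun s => wave (- v) s * f s) (- b) b / (2 * b))%C.

Lemma window_coef_wave b v z : window_coef b v (wave z) = sinc b (z - v).
Proof.
  unfold window_coef, sinc; f_equal; apply CInt_ext; intros t.
  unfold Cminus; rewrite wave_plus; ring.
Qed.

Lemma window_coef_bound b v f B : 0 < b -> Ccontinuous f ->
  (forall t, Rabs t <= b -> Cmod (f t) <= B) -> Cmod (window_coef b v f) <= 2 * B.
Proof.
  intros Hb Hf HB; unfold window_coef, Cdiv.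
  assert (H : Cmod (CInt (fun s => wave (- v) s * f s)%C (- b) b) <= 2 * (B * (b - - b))).
  { apply CInt_bound; [|lra|].
    - apply Ccontinuous_mult; [apply Ccontinuous_wave | exact Hf].
    - intros t Ht; rewrite Cmod_mult, <- RtoC_opp, Cmod_wave_real, Rmult_1_l.
      apply HB, Rabs_le; lra. }
  rewrite Cmod_mult, <- RtoC_mult, <- RtoC_inv, Cmod_R by lra.
  rewrite Rabs_pos_eq by (left; apply Rinv_0_lt_compat; lra).
  apply (Rmult_le_reg_r (2 * b)); [lra|].
  rewrite Rmult_assoc, Rinv_l by lra; lra.
Qed.

Lemma window_coef_plus b v f g : 0 < b -> Ccontinuous f -> Ccontinuous g ->
  window_coef b v (fun t => f t + g t)%C = (window_coef b v f + window_coef b v g)%C.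
Proof.
  intros Hb Hf Hg; unfold window_coef.
  rewrite (CInt_ext _ (fun s => wave (- v) s * f s + wave (- v) s * g s)%C) by (intros t; ring).
  rewrite CInt_plus by (apply Ccontinuous_mult; auto using Ccontinuous_wave).
  field; apply RtoC_neq; lra.
Qed.

Lemma window_coef_scal b v c f :
  0 < b -> Ccontinuous f -> window_coef b v (fun t => c * f t)%C = (c * window_coef b v f)%C.
Proof.
  intros Hb Hf; unfold window_coef.
  rewrite (CInt_ext _ (fun s => c * (wave (- v) s * f s))%C) by (intros t; ring).
  rewrite CInt_scal by (apply Ccontinuous_mult; auto using Ccontinuous_wave).
  field; apply RtoC_neq; lra.
Qed.

Lemma Ccontinuous_bounded f b : 0 <= b -> Ccontinuous f ->
  exists B, forall t, Rabs t <= b -> Cmod (f t) <= B.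
Proof.
  intros Hb Hf.
  assert (Hr : forall h : R -> R, (forall t, continuous h t) ->
      exists B, forall t, Rabs t <= b -> Rabs (h t) <= B).
  { intros h Hh.
    assert (Hc : forall t, - b <= t <= b -> continuity_pt h t).
    { intros t _; apply continuity_pt_filterlim, Hh. }
    destruct (continuity_ab_maj h (- b) b) as (M & HM & _); [lra | exact Hc |].
    destruct (continuity_ab_min h (- b) b) as (m & Hm & _); [lra | exact Hc |].
    exists (Rabs (h M) + Rabs (h m)); intros t Ht; apply Rabs_le_between in Ht.
    specialize (HM t Ht); specialize (Hm t Ht).
    apply Rabs_le; generalize (Rle_abs (h M)) (Rle_abs (- h m)) (Rabs_pos (h M)) (Rabs_pos (h m)).
    rewrite Rabs_Ropp; lra. }
  destruct (Hr (fun t => Re (f t))) as (B1 & H1); [apply Hf|].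
  destruct (Hr (fun t => Im (f t))) as (B2 & H2); [apply Hf|].
  exists (2 * Rmax B1 B2); intros t Ht; apply Cmod_le_ReIm.
  - eapply Rle_trans; [apply H1, Ht | apply Rmax_l].
  - eapply Rle_trans; [apply H2, Ht | apply Rmax_r].
Qed.

(** The functional T pairs f with the Fourier series of the samples, so that its norm
    depends on the samples only: this turns smallness of a transform on the real
    line into smallness of a distribution. T and S agree on the waves of real
    frequency near 0 by the sampling expansion, hence have the same transform. *)
Lemma distribution_from_samples A c S b g : distribution 0 A c S -> A < b ->
  (forall n, Cmod (FL S (node b n)) <= g n /\ Cmod (FL S (- node b n)) <= g n) ->
  ex_series g ->
  exists T, distribution 0 b (8 * Series g) T /\ forall z, FL T z = FL S z.
Proof.
  intros HS HAb Hg Hex.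
  assert (HA : 0 <= A) by apply HS.
  assert (Hb : 0 < b) by lra.
  assert (Hg0 : forall n, 0 <= g n).
  { intros n; eapply Rle_trans; [apply Cmod_ge_0 | apply (Hg n)]. }
  assert (HSg : 0 <= Series g).
  { rewrite <- (Rmult_0_l (Series g)), <- Series_scal_l.
    apply Series_le; [|exact Hex]; intros n; specialize (Hg0 n); lra. }
  set (tm := fun f n => (FL S (node b n) * window_coef b (node b n) f
                         + FL S (- node b n) * window_coef b (- node b n) f)%C).
  set (T := fun f => CSeries (tm f)).
  assert (Htm : forall f B, Ccontinuous f -> (forall t, Rabs t <= b -> Cmod (f t) <= B) ->
    forall n, Cmod (tm f n) <= 4 * B * g n).
  { intros f B Hf HB n; unfold tm; eapply Rle_trans; [apply Cmod_triangle|].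
    rewrite !Cmod_mult; destruct (Hg n) as [G1 G2].
    assert (C1 := window_coef_bound b (node b n) f B Hb Hf HB).
    assert (C2 := window_coef_bound b (- node b n) f B Hb Hf HB).
    assert (B1 := Rmult_le_compat _ _ _ _ (Cmod_ge_0 _) (Cmod_ge_0 _) G1 C1).
    assert (B2 := Rmult_le_compat _ _ _ _ (Cmod_ge_0 _) (Cmod_ge_0 _) G2 C2).
    lra. }
  assert (Hsum : forall f, Ccontinuous f -> Csummable (tm f)).
  { intros f Hf; destruct (Ccontinuous_bounded f b (Rlt_le _ _ Hb) Hf) as (B & HB).
    exists (fun n => 4 * B * g n); split; [now apply Htm|].
    now apply (ex_series_Rscal (4 * B)). }
  assert (HT : distribution 0 b (8 * Series g) T).
  { repeat split; try lra.
    - intros d e Hd He; unfold T.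
      assert (Cd := jet_Ccontinuous d 0 Hd); assert (Ce := jet_Ccontinuous e 0 He).
      rewrite <- CSeries_plus by auto; f_equal; apply functional_extensionality; intros n.
      unfold tm; rewrite !window_coef_plus by auto; ring.
    - intros a d Hd; unfold T.
      assert (Cd := jet_Ccontinuous d 0 Hd).
      rewrite <- CSeries_scal by auto; f_equal; apply functional_extensionality; intros n.
      unfold tm; rewrite !window_coef_scal by auto; ring.
    - intros d B Hd HB; unfold T.
      eapply Rle_trans; [apply (CSeries_bound _ (fun n => 4 * B * g n))|].
      + apply Htm; [now apply jet_Ccontinuous|]; intros t Ht; apply HB; [lia | exact Ht].
      + now apply (ex_series_Rscal (4 * B)).
      + rewrite Series_scal_l; right; ring. }
  exists T; split; [exact HT|].
  (* The difference of the two functionals is a distribution, to which the identity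
     theorem applies. *)
  assert (HD : distribution 0 b (8 * Series g + c) (fun f => (T f + (-1) * S f)%C)).
  { destruct HT as (T1 & T2 & T3 & T4 & T5), HS as (S1 & S2 & S3 & S4 & S5).
    repeat split; try lra.
    - intros d e Hd He; rewrite T1, S1 by auto; ring.
    - intros a d Hd; rewrite T2, S2 by auto; ring.
    - intros d B Hd HB; eapply Rle_trans; [apply Cmod_triangle|].
      rewrite Cmod_mult, Cmod_R. replace (Rabs (-1)) with 1 by (rewrite Rabs_left; lra).
      assert (H1 : Cmod (T (d O)) <= 8 * Series g * B) by (apply T5; auto).
      assert (H2 : Cmod (S (d O)) <= c * B).
      { apply S5; auto; intros j t Hj Ht; apply HB; auto; lra. }
      lra. }
  intros z.
  assert (H0 : FL (fun f => (T f + (-1) * S f)%C) z = 0%C).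
  { apply (FL_eq_0_of_segment _ _ _ _ (PI / b / 2) HD).
    - assert (Hp : 0 < PI / b) by (apply Rdiv_lt_0_compat; [apply PI_RGT_0 | exact Hb]); lra.
    - intros x Hx.
      change ((T (wave x) + -1 * S (wave x))%C = 0%C).
      assert (HTx : T (wave x) = S (wave x)).
      { destruct (sampling_sum_cvg b Hb x Hx A HAb) as (K & HK).
        unfold T; apply (CSeries_limit _ _ (c * K)); intros X HX.
        set (fn := fun n t => (sinc b (x - node b n) * wave (node b n) t
                 + sinc b (x + node b n) * wave (- node b n) t)%C).
        assert (Hfn : forall n, smooth (fn n)).
        { intros n; apply smooth_plus; apply smooth_scal, smooth_wave. }
        destruct (distribution_Csum 0 A c S fn X HS Hfn) as [HF1 HF2].
        replace (Csum (tm (wave x)) X) with (S (sampling_sum b x X)).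
        - assert (HF3 : smooth (sampling_sum b x X)) by exact HF2.
          rewrite <- (distribution_minus 0 A c S _ _ HS HF3 (smooth_wave x)).
          eapply Rle_trans; [apply (distribution0_bound A c S _ (K / INR X) HS)|].
          + apply smooth_minus; [exact HF3 | apply smooth_wave].
          + intros t Ht; exact (HK X t HX Ht).
          + right; unfold Rdiv; ring.
        - change (sampling_sum b x X) with (fun t => Csum (fun n => fn n t) X); rewrite HF1.
          apply Csum_ext; intros n _; unfold fn, tm.
          rewrite (distribution_comb 0 A c S _ _ _ _ HS (smooth_wave (node b n))
            (smooth_wave (- node b n))).
          rewrite !window_coef_wave, RtoC_opp.
          replace (x - - node b n)%C with (x + node b n)%C by ring.
          change (S (wave (node b n))) with (FL S (node b n)).
          change (S (wave (- node b n))) with (FL S (- node b n)).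
          ring. }
      rewrite HTx; ring. }
  change ((T (wave z) + -1 * S (wave z))%C = 0%C) in H0.
  change (T (wave z) = S (wave z)).
  transitivity ((T (wave z) + -1 * S (wave z)) + S (wave z))%C; [ring | rewrite H0; ring].
Qed.

(** * Multiplying a transform by sinc *)

Lemma distribution_shift2 N A c S a a' e : distribution N A c S -> 0 <= e ->
  distribution N (A + e) (c * (Cmod a + Cmod a'))
    (fun f => S (fun t => a * f (t + e)%R + a' * f (t + - e)%R)%C).
Proof.
  intros (H1 & H2 & HA & Hc & H3) He.
  assert (Hj : forall d, jet d -> jet (fun j t => a * d j (t + e)%R + a' * d j (t + - e)%R)%C).
  { intros d Hd; apply jet_plus; apply jet_scal; now apply jet_shift. }
  assert (Ha := Cmod_ge_0 a); assert (Ha' := Cmod_ge_0 a').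
  repeat split; try nra.
  - intros d d' Hd Hd'; etransitivity; [|exact (H1 _ _ (Hj d Hd) (Hj d' Hd'))].
    f_equal; apply functional_extensionality; intros t; ring.
  - intros k d Hd; etransitivity; [|exact (H2 k _ (Hj d Hd))].
    f_equal; apply functional_extensionality; intros t; ring.
  - intros d B Hd HB; rewrite Rmult_assoc; apply (H3 _ _ (Hj d Hd)).
    intros j t Hjn Ht; eapply Rle_trans; [apply Cmod_triangle|]; rewrite !Cmod_mult.
    assert (B1 : Cmod (d j (t + e)) <= B).
    { apply HB; auto; eapply Rle_trans; [apply Rabs_triang|]; rewrite (Rabs_pos_eq e); lra. }
    assert (B2 : Cmod (d j (t + - e)) <= B).
    { apply HB; auto; eapply Rle_trans; [apply Rabs_triang|].
      rewrite Rabs_Ropp, (Rabs_pos_eq e); lra. }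
    rewrite Rmult_plus_distr_r; apply Rplus_le_compat; apply Rmult_le_compat_l; assumption.
Qed.

Lemma resolvent_wave_self x t : resolvent x (wave x) t = (t * wave x t)%C.
Proof.
  change (resolvent x (wave x) t = (fun t => RtoC t * wave x t)%C t).
  rewrite (resolvent_unique x (wave x) (fun t => RtoC t * wave x t)%C); [reflexivity |
    apply Ccontinuous_wave | | ].
  - cbv beta; ring.
  - intros s; eapply is_Cderive_ext_d; [apply is_Cderive_mult; [apply is_Cderive_RtoC_id |
    apply is_Cderive_wave]|].
    cbv beta; ring.
Qed.

(** Averaging the test function over [- e, e] against e^(i s x). It is written as a
    difference of two translates followed by a division by z - x: the difference
    makes the transform vanish at x, and the division lowers the order. *)
Lemma distribution_avg N A c S e x : distribution N A c S -> 0 < e ->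
  exists c' S', distribution (pred N) (A + e) c' S' /\
    forall z, FL S' z = (sinc e (z - RtoC x) * FL S z)%C.
Proof.
  intros HS He.
  set (k := (Ci / (2 * e))%C).
  set (a := (k * wave (- x) e)%C); set (a' := (- k * wave (- x) (- e)%R)%C).
  assert (HM := distribution_shift2 N A c S a a' e HS (Rlt_le _ _ He)).
  set (M := fun f => S (fun t => a * f (t + e)%R + a' * f (t + - e)%R)%C) in *.
  destruct (distribution_resolvent _ _ _ _ x HM) as (c' & HS' & _).
  set (S' := fun f => M (fun t => - Ci * resolvent x f t)%C) in *.
  exists c', S'; split; [exact HS'|]; intros z.
  assert (He' : RtoC e <> 0%C) by (apply RtoC_neq; lra).
  assert (HFM : forall z, FL M z = ((z - x) * sinc e (z - x) * FL S z)%C).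
  { intros w; rewrite sinc_mult by exact He.
    change (FL M w) with (S (fun t => a * wave w (t + e)%R + a' * wave w (t + - e)%R)%C).
    change (FL S w) with (S (wave w)).
    rewrite <- (distribution_scal HS _ (wave w)) by apply smooth_wave.
    f_equal; apply functional_extensionality; intros t.
    rewrite !wave_shift; unfold a, a', k, Cminus; rewrite !wave_plus; field; exact He'. }
  destruct (C_eq_dec z x) as [->|Hz].
  - replace (x - x)%C with (RtoC 0) by ring.
    rewrite sinc_0, Cmult_1_l by exact He.
    change (FL S' x) with (S (fun t => a * (- Ci * resolvent x (wave x) (t + e)%R)
       + a' * (- Ci * resolvent x (wave x) (t + - e)%R))%C).
    change (FL S x) with (S (wave x)); f_equal; apply functional_extensionality; intros t.
    rewrite !resolvent_wave_self, !wave_shift; unfold a, a', k.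
    assert (H1 := wave_mult_opp x e); assert (H2 := wave_mult_opp x (- e)).
    transitivity (- (Ci * Ci) / (2 * e) * wave x t *
      (RtoC (t + e) * (wave x e * wave (- x) e) - RtoC (t + - e) * (wave x (- e)%R * wave (- x)
        (- e)%R)))%C.
    + field; exact He'.
    + rewrite H1, H2, !RtoC_plus, !RtoC_opp.
      replace (- (Ci * Ci))%C with (RtoC 1) by (apply injective_projections; simpl; ring).
      field; exact He'.
  - apply Cminus_neq_0 in Hz.
    assert (HJ := FL_resolvent _ _ _ _ x z HM); fold S' in HJ.
    rewrite !HFM in HJ.
    transitivity ((z - x) * FL S' z / (z - x))%C; [field; exact Hz|].
    rewrite HJ; field; exact Hz.
Qed.

Lemma distribution_avg_iter N A c S e x n : distribution N A c S -> 0 < e ->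
  exists c' S', distribution (N - n) (A + INR n * e) c' S' /\
    forall z, FL S' z = (Cpow (sinc e (z - RtoC x)) n * FL S z)%C.
Proof.
  intros HS He; induction n as [|n (c1 & S1 & H1 & F1)].
  - exists c, S; split; [|intros z; simpl; ring].
    rewrite Nat.sub_0_r; simpl; rewrite Rmult_0_l, Rplus_0_r; exact HS.
  - destruct (distribution_avg _ _ _ _ e x H1 He) as (c2 & S2 & H2 & F2).
    exists c2, S2; split.
    + replace (N - Datatypes.S n)%nat with (pred (N - n)) by lia.
      rewrite S_INR; replace (A + (INR n + 1) * e) with (A + INR n * e + e) by ring; exact H2.
    + intros z; rewrite F2, F1; simpl; ring.
Qed.

Lemma distribution_const N A c S k :
  distribution N A c S -> distribution N A (Cmod k * c) (fun f => (k * S f)%C).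
Proof.
  intros (H1 & H2 & HA & Hc & H3); assert (Hk := Cmod_ge_0 k); repeat split; auto; try nra.
  - intros d e Hd He; rewrite H1 by auto; ring.
  - intros a d Hd; rewrite H2 by auto; ring.
  - intros d B Hd HB; rewrite Cmod_mult, Rmult_assoc; apply Rmult_le_compat_l; auto.
Qed.

(** * Size and Taylor bounds of sinc *)

Lemma sinc_far e (w : C) : 0 < e -> w <> 0%C ->
  Cmod (sinc e w) <= exp (e * Rabs (Im w)) / (e * Cmod w).
Proof.
  intros He Hw.
  assert (Hm : 0 < Cmod w) by exact (proj1 (Cmod_gt_0 w) Hw).
  assert (H := f_equal Cmod (sinc_mult e w He)).
  unfold Cdiv in H; rewrite !Cmod_mult, Cmod_Ci, Rmult_1_l in H.
  rewrite <- RtoC_mult, <- RtoC_inv, Cmod_R, Rabs_inv, (Rabs_pos_eq (2 * e)) in H by lra.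
  assert (Hd : Cmod (wave w e - wave w (- e)) <= 2 * exp (e * Rabs (Im w))).
  { unfold Cminus; eapply Rle_trans; [apply Cmod_triangle|].
    rewrite Cmod_opp, !Cmod_wave.
    assert (exp (e * Im w) <= exp (e * Rabs (Im w))).
    { apply exp_le_mono, Rmult_le_compat_l; [lra | apply Rle_abs]. }
    assert (exp (- e * Im w) <= exp (e * Rabs (Im w))).
    { apply exp_le_mono; rewrite <- (Rabs_Ropp (Im w)).
      replace (- e * Im w) with (e * - Im w) by ring.
      apply Rmult_le_compat_l; [lra | apply Rle_abs]. }
    lra. }
  apply (Rmult_le_reg_l (Cmod w)); [exact Hm|]; rewrite H.
  replace (Cmod w * (exp (e * Rabs (Im w)) / (e * Cmod w)))
    with (2 * exp (e * Rabs (Im w)) * / (2 * e)) by (field; lra).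
  apply Rmult_le_compat_r; [left; apply Rinv_0_lt_compat; lra | exact Hd].
Qed.

Lemma sinc_real_bound e y : 0 < e -> Cmod (sinc e (RtoC y)) <= 2.
Proof.
  intros He.
  replace (RtoC y) with (RtoC y - RtoC 0)%C by ring.
  rewrite <- window_coef_wave. replace 2 with (2 * 1) by ring.
  apply window_coef_bound; [exact He | apply Ccontinuous_wave|].
  intros t _; rewrite Cmod_wave_real; lra.
Qed.

Lemma sinc_real e y : 0 < e -> exists r, sinc e (RtoC y) = RtoC r.
Proof.
  intros He; destruct (Req_dec y 0) as [->|Hy].
  - exists 1; now apply sinc_0.
  - exists (sin (y * e) / (e * y)).
    assert (H := sinc_mult e (RtoC y) He).
    rewrite !wave_real in H. replace (y * - e) with (- (y * e)) in H by ring.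
    rewrite cos_neg, sin_neg in H.
    assert (Hy' := RtoC_neq y Hy).
    transitivity (RtoC y * sinc e (RtoC y) / RtoC y)%C; [field; exact Hy'|].
    rewrite H; apply injective_projections; simpl; field; split; nra.
Qed.

(** The divided differences of sinc are transforms of quotients of the mean over
    [- e, e], which [divided_jet] bounds in terms of imaginary parts only. The
    bounds are thus uniform over real translates, and all peaks share them. *)
Lemma sinc_taylor e R0 : 0 < e <= 1 -> 0 <= R0 -> exists d : C -> C,
  (forall z, Rabs (Im z) <= R0 -> Cmod (d z) <= 8 * exp (R0 + 1)) /\
  (forall z w, Rabs (Im z) <= R0 -> Rabs (Im w) <= R0 ->
     Cmod (sinc e w - sinc e z - (w - z) * d z) <= 8 * exp (R0 + 1) * (Cmod (w - z) * Cmod (w - z))) /\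
  (forall z w, Rabs (Im z) <= R0 -> Rabs (Im w) <= R0 ->
     Cmod (sinc e w - sinc e z) <= 8 * exp (R0 + 1) * Cmod (w - z)).
Proof.
  intros [He He1] HR.
  set (U := window_coef e 0).
  assert (HU : distribution 0 e 2 U).
  { unfold U; repeat split; try lra.
    - intros d d' Hd Hd'; apply window_coef_plus; auto; now apply jet_Ccontinuous.
    - intros a d Hd; apply window_coef_scal; auto; now apply jet_Ccontinuous.
    - intros d B Hd HB; apply window_coef_bound; [exact He | now apply jet_Ccontinuous |].
      intros t Ht; apply HB; auto. }
  assert (HF : forall z, FL U z = sinc e z).
  { intros z; change (window_coef e 0 (wave z) = sinc e z); rewrite window_coef_wave; f_equal; ring. }
  assert (HOp : forall l w, (length l <= 2)%nat -> (forall mu, In mu l -> Rabs (Im mu) <= R0) ->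
     Rabs (Im w) <= R0 -> Cmod (FL (divided l U) w) <= 8 * exp (R0 + 1)).
  { intros l w Hl Hmu Hw.
    set (M := fold_right (fun mu m => Rmax (Cmod mu) m) 0 l).
    assert (HM0 : 0 <= M).
    { unfold M; clear; induction l as [|mu l IH]; simpl; [lra|].
      eapply Rle_trans; [exact IH | apply Rmax_r]. }
    assert (HM : forall mu, In mu l -> Cmod mu <= M).
    { unfold M; clear; induction l as [|nu l IH]; simpl; intros mu Hmu; [easy|].
      destruct Hmu as [<-|Hmu]; [apply Rmax_l|].
      eapply Rle_trans; [now apply IH | apply Rmax_r]. }
    destruct (divided_jet l 0 e 1 M R0 1 (fun j t => Cpow (- Ci * w) j * wave w t)%C) as (d' & Hd'
      & Hw' & HO);
      auto; try lra.
    - apply jet_wave.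
    - intros j t Hj Ht; replace j with O by lia; simpl.
      rewrite Cmult_1_l, Cmod_wave, !Rmult_1_l.
      eapply Rle_trans; [apply exp_Im_le|]; apply exp_le_mono.
      apply Rmult_le_compat_r; [apply Rabs_pos | lra].
    - assert (HE : (fun t => Cpow (- Ci * w) 0 * wave w t)%C = wave w).
      { apply functional_extensionality; intros t; simpl; ring. }
      cbv beta in HO; rewrite HE in HO.
      rewrite FL_eq, HO.
      eapply Rle_trans; [apply (distribution0_bound 0%R e 2 U) || idtac|].
      { destruct HU as (_ & _ & _ & _ & H3).
        apply (H3 d' (4 * exp (R0 + 1)) Hd'); intros j t Hj Ht.
        eapply Rle_trans; [apply Hw'; auto|]; replace j with O by lia.
        rewrite pow_O, !Rmult_1_r, Rmult_1_l.
        apply Rmult_le_compat; [apply pow_le; lra | left; apply exp_pos | |].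
        - destruct (length l) as [|[|[|n]]]; simpl; [lra | lra | lra | lia].
        - apply exp_le_mono. rewrite <- (Rmult_1_r (R0 + 1)) at 2.
          apply Rmult_le_compat_l; lra. }
      lra. }
  exists (fun z => FL (divided (z :: nil) U) z); split; [|split].
  - intros z Hz; apply HOp; [simpl; lia | | exact Hz]. intros mu [<-|[]]; exact Hz.
  - intros z w Hz Hw.
    destruct (distribution_resolvent _ _ _ _ z HU) as (c1 & _ & H1).
    replace (sinc e w - sinc e z - (w - z) * FL (divided (z :: nil) U) z)%C
      with ((w - z) * (w - z) * FL (divided (z :: z :: nil) U) w)%C.
    + rewrite !Cmod_mult, Rmult_comm; apply Rmult_le_compat_r.
      * apply Rmult_le_pos; apply Cmod_ge_0.
      * apply HOp; [simpl; lia | | exact Hw]. intros mu [<-|[<-|[]]]; exact Hz.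
    + rewrite <- !HF.
      assert (J1 := FL_resolvent _ _ _ _ z w HU); assert (J2 := FL_resolvent _ _ _ _ z w H1).
      rewrite <- J1; simpl divided.
      transitivity ((w - z) * ((w - z) * FL (fun f : R -> C => (fun f0 : R -> C =>
         U (fun t : R => - Ci * resolvent z f0 t)) (fun t : R => - Ci * resolvent z f t)) w))%C;
           [simpl; ring|].
      rewrite J2; ring.
  - intros z w Hz Hw; rewrite <- !HF, <- (FL_resolvent _ _ _ _ z w HU), Cmod_mult, Rmult_comm.
    apply Rmult_le_compat_r; [apply Cmod_ge_0|].
    apply (HOp (z :: nil)); [simpl; lia | | exact Hw]. intros mu [<-|[]]; exact Hz.
Qed.

(** * Sums of entire functions *)

Lemma Cpow_taylor a b eta n : Cmod a <= eta -> Cmod b <= eta ->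
  Cmod (Cpow a (S (S n)) - Cpow b (S (S n)) - INR (S (S n)) * Cpow b (S n) * (a - b))
    <= INR (S (S n)) ^ 2 * eta ^ n * (Cmod (a - b) * Cmod (a - b)).
Proof.
  intros Ha Hb; assert (He : 0 <= eta) by (generalize (Cmod_ge_0 a); lra).
  assert (Hab : 0 <= Cmod (a - b) * Cmod (a - b)) by (apply Rmult_le_pos; apply Cmod_ge_0).
  induction n as [|n IH].
  - replace (Cpow a 2 - Cpow b 2 - INR 2 * Cpow b 1 * (a - b))%C with ((a - b) * (a - b))%C.
    + rewrite Cmod_mult; simpl; lra.
    + simpl INR; rewrite RtoC_plus; simpl; ring.
  - set (k := S (S n)) in *.
    replace (Cpow a (S k) - Cpow b (S k) - INR (S k) * Cpow b k * (a - b))%C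
      with (a * (Cpow a k - Cpow b k - INR k * Cpow b (S n) * (a - b))
            + INR k * Cpow b (S n) * ((a - b) * (a - b)))%C.
    2:{ rewrite (S_INR k), RtoC_plus; unfold k; simpl Cpow; ring. }
    eapply Rle_trans; [apply Cmod_triangle|]; rewrite !Cmod_mult, Cmod_pow, Cmod_R.
    rewrite (Rabs_pos_eq (INR k)) by apply pos_INR.
    assert (Hen : 0 <= eta ^ n) by now apply pow_le.
    assert (Hk := pos_INR k).
    assert (H1 : Cmod a * Cmod (Cpow a k - Cpow b k - INR k * Cpow b (S n) * (a - b))
       <= eta * (INR k ^ 2 * eta ^ n * (Cmod (a - b) * Cmod (a - b)))).
    { apply Rmult_le_compat; auto; apply Cmod_ge_0. }
    assert (H2 : Cmod b ^ S n <= eta ^ S n).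
    { apply pow_incr; split; [apply Cmod_ge_0 | exact Hb]. }
    set (D := Cmod (a - b) * Cmod (a - b)) in *.
    assert (H3 : INR k * Cmod b ^ S n * D <= INR k * eta ^ S n * D).
    { apply Rmult_le_compat_r; [exact Hab|]; apply Rmult_le_compat_l; assumption. }
    eapply Rle_trans; [apply Rplus_le_compat; [exact H1 | exact H3]|].
    assert (H4 : 0 <= eta * eta ^ n * D)
      by (apply Rmult_le_pos; [apply Rmult_le_pos; assumption | exact Hab]).
    rewrite (S_INR k).
    replace ((INR k + 1) ^ 2 * eta ^ S n * D)
      with ((INR k * INR k + 2 * INR k + 1) * (eta * eta ^ n * D)) by (simpl; ring).
    replace (eta * (INR k ^ 2 * eta ^ n * D) + INR k * eta ^ S n * D)
      with ((INR k * INR k + INR k) * (eta * eta ^ n * D)) by (simpl; ring).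
    apply Rmult_le_compat_r; [exact H4 | lra].
Qed.

(** A quadratic Taylor bound with summable constants passes to the sum, whose
    derivative is the sum of the derivatives. *)
Lemma entire_series (f : nat -> C -> C) :
  (forall R0, 0 < R0 -> exists (B : nat -> R) (d : nat -> C -> C), ex_series B /\
     forall n z w, Cmod z <= R0 -> Cmod w <= R0 ->
       Cmod (f n z) <= B n /\ Cmod (d n z) <= B n /\
       Cmod (f n w - f n z - (w - z) * d n z) <= B n * (Cmod (w - z) * Cmod (w - z))) ->
  entire (fun z => CSeries (fun n => f n z)).
Proof.
  intros H z.
  destruct (H (Cmod z + 2)) as (B & d & HB & Hf); [generalize (Cmod_ge_0 z); lra|].
  assert (Hz2 : Cmod z <= Cmod z + 2) by lra.
  set (q := fun z => CSeries (fun n => f n z)).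
  set (l := CSeries (fun n => d n z)).
  assert (HB0 : forall n, 0 <= B n).
  { intros n; eapply Rle_trans; [apply Cmod_ge_0 | apply (Hf n z z); auto]. }
  assert (Hdiff : forall w, Cmod (w - z) <= 2 ->
    Cmod (q w - q z - (w - z) * l) <= 2 * Series B * (Cmod (w - z) * Cmod (w - z))).
  { intros w Hw.
    assert (Hw2 : Cmod w <= Cmod z + 2).
    { replace w with (z + (w - z))%C by ring; eapply Rle_trans; [apply Cmod_triangle|]; lra. }
    assert (Sw : Csummable (fun n => f n w)) by (exists B; split; auto; intros n; now apply (Hf n w w)).
    assert (Sz : Csummable (fun n => f n z)) by (exists B; split; auto; intros n; now apply (Hf n z z)).
    assert (Sd : Csummable (fun n => d n z)) by (exists B; split; auto; intros n; now apply (Hf n z z)).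
    assert (Sc : forall k a, Csummable a -> Csummable (fun n => k * a n)%C).
    { intros k a (g & Ha & Hg); exists (fun n => Cmod k * g n); split.
      - intros n; rewrite Cmod_mult; apply Rmult_le_compat_l; [apply Cmod_ge_0 | apply Ha].
      - now apply ex_series_Rscal. }
    assert (Sp : forall a e, Csummable a -> Csummable e -> Csummable (fun n => a n + e n)%C).
    { intros a e (g & Ha & Hg) (h & He & Hh); exists (fun n => g n + h n); split.
      - intros n; eapply Rle_trans; [apply Cmod_triangle|]; apply Rplus_le_compat; auto.
      - exact (ex_series_plus (K := R_AbsRing) (V := R_NormedModule) g h Hg Hh). }
    replace (q w - q z - (w - z) * l)%C
      with (CSeries (fun n => f n w + ((-1) * f n z + (- (w - z)) * d n z))%C).
    - eapply Rle_trans; [apply (CSeries_bound _ (fun n => Cmod (w - z) * Cmod (w - z) * B n))|].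
      + intros n; replace (f n w + (-1 * f n z + - (w - z) * d n z))%C
          with (f n w - f n z - (w - z) * d n z)%C by ring.
        rewrite (Rmult_comm (_ * _) (B n)); now apply (Hf n z w).
      + now apply ex_series_Rscal.
      + rewrite Series_scal_l; right; ring.
    - rewrite (CSeries_plus (fun n => f n w) (fun n => (-1) * f n z + (- (w - z)) * d n z)%C) by auto.
      rewrite (CSeries_plus (fun n => (-1) * f n z)%C (fun n => (- (w - z)) * d n z)%C) by auto.
      rewrite (CSeries_scal (-1) (fun n => f n z)), (CSeries_scal (- (w - z)) (fun n => d n z)) by auto.
      unfold q, l; ring. }
  exists l; split; [apply is_linear_scal_l|].
  intros y Hy; apply (is_filter_lim_locally_unique (K := C_AbsRing)
    (V := AbsRing_NormedModule C_AbsRing) z y) in Hy.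
  rewrite <- Hy; clear y Hy.
  intros eps.
  set (K := 2 * Series B + 1).
  assert (HK : 0 < K).
  { unfold K; assert (0 <= Series B); [|lra].
    rewrite <- (Rmult_0_l (Series B)), <- Series_scal_l; apply Series_le; auto.
    intros n; specialize (HB0 n); lra. }
  assert (Heps := cond_pos eps).
  assert (Hdl : 0 < Rmin 1 (eps / K) / 2).
  { apply Rdiv_lt_0_compat; [|lra]; apply Rmin_pos; [lra | now apply Rdiv_lt_0_compat]. }
  exists (mkposreal _ Hdl); intros w Hw.
  assert (Hwz : Cmod (w - z) <= Rmin 1 (eps / K)).
  { change (Cmod (w - z) < Rmin 1 (eps / K) / 2) in Hw; lra. }
  change (Cmod (q w - q z - (w - z) * l) <= eps * Cmod (w - z)).
  assert (H1 := Rmin_l 1 (eps / K)); assert (H2 := Rmin_r 1 (eps / K)).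
  eapply Rle_trans; [apply Hdiff; lra|].
  assert (Hm := Cmod_ge_0 (w - z)).
  rewrite <- Rmult_assoc; apply Rmult_le_compat_r; [exact Hm|].
  apply Rle_trans with (K * (eps / K)); [|right; field; lra].
  apply Rmult_le_compat; try lra; [|unfold K; lra].
  assert (0 <= Series B); [|lra].
  rewrite <- (Rmult_0_l (Series B)), <- Series_scal_l; apply Series_le; auto.
  intros n; specialize (HB0 n); lra.
Qed.

(** * Peaks *)

Definition log_scale (x : R) : R := ln (2 + Rabs x).

Lemma exp_log_scale x : exp (log_scale x) = 2 + Rabs x.
Proof. unfold log_scale; apply exp_ln; generalize (Rabs_pos x); lra. Qed.

Lemma exp_1_ge_2 : 2 <= exp 1.
Proof. generalize (exp_ineq1_le 1); lra. Qed.

Lemma log_scale_ge_half x : / 2 <= log_scale x.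
Proof.
  apply Rnot_lt_le; intros H.
  assert (H1 : exp (log_scale x) < exp (/ 2)) by now apply exp_increasing.
  rewrite exp_log_scale in H1.
  assert (H2 : exp (/ 2) * exp (/ 2) <= 3).
  { rewrite <- exp_plus; replace (/ 2 + / 2) with 1 by field; apply exp_le_3. }
  generalize (Rabs_pos x); intros Hx; nra.
Qed.

Lemma log_scale_ge_1 x : 1 <= Rabs x -> 1 <= log_scale x.
Proof.
  intros Hx; apply Rnot_lt_le; intros H.
  assert (H1 : exp (log_scale x) < exp 1) by now apply exp_increasing.
  rewrite exp_log_scale in H1; generalize exp_le_3; lra.
Qed.

Lemma log_scale_sublinear K :
  0 <= K -> exists B, forall x, B <= Rabs x -> K * log_scale x <= Rabs x.
Proof.
  intros HK; exists ((2 * K + 2) ^ 2); intros x Hx.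
  set (u := 2 + Rabs x).
  assert (Hu : (2 * K + 2) ^ 2 <= u) by (unfold u; lra).
  set (s := sqrt u).
  assert (Hup : 0 < u) by (unfold u; generalize (Rabs_pos x); lra).
  assert (Hs : 0 < s) by now apply sqrt_lt_R0.
  assert (Hss : s * s = u) by (apply sqrt_def; lra).
  assert (Hs2 : 2 * K + 2 <= s).
  { apply Rnot_lt_le; intros Hlt; nra. }
  assert (Hln : ln s <= s).
  { apply Rnot_lt_le; intros Hlt; apply exp_increasing in Hlt; rewrite exp_ln in Hlt by exact Hs.
    generalize (exp_ineq1_le s); lra. }
  assert (Hlu : log_scale x <= 2 * s).
  { unfold log_scale; fold u; rewrite <- Hss, ln_mult by exact Hs; lra. }
  assert (Hxu : Rabs x = s * s - 2) by (rewrite Hss; unfold u; ring).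
  rewrite Hxu; nra.
Qed.

Lemma ex_series_inv_sq b : 0 < b -> ex_series (fun n => / (2 + node b n) ^ 2).
Proof.
  intros Hb.
  assert (Hp : 0 < PI / b) by (apply Rdiv_lt_0_compat; [apply PI_RGT_0 | exact Hb]).
  set (dl := Rmin 2 (PI / b / 2)).
  assert (Hd : 0 < dl) by (apply Rmin_pos; lra).
  (* A telescoping series. *)
  assert (Hbase : ex_series (fun n => / ((INR n + 1) * (INR n + 2)))).
  { exists 1; change (is_lim_seq (sum_n (fun n => / ((INR n + 1) * (INR n + 2)))) 1).
    apply (is_lim_seq_ext (fun n => 1 - / (INR n + 2))).
    - intros n; rewrite Rsum_sum_n; induction n as [|n IH]; [simpl; field|].
      change (Rsum ?f (S (S n))) with (Rsum f (S n) + f (S n)).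
      cbv beta; rewrite <- IH, S_INR; field.
      generalize (pos_INR n); lra.
    - replace (Finite 1) with (Rbar_minus 1 0) by (simpl; f_equal; ring).
      apply is_lim_seq_minus'; [apply is_lim_seq_const|].
      apply (is_lim_seq_ext (fun n => / INR (n + 2))).
      { intros n; rewrite plus_INR; simpl; f_equal; ring. }
      apply (is_lim_seq_incr_n (fun n => / INR n) 2).
      replace (Finite 0) with (Rbar_inv p_infty) by reflexivity.
      apply is_lim_seq_inv; [apply is_lim_seq_INR | discriminate]. }
  apply @ex_series_le with (b := fun n => 2 / dl ^ 2 * / ((INR n + 1) * (INR n + 2)));
    [|now apply ex_series_Rscal].
  intros n; assert (Hn := pos_INR n).
  assert (Hnode : dl * (INR n + 1) <= 2 + node b n).
  { unfold node; assert (H1 := Rmin_l 2 (PI / b / 2)); assert (H2 := Rmin_r 2 (PI / b / 2)).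
    fold dl in H1, H2. nra. }
  assert (0 < dl * (INR n + 1)) by nra.
  unfold norm; simpl norm; unfold abs; simpl abs.
  rewrite Rabs_pos_eq by (left; apply Rinv_0_lt_compat, pow_lt; lra).
  apply Rle_trans with (/ (dl * (INR n + 1)) ^ 2).
  - apply Rinv_le_contravar; [now apply pow_lt | apply pow_incr; lra].
  - replace (2 / dl ^ 2 * / ((INR n + 1) * (INR n + 2)))
      with (/ (dl * (INR n + 1)) ^ 2 * (2 * (INR n + 1) / (INR n + 2))) by (field; lra).
    rewrite <- (Rmult_1_r (/ _)) at 1; apply Rmult_le_compat_l.
    + left; apply Rinv_0_lt_compat; now apply pow_lt.
    + apply (Rmult_le_reg_r (INR n + 2)); [lra|]. field_simplify; lra.
Qed.

(** The decay of order k sets in at distance comparable to k from x, and the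
    exponential type is 1 whatever k is. *)
Definition peak (x : R) (k : nat) (z : C) : C := Cpow (2 * sinc (/ INR k) (z - x)) k.

Lemma Cpow_mult_distr (a b : C) n : Cpow (a * b) n = (Cpow a n * Cpow b n)%C.
Proof. induction n as [|n IH]; simpl; [ring | rewrite IH; ring]. Qed.

Lemma half_pow_exp k : (/ 2) ^ k <= exp (- (INR k / 2)).
Proof.
  replace (- (INR k / 2)) with (INR k * - / 2) by field.
  rewrite exp_INR_mult; apply pow_incr; split; [lra|].
  rewrite exp_Ropp; apply Rinv_le_contravar; [apply exp_pos|].
  assert (H2 : exp (/ 2) * exp (/ 2) <= 3).
  { rewrite <- exp_plus; replace (/ 2 + / 2) with 1 by field; apply exp_le_3. }
  apply Rnot_lt_le; intros H; nra.
Qed.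

Lemma four_pow_exp k : 4 ^ k <= exp (2 * INR k).
Proof.
  rewrite Rmult_comm, exp_INR_mult; apply pow_incr; split; [lra|].
  replace 2 with (1 + 1) by ring; rewrite exp_plus; generalize exp_1_ge_2; nra.
Qed.

(** Within a L of x the peak is at most 4^k <= e^(a L / 2), which the hypothesis on
    psi beats. At distance r > a L >= 4 k the peak is at most (2 k / r)^k: N + 2 of
    these factors pay for the polynomial growth of psi and for (2 + |y|)^2, up to
    e^(5 (N + 2) L), and the other ones give 2^(- k) <= e^(- a L / 16).
    The coefficients of a are chosen for this balance. *)
Lemma peak_product_bound N c (psi : C -> C) j k x a L :
  0 <= c -> (forall y : R, Cmod (psi (RtoC y)) <= c * (1 + Rabs y) ^ N) ->
  L = log_scale x -> 1 <= L -> a = 160 * INR (N + 2) + 32 * INR j + 16 ->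
  16 * (a * L) <= Rabs x -> a * L / 8 <= INR k <= a * L / 4 -> (N + 2 <= k)%nat ->
  (forall y : R, Rabs (y - x) <= a * L -> Cmod (psi (RtoC y)) <= exp (- (a * L))) ->
  forall y : R, Cmod (peak x k (RtoC y) * psi (RtoC y))
                <= (1 + c) * exp (- INR j) * / (2 + Rabs y) ^ 2.
Proof.
  intros Hc Hpsi HL HL1 Ha Hx Hk HNk Hbad y.
  assert (Hj := pos_INR j); assert (HN := pos_INR (N + 2)).
  assert (HaL : 16 <= a * L) by nra.
  assert (Hk0 : 0 < INR k) by lra.
  assert (HV : exp L = 2 + Rabs x) by (rewrite HL; apply exp_log_scale).
  assert (Hx0 := Rabs_pos x); assert (Hy0 := Rabs_pos y).
  assert (Hyp : 0 < (2 + Rabs y) ^ 2) by (apply pow_lt; lra).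
  assert (HjL : INR j <= INR j * L) by nra.
  assert (He : 0 < / INR k) by now apply Rinv_0_lt_compat.
  apply (Rmult_le_reg_r ((2 + Rabs y) ^ 2)); [exact Hyp|].
  rewrite (Rmult_assoc _ (/ _)), Rinv_l, Rmult_1_r by lra.
  unfold peak; rewrite Cmod_mult, Cmod_pow, Cmod_mult, Cmod_R, (Rabs_pos_eq 2) by lra.
  rewrite <- RtoC_minus.
  assert (Htri : Rabs y <= Rabs x + Rabs (y - x)).
  { replace y with (x + (y - x)) at 1 by ring; apply Rabs_triang. }
  destruct (Rle_dec (Rabs (y - x)) (a * L)) as [Hnear|Hfar].
  - specialize (Hbad y Hnear).
    assert (Hs := sinc_real_bound (/ INR k) (y - x) He).
    assert (H1 : (2 * Cmod (sinc (/ INR k) (RtoC (y - x)))) ^ k <= exp (2 * INR k)).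
    { eapply Rle_trans; [|apply four_pow_exp]; apply pow_incr; split; [|lra].
      generalize (Cmod_ge_0 (sinc (/ INR k) (RtoC (y - x)))); lra. }
    assert (H2 : (2 + Rabs y) ^ 2 <= exp (4 * L)).
    { replace (4 * L) with (INR 2 * (L + L)) by (simpl; ring).
      rewrite exp_INR_mult, exp_plus; apply pow_incr; split; [lra|].
      rewrite HV; nra. }
    apply Rle_trans with (exp (2 * INR k) * exp (- (a * L)) * exp (4 * L)).
    + apply Rmult_le_compat; [| lra | | exact H2].
      * apply Rmult_le_pos; [apply pow_le | apply Cmod_ge_0].
        generalize (Cmod_ge_0 (sinc (/ INR k) (RtoC (y - x)))); lra.
      * apply Rmult_le_compat; auto; [apply pow_le | apply Cmod_ge_0].
        generalize (Cmod_ge_0 (sinc (/ INR k) (RtoC (y - x)))); lra.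
    + rewrite <- !exp_plus; apply Rle_trans with (exp (- INR j)).
      * apply exp_le_mono.
        assert (a * L = 160 * INR (N + 2) * L + 32 * (INR j * L) + 16 * L) by (rewrite Ha; ring).
        assert (0 <= INR (N + 2) * L) by nra. lra.
      * generalize (exp_pos (- INR j)); nra.
  - apply Rnot_le_lt in Hfar.
    set (r := Rabs (y - x)) in *.
    assert (Hr : 4 * INR k <= r) by lra.
    assert (Hyx : RtoC (y - x) <> 0%C).
    { apply RtoC_neq; intros H0; unfold r in Hfar; rewrite H0, Rabs_R0 in Hfar; lra. }
    assert (Hs := sinc_far (/ INR k) _ He Hyx).
    replace (Rabs (Im (RtoC (y - x)))) with 0 in Hs by (simpl; now rewrite Rabs_R0).
    rewrite Rmult_0_r, exp_0, Cmod_R in Hs; fold r in Hs.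
    set (s := Cmod (sinc (/ INR k) (RtoC (y - x)))) in *.
    assert (Hs0 : 0 <= s) by apply Cmod_ge_0.
    assert (Hs1 : 2 * s <= 2 * INR k / r).
    { replace (2 * INR k / r) with (2 * (1 / (/ INR k * r))) by (field; lra). lra. }
    assert (Hs2 : 2 * s <= / 2).
    { eapply Rle_trans; [exact Hs1|]. apply (Rmult_le_reg_r r); [lra|].
      replace (2 * INR k / r * r) with (2 * INR k) by (field; lra). lra. }
    set (m := (N + 2)%nat) in *.
    destruct (Nat.le_exists_sub m k HNk) as (p & Hp & _).
    assert (Hpsi' := Hpsi y).
    assert (HkV : INR k <= 2 + Rabs x) by lra.
    assert (H1 : (2 * s) ^ k * (2 + Rabs y) ^ m <= exp (INR m * (5 * L)) * exp (- (INR k / 2))).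
    { apply Rle_trans with (exp (INR m * (5 * L)) * (/ 2) ^ k).
      2:{ apply Rmult_le_compat_l; [left; apply exp_pos | apply half_pow_exp]. }
      rewrite exp_INR_mult, Hp, !pow_add.
      replace ((2 * s) ^ p * (2 * s) ^ m * (2 + Rabs y) ^ m)
        with ((2 * s * (2 + Rabs y)) ^ m * (2 * s) ^ p) by (rewrite Rpow_mult_distr; ring).
      replace (exp (5 * L) ^ m * ((/ 2) ^ p * (/ 2) ^ m))
        with ((exp (5 * L) * / 2) ^ m * (/ 2) ^ p) by (rewrite Rpow_mult_distr; ring).
      assert (Hsy : 0 <= 2 * s * (2 + Rabs y)) by nra.
      apply Rmult_le_compat; [now apply pow_le | apply pow_le; lra | | apply pow_incr; lra].
      apply pow_incr; split; [exact Hsy|].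
      assert (H5 : exp (5 * L) = (2 + Rabs x) ^ 5).
      { replace (5 * L) with (INR 5 * L) by (simpl; ring); now rewrite exp_INR_mult, HV. }
      rewrite H5.
      set (V := 2 + Rabs x) in *.
      assert (HV2 : 16 <= V) by (unfold V; lra).
      apply Rle_trans with (2 * INR k / r * (2 * V * r)).
      - apply Rmult_le_compat; [lra | lra | exact Hs1 |].
        assert (Hr1 : 1 <= r) by lra. unfold V in *; nra.
      - replace (2 * INR k / r * (2 * V * r)) with (4 * V * INR k) by (field; lra).
        apply Rle_trans with (4 * V * V); [nra|].
        assert (8 <= V * V * V) by nra.
        replace (V ^ 5 * / 2) with (V * V * (V * V * V * / 2)) by field.
        nra. }
    apply Rle_trans with (c * ((2 * s) ^ k * (2 + Rabs y) ^ m)).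
    + unfold m; rewrite pow_add, <- !Rmult_assoc.
      apply Rmult_le_compat_r; [lra|].
      rewrite (Rmult_comm c), Rmult_assoc.
      apply Rmult_le_compat_l; [apply pow_le; lra|].
      eapply Rle_trans; [exact Hpsi'|]; apply Rmult_le_compat_l; [exact Hc|].
      apply pow_incr; lra.
    + apply Rle_trans with (c * exp (- INR j)).
      * apply Rmult_le_compat_l; [exact Hc|]; eapply Rle_trans; [exact H1|].
        rewrite <- exp_plus; apply exp_le_mono.
        assert (a * L = 160 * (INR m * L) + 32 * (INR j * L) + 16 * L) by (rewrite Ha; unfold m; ring).
        assert (0 <= INR m * L) by nra. lra.
      * generalize (exp_pos (- INR j)); nra.
Qed.

(** With k between a L / 8 and a L / 4 the peak exceeds every power of 2 + |x| up to
    the j-th, since 2^k >= e^(a L / 16) and a >= 16 j. The bound 1/8 on the disc of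
    radius j comes from |x| >= 64 k, and serves to sum the peaks. *)
Lemma peak_exists N A c S : distribution N A c S ->
  (forall a B, exists x, B <= Rabs x /\
      forall z : C, Cmod (z - x) <= a * log_scale x ->
  Cmod (FL S z) <= exp (- (a * log_scale x))) ->
  exists C0, 0 <= C0 /\ forall j : nat, exists (x : R) (k : nat) (T : (R -> C) -> C),
    (2 <= k)%nat /\ (j <= k)%nat /\ (exists n, k = (2 * n)%nat) /\
    (forall z, Cmod z <= INR j -> Cmod (2 * sinc (/ INR k) (z - x)) <= / 8) /\
    (2 + Rabs x) ^ j <= 2 ^ k /\
    distribution 0 (A + 2) (C0 * exp (- INR j)) T /\
    forall z, FL T z = (peak x k z * FL S z)%C.
Proof.
  intros HS Hbad.
  assert (HA : 0 <= A) by apply HS.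
  assert (Hc : 0 <= c) by apply HS.
  set (b := A + 2); assert (Hb : 0 < b) by (unfold b; lra).
  set (G := fun n => / (2 + node b n) ^ 2).
  assert (HG : ex_series G) by now apply ex_series_inv_sq.
  assert (Hnode : forall n, 0 < node b n).
  { intros n; unfold node; apply Rmult_lt_0_compat.
    - generalize (pos_INR n); lra.
    - apply Rdiv_lt_0_compat; [apply PI_RGT_0 | exact Hb]. }
  assert (HG0 : 0 <= Series G).
  { rewrite <- (Rmult_0_l (Series G)), <- Series_scal_l; apply Series_le; [|exact HG].
    intros n; assert (0 < G n); [|lra].
    unfold G; apply Rinv_0_lt_compat, pow_lt; generalize (Hnode n); lra. }
  exists (8 * ((1 + c) * Series G)); split; [apply Rmult_le_pos; [lra | apply Rmult_le_pos; lra]|].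
  intros j.
  set (a := 160 * INR (N + 2) + 32 * INR j + 16).
  assert (Hj := pos_INR j); assert (HN := pos_INR (N + 2)).
  destruct (log_scale_sublinear (16 * a)) as (B & HB); [unfold a; lra|].
  destruct (Hbad a (Rmax 1 B)) as (x & HxB & Hx).
  assert (Hx1 : 1 <= Rabs x) by (eapply Rle_trans; [apply Rmax_l | exact HxB]).
  assert (HxaL : 16 * (a * log_scale x) <= Rabs x).
  { rewrite <- Rmult_assoc; apply HB; eapply Rle_trans; [apply Rmax_r | exact HxB]. }
  assert (HL := log_scale_ge_1 x Hx1); set (L := log_scale x) in *.
  assert (Ha16 : 16 <= a) by (unfold a; lra).
  assert (HaL : a <= a * L) by nra.
  destruct (nfloor_ex (a * L / 8)) as (n & Hn1 & Hn2); [lra|].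
  set (k := (2 * n)%nat).
  assert (Hk : INR k = 2 * INR n) by (unfold k; rewrite mult_INR; simpl; ring).
  assert (Hkb : a * L / 8 <= INR k <= a * L / 4) by lra.
  assert (Hkj : 4 * INR j <= INR k) by (unfold a in *; lra).
  assert (HkN : INR (N + 2) <= INR k) by (unfold a in *; lra).
  apply INR_le in HkN.
  assert (Hk0 : 0 < INR k) by lra.
  assert (He : 0 < / INR k) by now apply Rinv_0_lt_compat.
  exists x, k.
  destruct (distribution_avg_iter N A c S (/ INR k) x k HS He) as (c1 & S1 & D1 & F1).
  replace (N - k)%nat with O in D1 by lia.
  rewrite Rinv_r in D1 by lra.
  assert (D2 := distribution_const _ _ _ _ (Cpow 2 k) D1).
  set (S2 := fun f => (Cpow 2 k * S1 f)%C) in *.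
  assert (F2 : forall z, FL S2 z = (peak x k z * FL S z)%C).
  { intros z; change (FL S2 z) with (Cpow 2 k * FL S1 z)%C; rewrite F1.
    unfold peak; rewrite Cpow_mult_distr; ring. }
  assert (Hpsi : forall y : R, Cmod (FL S (RtoC y)) <= c * (1 + Rabs y) ^ N).
  { intros y; eapply Rle_trans; [apply (FL_growth N A c S _ HS)|].
    rewrite Cmod_R. simpl Im; rewrite Rabs_R0, Rmult_0_l, exp_0, Rmult_1_r; lra. }
  assert (Hprod := peak_product_bound N c (FL S) j k x a L Hc Hpsi eq_refl HL eq_refl HxaL Hkb HkN).
  assert (Hprod' : forall y : R, Cmod (FL S2 (RtoC y)) <= (1 + c) * exp (- INR j) * / (2 + Rabs y) ^ 2).
  { intros y; rewrite F2; apply Hprod; intros y' Hy'; apply Hx.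
    rewrite <- RtoC_minus, Cmod_R; exact Hy'. }
  destruct (distribution_from_samples (A + 1) _ S2 b (fun n => (1 + c) * exp (- INR j) * G n) D2)
    as (T & DT & FT).
  { unfold b; lra. }
  { intros i; rewrite <- RtoC_opp; unfold G.
    assert (HA1 : Rabs (node b i) = node b i) by (apply Rabs_pos_eq; left; apply Hnode).
    split; eapply Rle_trans; try apply Hprod'; rewrite ?Rabs_Ropp, HA1; lra. }
  { now apply ex_series_Rscal. }
  exists T; split; [|split; [|split; [|split; [|split; [|split]]]]].
  - lia.
  - apply INR_le; lra.
  - now exists n.
  - intros z Hz.
    assert (Hxz : Rabs x <= Cmod (z - x) + Cmod z).
    { rewrite <- (Cmod_R x); replace (RtoC x) with (- (z - x) + z)%C at 1 by ring.
      eapply Rle_trans; [apply Cmod_triangle|]; rewrite Cmod_opp; lra. }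
    assert (Hm : 63 * INR k <= Cmod (z - x)) by lra.
    assert (Hne : (z - x)%C <> 0%C).
    { intros H0; rewrite H0, Cmod_0 in Hm; lra. }
    rewrite Cmod_mult, Cmod_R, (Rabs_pos_eq 2) by lra.
    assert (Hs := sinc_far (/ INR k) (z - x)%C He Hne).
    assert (Hexp : exp (/ INR k * Rabs (Im (z - x)%C)) <= 3).
    { eapply Rle_trans; [|apply exp_le_3]; apply exp_le_mono.
      apply (Rmult_le_reg_l (INR k)); [exact Hk0|].
      rewrite <- Rmult_assoc, Rinv_r, Rmult_1_l, Rmult_1_r by lra.
      replace (Im (z - x)%C) with (Im z) by (simpl; unfold Im; ring).
      eapply Rle_trans; [apply Rabs_Im_le_Cmod|]; lra. }
    assert (Hs2 : Cmod (sinc (/ INR k) (z - x)) <= 3 / 63).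
    { eapply Rle_trans; [exact Hs|].
      apply Rle_trans with (3 / (/ INR k * Cmod (z - x))).
      - apply Rmult_le_compat_r; [left; apply Rinv_0_lt_compat; nra | exact Hexp].
      - apply Rmult_le_compat_l; [lra|]; apply Rinv_le_contravar; [lra|].
        apply (Rmult_le_reg_l (INR k)); [exact Hk0|].
        rewrite <- Rmult_assoc, Rinv_r, Rmult_1_l by lra; lra. }
    lra.
  - rewrite <- exp_log_scale, <- exp_INR_mult; fold L.
    apply Rle_trans with (exp (INR k / 2)).
    + apply exp_le_mono.
      assert (a * L = 160 * (INR (N + 2) * L) + 32 * (INR j * L) + 16 * L) by (unfold a; ring).
      assert (0 <= INR (N + 2) * L) by nra. assert (0 <= INR j * L) by nra. lra.
    + assert (Hh := half_pow_exp k). rewrite exp_Ropp, pow_inv in Hh.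
      assert (H2 : 0 < 2 ^ k) by (apply pow_lt; lra).
      apply Rinv_le_contravar in Hh; [|now apply Rinv_0_lt_compat].
      rewrite !Rinv_inv in Hh; exact Hh.
  - replace (8 * ((1 + c) * Series G) * exp (- INR j))
      with (8 * Series (fun n => (1 + c) * exp (- INR j) * G n)).
    + exact DT.
    + rewrite Series_scal_l; ring.
  - intros z; rewrite FT; apply F2.
Qed.

(** * The division property implies slow decrease *)

Lemma nat_choice (X : Type) (P : nat -> X -> Prop) :
  (forall n, exists x, P n x) -> exists f, forall n, P n (f n).
Proof.
  intros H; exists (fun n => proj1_sig (constructive_indefinite_description _ (H n))).
  intros n; exact (proj2_sig (constructive_indefinite_description _ (H n))).
Qed.

Lemma sq_le_two_pow k : INR k ^ 2 <= 2 * 2 ^ k.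
Proof.
  assert (H : INR k ^ 2 + INR k + 2 <= 2 * 2 ^ k).
  { induction k as [|k IH]; [simpl; lra|].
    rewrite S_INR; change (2 ^ S k) with (2 * 2 ^ k).
    assert (INR k <= INR k ^ 2).
    { destruct k as [|k]; [simpl; lra|].
      assert (1 <= INR (S k)) by (rewrite S_INR; generalize (pos_INR k); lra). nra. }
    nra. }
  generalize (pos_INR k); lra.
Qed.

(** On a fixed disc all but finitely many peaks are k-th powers of functions of
    modulus at most 1/8, so that value, derivative and Taylor remainder are at most
    a constant times k^2 8^(- k); the first peaks only need to be bounded. *)
Lemma peak_local (xs : nat -> R) (ks : nat -> nat) :
  (forall j, (2 <= ks j)%nat /\ (j <= ks j)%nat) ->
  (forall j z, Cmod z <= INR j -> Cmod (2 * sinc (/ INR (ks j)) (z - xs j)) <= / 8) ->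
  forall R0, 0 < R0 -> exists (B : nat -> R) (d : nat -> C -> C), ex_series B /\
    forall n z w, Cmod z <= R0 -> Cmod w <= R0 ->
      Cmod (peak (xs n) (ks n) z) <= B n /\ Cmod (d n z) <= B n /\
      Cmod (peak (xs n) (ks n) w - peak (xs n) (ks n) z - (w - z) * d n z)
        <= B n * (Cmod (w - z) * Cmod (w - z)).
Proof.
  intros Hks Hsmall R0 HR0.
  assert (He : forall j, 0 < / INR (ks j) <= 1).
  { intros j; destruct (Hks j) as [H2 _]; apply le_INR in H2; simpl in H2; split.
    - apply Rinv_0_lt_compat; lra.
    - rewrite <- Rinv_1; apply Rinv_le_contravar; lra. }
  destruct (nat_choice _ _ (fun j => sinc_taylor (/ INR (ks j)) R0 (He j) (Rlt_le _ _ HR0)))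
    as (dd & Hdd).
  set (Kc := 8 * exp (R0 + 1)) in *.
  assert (HKc : 0 <= Kc) by (unfold Kc; generalize (exp_pos (R0 + 1)); lra).
  (* A bound of the base of the j-th peak on the disc of radius R0. *)
  set (eta := fun j : nat => if Rle_dec R0 (INR j) then / 8 else 4 * exp R0).
  assert (Heta0 : forall j, 0 < eta j).
  { intros j; unfold eta; destruct Rle_dec; generalize (exp_pos R0); lra. }
  assert (HIm : forall (z : C) (x : R), Rabs (Im (z - x)%C) <= Cmod z).
  { intros z x; replace (Im (z - x)%C) with (Im z) by (simpl; unfold Im; ring).
    apply Rabs_Im_le_Cmod. }
  assert (Heta : forall j z, Cmod z <= R0 -> Cmod (2 * sinc (/ INR (ks j)) (z - xs j)) <= eta j).
  { intros j z Hz; unfold eta; destruct Rle_dec as [Hj|Hj]; [apply Hsmall; lra|].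
    rewrite Cmod_mult, Cmod_R, (Rabs_pos_eq 2) by lra.
    replace (z - xs j)%C with (z - xs j - RtoC 0)%C by ring.
    rewrite <- window_coef_wave; destruct (He j) as [He0 He1].
    assert (Hb : Cmod (window_coef (/ INR (ks j)) 0 (wave (z - xs j))) <= 2 * exp R0); [|lra].
    apply window_coef_bound; [exact He0 | apply Ccontinuous_wave|]; intros t Ht; rewrite Cmod_wave.
    eapply Rle_trans; [apply exp_Im_le|]; apply exp_le_mono.
    rewrite <- (Rmult_1_r R0); apply Rmult_le_compat; try apply Rabs_pos; [|lra].
    eapply Rle_trans; [apply HIm | exact Hz]. }
  set (Q := (1 + 2 * Kc) ^ 2).
  set (B := fun j => INR (ks j) ^ 2 * eta j ^ (ks j - 2) * ((1 + eta j) ^ 2 * Q)).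
  exists B, (fun j z => INR (ks j) * Cpow (2 * sinc (/ INR (ks j)) (z - xs j)) (ks j - 1)
               * (2 * dd j (z - xs j)))%C.
  split.
  - destruct (INR_unbounded R0) as (j0 & HJ).
    apply (ex_series_incr_n B j0).
    apply @ex_series_le with (b := fun n => 512 * Q * (/ 4) ^ n).
    2:{ apply ex_series_Rscal; exists (/ (1 - / 4)); apply is_series_geom.
        rewrite Rabs_pos_eq; lra. }
    intros n; unfold norm; simpl norm; unfold abs; simpl abs.
    assert (HQ : 0 <= Q) by (unfold Q; apply pow2_ge_0).
    assert (Heq : eta (j0 + n)%nat = / 8).
    { unfold eta; destruct Rle_dec as [|Hn]; [reflexivity|exfalso; apply Hn].
      rewrite plus_INR; generalize (pos_INR n); lra. }
    unfold B; rewrite Heq.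
    destruct (Hks (j0 + n)%nat) as [H2 Hj]; set (k := ks (j0 + n)%nat) in *.
    rewrite Rabs_pos_eq.
    2:{ apply Rmult_le_pos; apply Rmult_le_pos; try apply pow2_ge_0; try exact HQ.
        apply pow_le; lra. }
    assert (H8 : (/ 8) ^ (k - 2) = 64 * ((/ 2) ^ k * (/ 4) ^ k)).
    { rewrite <- Rpow_mult_distr; replace (/ 2 * / 4) with (/ 8) by field.
      replace k with (2 + (k - 2))%nat at 2 by lia.
      rewrite pow_add; simpl; field. }
    rewrite H8.
    assert (Hsq := sq_le_two_pow k).
    assert (H22 : 2 ^ k * (/ 2) ^ k = 1).
    { rewrite <- Rpow_mult_distr; replace (2 * / 2) with 1 by field; apply pow1. }
    assert (H4 : (/ 4) ^ k <= (/ 4) ^ n).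
    { replace k with (n + (k - n))%nat by lia; rewrite pow_add.
      assert (0 <= (/ 4) ^ n) by (apply pow_le; lra).
      assert (0 <= (/ 4) ^ (k - n) <= 1).
      { split; [apply pow_le; lra|]; rewrite <- (pow1 (k - n)); apply pow_incr; lra. }
      nra. }
    assert (H2p : 0 <= (/ 2) ^ k) by (apply pow_le; lra).
    assert (H4p : 0 <= (/ 4) ^ k) by (apply pow_le; lra).
    apply Rle_trans with (2 * 2 ^ k * (64 * ((/ 2) ^ k * (/ 4) ^ k)) * (4 * Q)).
    + apply Rmult_le_compat.
      * apply Rmult_le_pos; [apply pow2_ge_0 | nra].
      * apply Rmult_le_pos; [apply pow2_ge_0 | exact HQ].
      * apply Rmult_le_compat_r; [nra | exact Hsq].
      * apply Rmult_le_compat_r; [exact HQ | lra].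
    + replace (2 * 2 ^ k * (64 * ((/ 2) ^ k * (/ 4) ^ k)) * (4 * Q))
        with (512 * Q * (2 ^ k * (/ 2) ^ k * (/ 4) ^ k)) by ring.
      rewrite H22, Rmult_1_l; apply Rmult_le_compat_l; [lra | exact H4].
  - intros j z w Hz Hw.
    destruct (Hdd j) as (D1 & D2 & D3).
    set (e := / INR (ks j)) in *; set (x := xs j).
    assert (Hz' : Rabs (Im (z - x)%C) <= R0) by (eapply Rle_trans; [apply HIm | exact Hz]).
    assert (Hw' : Rabs (Im (w - x)%C) <= R0) by (eapply Rle_trans; [apply HIm | exact Hw]).
    specialize (D1 _ Hz'); specialize (D2 _ _ Hz' Hw'); specialize (D3 _ _ Hz' Hw').
    replace (w - x - (z - x))%C with (w - z)%C in D2, D3 by ring.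
    set (s := (2 * sinc e (z - x))%C); set (u := (2 * sinc e (w - x))%C).
    assert (Hs : Cmod s <= eta j) by (apply Heta, Hz).
    assert (Hu : Cmod u <= eta j) by (apply Heta, Hw).
    assert (Hm2 : forall v : C, Cmod (2 * v) = 2 * Cmod v).
    { intros v; now rewrite Cmod_mult, Cmod_R, Rabs_pos_eq by lra. }
    set (D := Cmod (w - z)) in *.
    assert (HD : 0 <= D) by apply Cmod_ge_0.
    assert (Hus : Cmod (u - s) <= 2 * Kc * D).
    { replace (u - s)%C with (2 * (sinc e (w - x) - sinc e (z - x)))%C by (unfold u, s; ring).
      rewrite Hm2; lra. }
    assert (Hust : Cmod (u - s - (w - z) * (2 * dd j (z - x)%C)) <= 2 * Kc * (D * D)).
    { replace (u - s - (w - z) * (2 * dd j (z - x)))%C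
        with (2 * (sinc e (w - x) - sinc e (z - x) - (w - z) * dd j (z - x)))%C by (unfold u, s; ring).
      rewrite Hm2; lra. }
    assert (Hd2 : Cmod (2 * dd j (z - x)%C) <= 2 * Kc) by (rewrite Hm2; lra).
    destruct (Hks j) as [H2 _].
    unfold B, peak; fold e x.
    set (k := ks j) in *.
    destruct k as [|[|n]]; [lia|lia|].
    replace (S (S n) - 1)%nat with (S n) by lia.
    replace (S (S n) - 2)%nat with n by lia.
    fold s u.
    set (t := eta j) in *; assert (Ht : 0 < t) by apply Heta0.
    set (K := INR (S (S n))).
    assert (HK : 1 <= K) by (unfold K; rewrite !S_INR; generalize (pos_INR n); lra).
    assert (Htn : 0 <= t ^ n) by (apply pow_le; lra).
    assert (HK2 : 0 <= K ^ 2 * t ^ n) by (apply Rmult_le_pos; [apply pow2_ge_0 | exact Htn]).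
    assert (HsS : Cmod s ^ S n <= t * t ^ n).
    { apply (pow_incr _ _ (S n)); split; [apply Cmod_ge_0 | exact Hs]. }
    assert (HsS0 : 0 <= Cmod s ^ S n) by apply pow_le, Cmod_ge_0.
    assert (HKK : K <= K ^ 2) by (simpl; nra).
    assert (HKp : K * (t * t ^ n) <= K ^ 2 * t ^ n * t).
    { replace (K ^ 2 * t ^ n * t) with (K ^ 2 * (t * t ^ n)) by ring.
      apply Rmult_le_compat_r; [apply Rmult_le_pos; lra | exact HKK]. }
    unfold Q; split; [|split].
    + rewrite Cmod_pow; apply Rle_trans with (t ^ S (S n)).
      * apply pow_incr; split; [apply Cmod_ge_0 | exact Hs].
      * change (t ^ S (S n)) with (t * (t * t ^ n)).
        apply Rle_trans with (K ^ 2 * t ^ n * (t * t)).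
        -- assert (0 <= t * (t * t ^ n)) by (repeat apply Rmult_le_pos; lra).
           assert (1 <= K ^ 2) by lra. nra.
        -- apply Rmult_le_compat_l; [exact HK2|]; simpl.
           assert (1 <= (1 + 2 * Kc) * ((1 + 2 * Kc) * 1)) by nra.
           assert (t * t <= (1 + t) * ((1 + t) * 1)) by nra.
           assert (0 <= (1 + t) * ((1 + t) * 1)) by nra. nra.
    + rewrite !Cmod_mult, Cmod_pow, Cmod_R, Rabs_pos_eq by lra.
      rewrite <- Cmod_mult.
      apply Rle_trans with (K ^ 2 * t ^ n * t * (2 * Kc)).
      * apply Rmult_le_compat; [apply Rmult_le_pos; lra | apply Cmod_ge_0 | | exact Hd2].
        eapply Rle_trans; [|exact HKp]; apply Rmult_le_compat_l; [lra | exact HsS].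
      * rewrite Rmult_assoc; apply Rmult_le_compat_l; [exact HK2|].
        simpl; apply Rmult_le_compat; nra.
    + replace (Cpow u (S (S n)) - Cpow s (S (S n)) - (w - z) * (K * Cpow s (S n) * (2 * dd j (z -
      x))))%C
        with ((Cpow u (S (S n)) - Cpow s (S (S n)) - K * Cpow s (S n) * (u - s))
              + K * Cpow s (S n) * (u - s - (w - z) * (2 * dd j (z - x))))%C by ring.
      eapply Rle_trans; [apply Cmod_triangle|].
      rewrite (Cmod_mult (K * _)), (Cmod_mult K), Cmod_pow, Cmod_R, (Rabs_pos_eq K) by lra.
      assert (T1 := Cpow_taylor u s t n Hu Hs); fold K in T1.
      apply Rle_trans with (K ^ 2 * t ^ n * ((2 * Kc * D) * (2 * Kc * D))
                            + K ^ 2 * t ^ n * t * (2 * Kc * (D * D))).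
      * apply Rplus_le_compat.
        -- eapply Rle_trans; [exact T1|]; apply Rmult_le_compat_l; [exact HK2|].
           apply Rmult_le_compat; try apply Cmod_ge_0; exact Hus.
        -- apply Rmult_le_compat; [apply Rmult_le_pos; lra | apply Cmod_ge_0 | | exact Hust].
           eapply Rle_trans; [|exact HKp]; apply Rmult_le_compat_l; [lra | exact HsS].
      * replace (K ^ 2 * t ^ n * (2 * Kc * D * (2 * Kc * D)) + K ^ 2 * t ^ n * t * (2 * Kc * (D * D)))
          with (K ^ 2 * t ^ n * (4 * Kc * Kc + 2 * t * Kc) * (D * D)) by ring.
        apply Rmult_le_compat_r; [nra|]; apply Rmult_le_compat_l; [exact HK2|].
        simpl.
        assert (0 <= t * Kc) by nra. assert (0 <= Kc * Kc) by nra.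
        assert (0 <= t * (Kc * Kc)) by nra. assert (0 <= t * t) by nra.
        assert (0 <= t * t * Kc) by nra. assert (0 <= t * t * (Kc * Kc)) by nra.
        nra.
Qed.

Lemma Series_ge_term (a : nat -> R) j : (forall n, 0 <= a n) -> ex_series a -> a j <= Series a.
Proof.
  intros Ha Hex; rewrite (Series_incr_n a (S j)) by (lia || assumption).
  assert (H1 : a j <= sum_f_R0 a j).
  { clear Hex; destruct j as [|j]; simpl; [lra|].
    assert (0 <= sum_f_R0 a j) by (now apply cond_pos_sum). lra. }
  assert (H2 : 0 <= Series (fun k => a (S j + k)%nat)).
  { rewrite <- (Rmult_0_l (Series (fun k => a (S j + k)%nat))), <- Series_scal_l.
    apply Series_le; [intros n; specialize (Ha (S j + n)%nat); lra|].
    now apply (ex_series_incr_n a (S j)). }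
  simpl pred; lra.
Qed.

(** Evenness of k keeps the peaks from cancelling each other on the real line. *)
Lemma peak_real x k (y : R) : (2 <= k)%nat -> (exists n, k = (2 * n)%nat) ->
  exists r, 0 <= r /\ peak x k (RtoC y) = RtoC r.
Proof.
  intros H2 (n & Hn).
  assert (He : 0 < / INR k) by (apply Rinv_0_lt_compat, lt_0_INR; lia).
  destruct (sinc_real (/ INR k) (y - x) He) as (r & Hr).
  exists ((2 * r) ^ k); split.
  - rewrite Hn, pow_mult; apply pow_le, pow2_ge_0.
  - unfold peak; rewrite <- RtoC_minus, Hr, <- RtoC_mult; generalize (2 * r); intros v.
    clear; induction k as [|k IH]; simpl; [reflexivity|]. now rewrite IH, RtoC_mult.
Qed.

Lemma peak_center x k : (2 <= k)%nat -> peak x k (RtoC x) = RtoC (2 ^ k).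
Proof.
  intros H2; unfold peak.
  assert (He : 0 < / INR k) by (apply Rinv_0_lt_compat, lt_0_INR; lia).
  replace (x - x)%C with (RtoC 0) by ring; rewrite sinc_0, Cmult_1_r by exact He.
  clear; induction k as [|k IH]; simpl; [reflexivity|]. now rewrite IH, RtoC_mult.
Qed.

(** If the conclusion fails at every a then it fails at points x with |x| as large as
    desired: psi is nonzero somewhere, and that point enters every disc centred in
    a bounded set once a is large. This feeds [peak_exists]. *)
Lemma slowly_decreasing psi : Ehrenpreis_invertible psi ->
  exists a, 0 < a /\ forall x : R, exists z : C, Cmod (z - x) <= a * log_scale x /\
    exp (- (a * log_scale x)) <= Cmod (psi z).
Proof.
  intros ((S & HS & HF) & (z0 & Hz0) & Hdiv).
  apply compactly_supported_distribution_iff in HS; destruct HS as (N & A & c & HS).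
  apply NNPP; intros Hno.
  assert (Hbad : forall a B, exists x, B <= Rabs x /\
      forall z : C, Cmod (z - x) <= a * log_scale x -> Cmod (FL S z) <= exp (- (a * log_scale x))).
  { intros a B.
    assert (Hp : 0 < Cmod (psi z0)) by (apply Cmod_gt_0; exact Hz0).
    set (a' := Rmax (Rmax a 1) (Rmax (2 * (Cmod z0 + B)) (- 2 * ln (Cmod (psi z0))))).
    assert (Ha1 : a <= a') by (unfold a'; eapply Rle_trans; [apply Rmax_l | apply Rmax_l]).
    assert (Ha2 : 1 <= a') by (unfold a'; eapply Rle_trans; [apply Rmax_r | apply Rmax_l]).
    assert (Ha3 : 2 * (Cmod z0 + B) <= a') by (unfold a'; eapply Rle_trans; [apply Rmax_l |
      apply Rmax_r]).
    assert (Ha4 : - 2 * ln (Cmod (psi z0)) <= a') by (unfold a'; eapply Rle_trans; [apply Rmax_r |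
      apply Rmax_r]).
    assert (Hx : exists x : R, forall z : C, Cmod (z - x) <= a' * log_scale x ->
      Cmod (psi z) < exp (- (a' * log_scale x))).
    { apply NNPP; intros Hn; apply Hno; exists a'; split; [lra|]; intros x.
      apply NNPP; intros Hn2; apply Hn; exists x; intros z Hz.
      apply Rnot_le_lt; intros Hle; apply Hn2; exists z; split; assumption. }
    destruct Hx as (x & Hx); exists x; assert (Hlg := log_scale_ge_half x); split.
    - apply Rnot_lt_le; intros HxB.
      assert (Hz : Cmod (z0 - x) <= a' * log_scale x).
      { unfold Cminus; eapply Rle_trans; [apply Cmod_triangle|]; rewrite Cmod_opp, Cmod_R.
        nra. }
      specialize (Hx _ Hz).
      assert (Hlt : exp (- (a' * log_scale x)) <= Cmod (psi z0)); [|lra].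
      rewrite <- (exp_ln _ Hp); apply exp_le_mono; nra.
    - intros z Hz; change (FL S z) with (Fourier_Laplace S z); rewrite <- HF.
      assert (Hlt : Cmod (psi z) < exp (- (a' * log_scale x))) by (apply Hx; nra).
      left; eapply Rlt_le_trans; [exact Hlt|]; apply exp_le_mono; nra. }
  destruct (peak_exists N A c S HS Hbad) as (C0 & HC0 & Hpk).
  assert (Hpk' : forall j, exists p : R * nat * ((R -> C) -> C),
    (2 <= snd (fst p))%nat /\ (j <= snd (fst p))%nat /\ (exists n, snd (fst p) = (2 * n)%nat) /\
    (forall z, Cmod z <= INR j -> Cmod (2 * sinc (/ INR (snd (fst p))) (z - fst (fst p))) <= / 8) /\
    (2 + Rabs (fst (fst p))) ^ j <= 2 ^ (snd (fst p)) /\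
    distribution 0 (A + 2) (C0 * exp (- INR j)) (snd p) /\
    forall z, FL (snd p) z = (peak (fst (fst p)) (snd (fst p)) z * FL S z)%C).
  { intros j; destruct (Hpk j) as (x & k & T & H); exists (x, k, T); exact H. }
  destruct (nat_choice _ _ Hpk') as (p & Hp).
  set (xs := fun j => fst (fst (p j))); set (ks := fun j => snd (fst (p j))).
  set (Ts := fun j => snd (p j)).
  assert (Hloc := peak_local xs ks (fun j => conj (proj1 (Hp j)) (proj1 (proj2 (Hp j))))
    (fun j => proj1 (proj2 (proj2 (proj2 (Hp j)))))).
  set (q := fun z => CSeries (fun j => peak (xs j) (ks j) z)).
  assert (Hq : entire q) by (apply entire_series; exact Hloc).
  assert (Hqs : forall z, Csummable (fun j => peak (xs j) (ks j) z)).
  { intros z; destruct (Hloc (Cmod z + 1)) as (B & d & HB & Hb); [generalize (Cmod_ge_0 z); lra|].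
    exists B; split; [intros n; apply (Hb n z z); lra | exact HB]. }
  set (T := fun f => CSeries (fun j => Ts j f)).
  assert (Hgeo : ex_series (fun j => exp (- INR j))).
  { apply (ex_series_ext (fun j => exp (- (1)) ^ j)).
    - intros j; rewrite <- exp_INR_mult; f_equal; ring.
    - exists (/ (1 - exp (- (1)))); apply is_series_geom.
      rewrite Rabs_pos_eq by (left; apply exp_pos).
      apply Rlt_le_trans with (exp 0); [apply exp_increasing; lra | rewrite exp_0; lra]. }
  assert (HTd : forall j, distribution 0 (A + 2) (C0 * exp (- INR j)) (Ts j)) by (intros j; apply Hp).
  assert (HA : 0 <= A + 2) by (generalize (proj1 (proj2 (proj2 HS))); lra).
  assert (Hsum : forall f, smooth f -> Csummable (fun j => Ts j f)).
  { intros f Hf; destruct (Ccontinuous_bounded f (A + 2) HA (smooth_Ccontinuous f Hf)) as (B & HB).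
    exists (fun j => C0 * B * exp (- INR j)); split; [|now apply ex_series_Rscal].
    intros j; eapply Rle_trans; [apply (distribution0_bound _ _ _ f B (HTd j) Hf HB)|]; right; ring. }
  assert (HTq : forall z, FL T z = (q z * psi z)%C).
  { intros z; rewrite HF. change (FL T z) with (CSeries (fun j => FL (Ts j) z)).
    unfold q; rewrite Cmult_comm, <- CSeries_scal by apply Hqs.
    f_equal; apply functional_extensionality; intros j.
    unfold Ts, xs, ks; rewrite (proj2 (proj2 (proj2 (proj2 (proj2 (proj2 (Hp j))))))).
    change (Fourier_Laplace S z) with (FL S z); ring. }
  assert (HT : compactly_supported_distribution T).
  { apply compactly_supported_distribution_iff;
    exists O, (A + 2), (2 * C0 * Series (fun j => exp (- INR j))).
    assert (HS0 : 0 <= Series (fun j => exp (- INR j))).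
    { rewrite <- (Rmult_0_l (Series (fun j => exp (- INR j)))), <- Series_scal_l.
      apply Series_le; [|exact Hgeo]; intros n; generalize (exp_pos (- INR n)); lra. }
    split; [|split; [|split; [|split]]].
    - intros d e Hd He; unfold T.
      rewrite <- CSeries_plus by (apply Hsum; now apply jet_smooth).
      f_equal; apply functional_extensionality; intros j.
      apply (HTd j); assumption.
    - intros k d Hd; unfold T; rewrite <- CSeries_scal by (apply Hsum; now apply jet_smooth).
      f_equal; apply functional_extensionality; intros j.
      apply (HTd j); assumption.
    - exact HA.
    - apply Rmult_le_pos; lra.
    - intros d B Hd HB; unfold T.
      eapply Rle_trans; [apply (CSeries_bound _ (fun j => C0 * B * exp (- INR j)))|].
      + intros j; eapply Rle_trans; [apply (HTd j); [exact Hd | exact HB]|]; right; ring.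
      + now apply ex_series_Rscal.
      + rewrite Series_scal_l; right; ring. }
  destruct (Hdiv (FL T) q) as (Sq & HSq & HFq).
  - exists T; split; [exact HT | reflexivity].
  - exact Hq.
  - intros z Hz; rewrite HTq; field; exact Hz.
  - apply compactly_supported_distribution_iff in HSq; destruct HSq as (N' & A' & c' & HSq).
    (* At the centre of the j-th peak, with j = N' + n, the polynomial bound of
       order N' on q leaves a factor (2 + |x|)^n >= 2^n to be absorbed by c'. *)
    assert (Hgrow : forall n, 2 ^ n <= c').
    { intros n; set (j := (N' + n)%nat); set (x := xs j).
      assert (Hb := FL_growth N' A' c' Sq (RtoC x) HSq).
      change (FL Sq (RtoC x)) with (Fourier_Laplace Sq (RtoC x)) in Hb.
      rewrite <- HFq, Cmod_R in Hb; simpl Im in Hb.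
      rewrite Rabs_R0, Rmult_0_l, exp_0, Rmult_1_r in Hb.
      assert (Hre : 2 ^ (ks j) <= Cmod (q (RtoC x))).
      { eapply Rle_trans; [|apply Rabs_Re_le_Cmod].
        eapply Rle_trans; [|apply Rle_abs].
        replace (2 ^ ks j) with (Re (peak (xs j) (ks j) (RtoC x))).
        - unfold q, CSeries; simpl Re.
          apply (Series_ge_term (fun n => Re (peak (xs n) (ks n) (RtoC x))) j).
          + intros i; destruct (peak_real (xs i) (ks i) x) as (r & Hr & ->);
              [apply Hp | apply Hp | exact Hr].
          + destruct (Hqs (RtoC x)) as (g & Hg & Hgs).
            exact (proj1 (Cex_series _ g Hg Hgs)).
        - unfold x; rewrite peak_center by apply Hp; reflexivity. }
      assert (Hpow : (2 + Rabs x) ^ j <= 2 ^ (ks j)) by apply Hp.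
      assert (Hx0 := Rabs_pos x).
      assert (Hc' : 0 <= c') by apply HSq.
      assert (H1 : (2 + Rabs x) ^ n * (2 + Rabs x) ^ N' <= c' * (2 + Rabs x) ^ N').
      { rewrite <- pow_add, Nat.add_comm; fold j.
        eapply Rle_trans; [exact Hpow|]; eapply Rle_trans; [exact Hre|].
        eapply Rle_trans; [exact Hb|]; apply Rmult_le_compat_l; [exact Hc'|].
        apply pow_incr; lra. }
      apply Rmult_le_reg_r in H1; [|apply pow_lt; lra].
      eapply Rle_trans; [|exact H1]; apply pow_incr; lra. }
    destruct (INR_unbounded c') as (n & Hn).
    specialize (Hgrow n).
    assert (INR n <= 2 ^ n).
    { clear; induction n as [|n IH]; [simpl; lra|].
      rewrite S_INR; simpl.
      assert (1 <= 2 ^ n) by (apply pow_R1_Rle; lra). lra. }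
    lra.
Qed.

(** * Counting zeros *)

Lemma limsup_lt_p_infty (F : (R -> Prop) -> Prop) (f : R -> Rbar) :
  (forall P Q : R -> Prop, (forall x, P x -> Q x) -> F P -> F Q) ->
  Rbar_lt (limsup F f) p_infty -> exists M : R, F (fun x => Rbar_le (f x) (Finite M)).
Proof.
  intros Hmono Hlt; apply NNPP; intros Hno.
  assert (Hlb : Rbar_is_lower_bound (fun M : Rbar => F (fun x => Rbar_le (f x) M)) p_infty).
  { intros [M| |] HM; [exfalso; apply Hno; now exists M | exact Logic.I|].
    exfalso; apply Hno; exists 0; revert HM; apply Hmono; intros x Hx.
    destruct (f x); simpl in *; tauto. }
  apply (Rbar_lt_not_le _ _ Hlt).
  destruct (Rbar_ex_glb (fun M : Rbar => F (fun x => Rbar_le (f x) M))) as (g & Hg).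
  unfold limsup; rewrite (Rbar_is_glb_unique _ _ Hg); apply Hg, Hlb.
Qed.

Lemma limsup_le F f (M : Rbar) : F (fun x => Rbar_le (f x) M) -> Rbar_le (limsup F f) M.
Proof.
  intros HM.
  destruct (Rbar_ex_glb (fun M : Rbar => F (fun x => Rbar_le (f x) M))) as (g & Hg).
  unfold limsup; rewrite (Rbar_is_glb_unique _ _ Hg); apply Hg, HM.
Qed.

Lemma card_ge {I : Type} (P : I -> Prop) s : NoDup s -> (forall k, In k s -> P k) ->
  Rbar_le (INR (length s)) (card P).
Proof.
  intros H1 H2; unfold card.
  match goal with |- Rbar_le _ (Lub_Rbar ?X) => apply (proj1 (Lub_Rbar_correct X)) end.
  now exists s.
Qed.

Lemma card_le {I : Type} (P : I -> Prop) (B : R) :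
  (forall s, NoDup s -> (forall k, In k s -> P k) -> INR (length s) <= B) ->
  exists r, card P = Finite r /\ 0 <= r <= B.
Proof.
  intros H.
  assert (H1 : Rbar_le (card P) B).
  { unfold card.
    match goal with |- Rbar_le (Lub_Rbar ?X) _ => apply (proj2 (Lub_Rbar_correct X)) end.
    intros r (s & Hs & Hk & ->); now apply H. }
  assert (H0 := card_ge P nil (NoDup_nil _) (fun k (Hk : In k nil) => match Hk with end)).
  destruct (card P) as [r| |]; simpl in *; try tauto.
  exists r; split; [reflexivity | lra].
Qed.

Lemma entire_locally_bounded g z : entire g -> locally_bounded g z.
Proof.
  intros Hg.
  assert (Hc := ex_derive_continuous (K := C_AbsRing) (V := C_NormedModule) g z (Hg z)).
  assert (Hball : locally (g z) (fun v => ball (g z) 1 v)) by (exists (mkposreal 1 Rlt_0_1); auto).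
  apply Hc in Hball; destruct Hball as (d & Hd).
  exists d, (Cmod (g z) + 2 * 1); split; [apply cond_pos|]; intros w Hw.
  specialize (Hd w Hw); destruct Hd as [H1 H2].
  replace (g w) with (g z + (g w - g z))%C by ring.
  eapply Rle_trans; [apply Cmod_triangle|]; apply Rplus_le_compat_l.
  apply Cmod_le_ReIm; left; [exact H1 | exact H2].
Qed.

Lemma count_occ_map_le {I : Type} (mu : I -> C) s z : exists s', 
  length s' = count_occ C_eq_dec (map mu s) z /\ (NoDup s -> NoDup s') /\
  forall k, In k s' -> In k s /\ mu k = z.
Proof.
  exists (filter (fun k => if C_eq_dec (mu k) z then true else false) s); split; [|split].
  - induction s as [|k s IH]; simpl; [reflexivity|].
    destruct (C_eq_dec (mu k) z); simpl; rewrite ?IH; reflexivity.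
  - apply NoDup_filter.
  - intros k Hk; apply filter_In in Hk; destruct Hk as [H1 H2]; split; [exact H1|].
    destruct (C_eq_dec (mu k) z); [assumption | discriminate].
Qed.

(** A point occurs in the list at most as often as its order as a zero, because the
    list selects distinct indices. *)
Lemma zero_sequence_factor {I : Type} (mu : I -> C) N A c S psi s :
  distribution N A c S -> (forall z, psi z = FL S z) -> zero_sequence psi mu -> NoDup s ->
  forall z, FL S z = (rootprod (map mu s) z * FL (divided (map mu s) S) z)%C.
Proof.
  intros HS HF Hmu Hs; apply (FL_divided _ N A c S HS); intros z.
  destruct (Hmu z) as (m & (g & Hg & _ & Hgm) & Hcard).
  destruct (count_occ_map_le mu s z) as (s' & Hlen & Hnd & Hin).
  set (p := count_occ C_eq_dec (map mu s) z) in *.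
  assert (Hp : (p <= m)%nat).
  { assert (H := card_ge (fun k => mu k = z) s' (Hnd Hs) (fun k Hk => proj2 (Hin k Hk))).
    rewrite Hcard in H; simpl in H; apply INR_le in H; lia. }
  destruct (entire_locally_bounded g z Hg) as (d & B & Hd & HB).
  exists (fun w => Cpow (w - z) (m - p) * g w)%C; split.
  - exists (Rmin d 1), B; split; [apply Rmin_pos; lra|]; intros w Hw.
    rewrite Cmod_mult, Cmod_pow.
    assert (H1 : Cmod (g w) <= B) by (apply HB; eapply Rlt_le_trans; [exact Hw | apply Rmin_l]).
    assert (H2 : 0 <= Cmod (w - z) ^ (m - p) <= 1).
    { split; [apply pow_le, Cmod_ge_0|].
      rewrite <- (pow1 (m - p)); apply pow_incr; split; [apply Cmod_ge_0|].
      left; eapply Rlt_le_trans; [exact Hw | apply Rmin_r]. }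
    generalize (Cmod_ge_0 (g w)); nra.
  - intros w; rewrite <- HF, Hgm, Cmult_assoc; f_equal.
    replace m with (p + (m - p))%nat at 1 by lia.
    generalize (m - p)%nat; clear; intros n; induction p as [|p IH]; simpl; [ring|].
    rewrite IH; ring.
Qed.

Theorem theorem2p1 (l : R -> R)
  (l_ge1 : forall t : R, 0 <= t -> 1 <= l t)
  (l_nondecreasing : forall s t : R, 0 <= s -> s <= t -> l s <= l t)
  (ln_O_l : exists c : R,
     Rbar_locally p_infty (fun t => Rabs (ln t) <= c * Rabs (l t)))
  (l_growth : Rbar_lt
     (limsup (Rbar_locally p_infty) (fun t => Finite (ln (l t) / ln t)))
     (Finite (1 / 2)))
  (l_doubling : exists K : R, 1 < K /\
     Rbar_lt (limsup (Rbar_locally p_infty) (fun t => Finite (l (K * t) / l t)))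
             p_infty)
  (psi : C -> C) (psi_inv : Ehrenpreis_invertible psi)
  (I : Type) (mu : I -> C) (mu_zeros : zero_sequence psi mu)
  (M0 : R) (M0_gt0 : 0 < M0) :
  Rbar_lt
    (limsup abs_infty (fun x => Rbar_div (m_Re l M0 mu x) (Finite (l (Rabs x)))))
    p_infty.
Proof.
  destruct (slowly_decreasing psi psi_inv) as (a & Ha & Hsd).
  destruct psi_inv as ((S & HS & HF) & _ & _).
  apply compactly_supported_distribution_iff in HS; destruct HS as (N & A & cS & HS).
  destruct ln_O_l as (c0 & t0 & Hln).
  destruct l_doubling as (K & HK & Hdbl).
  apply limsup_lt_p_infty in Hdbl;
    [|intros P Q HPQ; apply filter_imp; exact HPQ].
  destruct Hdbl as (Q0 & t1 & Hdbl).
  set (c1 := Rabs c0); set (Q := Rabs Q0).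
  assert (Hc1 : 0 <= c1) by apply Rabs_pos.
  assert (HQ : 0 <= Q) by apply Rabs_pos.
  set (P := 1 + M0 * Q + 2 * a * c1).
  assert (HMQ : 0 <= M0 * Q) by (apply Rmult_le_pos; lra).
  assert (Hac : 0 <= a * c1) by (apply Rmult_le_pos; lra).
  assert (HP : 1 <= P) by (unfold P; lra).
  set (W := P + 2 * exp 1 * P).
  assert (He1 := exp_1_ge_2).
  assert (HW : 0 <= W) by (unfold W; nra).
  assert (HA : 0 <= A) by apply HS.
  assert (HcS : 0 <= cS) by apply HS.
  set (C4 := 2 * a * c1 + cS + INR N * (2 * c1 + W) + W * A).
  apply Rbar_le_lt_trans with (Finite C4); [|exact Logic.I].
  apply limsup_le.
  exists (Rmax (Rmax t0 t1) (Rmax 2 (/ (K - 1)))); intros x Hx.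
  set (t := Rabs x) in *.
  assert (Ht0 : t0 < t).
  { eapply Rle_lt_trans; [|exact Hx]; eapply Rle_trans; [apply Rmax_l | apply Rmax_l]. }
  assert (Ht1 : t1 < t).
  { eapply Rle_lt_trans; [|exact Hx]; eapply Rle_trans; [apply Rmax_r | apply Rmax_l]. }
  assert (Ht2 : 2 < t).
  { eapply Rle_lt_trans; [|exact Hx]; eapply Rle_trans; [apply Rmax_l | apply Rmax_r]. }
  assert (HtK : / (K - 1) < t).
  { eapply Rle_lt_trans; [|exact Hx]; eapply Rle_trans; [apply Rmax_r | apply Rmax_r]. }
  set (ell := l t).
  assert (Hell : 1 <= ell) by (apply l_ge1; lra).
  (* 2 + t <= t^2 for t > 2, and ln t = O(l t). *)
  assert (HL : log_scale x <= 2 * c1 * ell).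
  { unfold log_scale; fold t.
    assert (Hln2 : ln (2 + t) <= 2 * ln t).
    { replace (2 * ln t) with (ln t + ln t) by ring; rewrite <- ln_mult by lra.
      apply ln_le; nra. }
    specialize (Hln t Ht0); fold ell in Hln; rewrite (Rabs_pos_eq ell) in Hln by lra.
    assert (ln t <= c0 * ell) by (eapply Rle_trans; [apply Rle_abs | exact Hln]).
    assert (c0 * ell <= c1 * ell) by (apply Rmult_le_compat_r; [lra | apply Rle_abs]).
    lra. }
  (* t + 1 <= K t, so that doubling controls l on the interval around |x|. *)
  assert (Hl1 : l (t + 1) <= Q * ell).
  { apply Rle_trans with (l (K * t)).
    - apply l_nondecreasing; [lra|].
      apply (Rmult_lt_compat_l (K - 1)) in HtK; [|lra].
      rewrite Rinv_r in HtK by lra; lra.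
    - specialize (Hdbl t Ht1); simpl in Hdbl; fold ell in Hdbl.
      apply (Rmult_le_compat_r ell) in Hdbl; [|lra].
      replace (l (K * t) / ell * ell) with (l (K * t)) in Hdbl by (field; lra).
      assert (Q0 * ell <= Q * ell) by (apply Rmult_le_compat_r; [lra | apply Rle_abs]).
      lra. }
  destruct (card_le (fun k => low_zero l M0 (mu k) /\ x - 1 <= Re (mu k) <= x + 1) (C4 * ell))
    as (r & Hr & Hr0 & Hr1).
  2:{ unfold m_Re; rewrite Hr; simpl.
      apply (Rmult_le_reg_r ell); [lra|]; rewrite Rmult_assoc; fold ell.
      rewrite Rinv_l by lra; lra. }
  intros s Hnd Hs.
  destruct (Hsd x) as (z & Hzx & Hz).
  assert (Hzx' : Cmod (z - x) <= 2 * a * c1 * ell).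
  { eapply Rle_trans; [exact Hzx|].
    replace (2 * a * c1 * ell) with (a * (2 * c1 * ell)) by ring.
    apply Rmult_le_compat_l; lra. }
  assert (HPe : 2 * a * c1 * ell + (1 + M0 * Q * ell) <= P * ell).
  { unfold P; nra. }
  (* The radius P ell is the sum of the distance from z to x and of the distance
     from x to a counted zero. *)
  assert (Hmu : forall v, In v (map mu s) ->
     Cmod v <= t + P * ell /\ Rabs (Im v) <= P * ell /\ Cmod (z - v) <= P * ell).
  { intros v Hv; apply in_map_iff in Hv; destruct Hv as (k & <- & Hk).
    destruct (Hs k Hk) as (Hlow & Hre); set (v := mu k) in *.
    assert (Hre1 : Rabs (Re v - x) <= 1) by (apply Rabs_le; lra).
    assert (Hre2 : Rabs (Re v) <= t + 1).
    { replace (Re v) with (x + (Re v - x)) by ring.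
      eapply Rle_trans; [apply Rabs_triang|]; fold t; lra. }
    assert (Him : Rabs (Im v) <= M0 * Q * ell).
    { eapply Rle_trans; [exact Hlow|]; rewrite Rmult_assoc; apply Rmult_le_compat_l; [lra|].
      eapply Rle_trans; [|exact Hl1]; apply l_nondecreasing; [apply Rabs_pos | exact Hre2]. }
    assert (Hvx : Cmod (v - x) <= 1 + M0 * Q * ell).
    { replace (v - x)%C with (RtoC (Re v - x) + Ci * RtoC (Im v))%C.
      - eapply Rle_trans; [apply Cmod_triangle|].
        rewrite Cmod_mult, Cmod_Ci, !Cmod_R; lra.
      - destruct v; apply injective_projections; simpl; ring. }
    assert (0 <= 2 * a * c1 * ell) by nra.
    split; [|split].
    - replace v with ((v - x) + x)%C by ring.
      eapply Rle_trans; [apply Cmod_triangle|]; rewrite Cmod_R; fold t; lra.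
    - lra.
    - replace (z - v)%C with ((z - x) + - (v - x))%C by ring.
      eapply Rle_trans; [apply Cmod_triangle|]; rewrite Cmod_opp; lra. }
  assert (Hz1 : Cmod z <= t + P * ell).
  { replace z with ((z - x) + x)%C by ring.
    eapply Rle_trans; [apply Cmod_triangle|]; rewrite Cmod_R; fold t.
    assert (0 <= M0 * Q * ell) by nra. lra. }
  assert (Hz2 : Rabs (Im z) <= P * ell).
  { replace (Im z) with (Im (z - x)%C) by (simpl; unfold Im; ring).
    eapply Rle_trans; [apply Rabs_Im_le_Cmod|].
    assert (0 <= M0 * Q * ell) by nra. lra. }
  assert (HPl : 0 < P * ell) by nra.
  assert (Hsmall := many_zeros_small N A cS S (map mu s) z (t + P * ell) (P * ell) (P * ell)
     HS HPl (zero_sequence_factor mu N A cS S psi s HS HF mu_zeros Hnd z) Hmu Hz1 Hz2).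
  change (FL S z) with (Fourier_Laplace S z) in Hsmall.
  rewrite <- HF, length_map in Hsmall.
  set (n := INR (length s)) in *.
  assert (Hexp : exp (- (a * log_scale x)) <= exp (cS - n + INR N * (log_scale x + W * ell) + W * A
    * ell)).
  { eapply Rle_trans; [exact Hz|]; eapply Rle_trans; [exact Hsmall|].
    assert (HcSe : cS <= exp cS) by (generalize (exp_ineq1_le cS); lra).
    assert (Hpow : (1 + (t + P * ell) + 2 * exp 1 * (P * ell)) ^ N
                    <= exp (INR N * (log_scale x + W * ell))).
    { rewrite exp_INR_mult; apply pow_incr; split; [nra|].
      rewrite exp_plus, exp_log_scale; fold t.
      assert (Hwe : 1 + W * ell <= exp (W * ell)) by apply exp_ineq1_le.
      assert (0 <= W * ell) by nra.
      apply Rle_trans with ((2 + t) * (1 + W * ell)); [unfold W in *; nra|].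
      apply Rmult_le_compat_l; lra. }
    assert (Hlast : exp ((P * ell + 2 * exp 1 * (P * ell)) * A) = exp (W * A * ell)).
    { f_equal; unfold W; ring. }
    assert (Hpow0 : 0 <= (1 + (t + P * ell) + 2 * exp 1 * (P * ell)) ^ N) by (apply pow_le; nra).
    set (X := (1 + (t + P * ell) + 2 * exp 1 * (P * ell)) ^ N) in *.
    rewrite Hlast; unfold Rminus; rewrite !exp_plus, <- !Rmult_assoc.
    apply Rmult_le_compat_r; [left; apply exp_pos|].
    apply Rmult_le_compat; [|exact Hpow0| |exact Hpow].
    - apply Rmult_le_pos; [exact HcS | left; apply exp_pos].
    - apply Rmult_le_compat_r; [left; apply exp_pos | exact HcSe]. }
  assert (Hlin : - (a * log_scale x) <= cS - n + INR N * (log_scale x + W * ell) + W * A * ell).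
  { apply Rnot_lt_le; intros Hlt; apply exp_increasing in Hlt; lra. }
  assert (a * log_scale x <= a * (2 * c1 * ell)) by (apply Rmult_le_compat_l; lra).
  assert (INR N * (log_scale x + W * ell) <= INR N * (2 * c1 * ell + W * ell)).
  { apply Rmult_le_compat_l; [apply pos_INR | lra]. }
  assert (cS <= cS * ell) by nra.
  replace (C4 * ell) with (a * (2 * c1 * ell) + cS * ell + INR N * (2 * c1 * ell + W * ell) + W * A
    * ell)
    by (unfold C4; ring).
  lra.
Qed.
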